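(* Let $V \subset \mathbb{CP}^n$ be a subvariety of codimension $s$, given by one or several (nonzero) homogeneous polynomial equations of degrees $\leq d$. If $V$ contains all the nodes from a supra-simplicial set $\mathsf A$ of a $d^{\{n\}}$-cage $\mathsf K \subset \mathbb{CP}^n$, then $V$ is a complete intersection of the multi-degree $(\underbrace{d,\dots,d}_{s})$, and $V$ is smooth at each node of the cage $\mathsf K$. Thus, $\deg V = d^{\,n-\dim V}$.
   Context: ''Variety'' means algebraic set (no irreducibility is required). Cage: a $d^{\{n\}}$-cage $\mathsf K$ in $\mathbb P^n$ is a configuration of $n$ distinctly colored groups of hyperplanes, each group consisting of $d$ hyperplanes, such that $\mathsf K$ generates exactly $d^n$ points where hyperplanes of all $n$ distinct colors intersect transversally. (Thus any $n$ hyperplanes of pairwise distinct colors are in general position and meet in one point, and the $d^n$ points so obtained are distinct.) These $d^n$ points are the nodes of $\mathsf K$. Supra-simplicial set: after ordering the hyperplanes $H_{j,1},\dots,H_{j,d}$ within each color $j\in\{1,\dots,n\}$, each node is $p_I=\bigcap_j H_{j,i_j}$ for a unique multi-index $I=(i_1,\dots,i_n)$ with $1\le i_j\le d$. Put $\|I\|=i_1+\dots+i_n$. A set of nodes is supra-simplicial if, for some orderings of the hyperplanes in each group, it equals $\{p_I : \|I\|\le d+n\}$ (always with $1\le i_j\le d$). Complete intersection: a purely $(n-k)$-dimensional Zariski closed subset $V\subset\mathbb P^n$ over a field of characteristic zero is a complete intersection of type (multi-degree) $(d_1,\dots,d_k)$ if $V$ is an intersection of hypersurfaces $H_1,\dots,H_k$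 in $\mathbb P^n$ of degrees $d_1,\dots,d_k$ such that, at a generic (nonsingular) point $x$ of each component of $V$, the tangent hyperspaces $T_xH_1,\dots,T_xH_k$ are in general position in $T_x\mathbb P^n$. *)

(* Defs.v *)
From mathcomp Require Import all_boot all_order all_algebra all_fingroup.
From mathcomp Require Export complex mpoly.
From mathcomp Require Export boolp classical_sets functions cardinality reals.

Set Implicit Arguments.
Unset Strict Implicit.
Unset Printing Implicit Defensive.

Import Order.TTheory GRing.Theory Num.Theory.
Local Open Scope classical_set_scope.
Local Open Scope card_scope.
Local Open Scope ring_scope.

(* P^n as the set of lines through the origin of F^(n+1): since equality of
   {vspace _} is equality of subspaces, Leibniz equality is equality of
   projective points. *)
Definition proj (F : fieldType) (n : nat) :=
  {x : {vspace 'rV[F]_n.+1} | \dim x == 1%N}.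

Section AlgebraicSets.
Variables (F : closedFieldType) (n : nat).
Implicit Types (f g : {mpoly F[n.+1]}) (S : set {mpoly F[n.+1]}).
Implicit Types (x : proj F n) (V W Z : set (proj F n)).

Definition homogeneous f := exists e, f \is e.-homog.

(* Quantifying over all vectors of the line x avoids choosing homogeneous
   coordinates; for homogeneous f one nonzero vector decides. *)
Definition vanishes f x := forall u, u \in val x -> f.@[u 0] = 0.

Definition zero_set S : set (proj F n) :=
  [set x | forall f, S f -> vanishes f x].

Definition zariski_closed V :=
  exists2 S, (forall f, S f -> homogeneous f) & V = zero_set S.

Definition irreducible W :=
  [/\ zariski_closed W, W !=set0 &
      forall Z1 Z2, zariski_closed Z1 -> zariski_closed Z2 ->
        W `<=` Z1 `|` Z2 -> W `<=` Z1 \/ W `<=` Z2].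

(* A strict chain c 0 < c 1 < ... < c k of irreducible closed subsets of V. *)
Definition irreducible_chain V k (c : nat -> set (proj F n)) :=
  [/\ forall i, (i <= k)%N -> irreducible (c i),
      forall i, (i < k)%N -> c i `<` c i.+1 &
      c k `<=` V].

(* Krull dimension; the empty set has no dimension in nat. *)
Definition has_dim V k :=
  (exists c, irreducible_chain V k c) /\
  (forall m c, irreducible_chain V m c -> (m <= k)%N).

Definition has_codim V s := exists2 k, has_dim V k & (k + s = n)%N.

Definition component V W :=
  [/\ irreducible W, W `<=` V &
      forall W', irreducible W' -> W' `<=` V -> W `<=` W' -> W' = W].

Definition pure_dim V k := forall W, component V W -> has_dim W k.

Definition local_dim V x k :=
  (exists W, [/\ component V W, W x & has_dim W k]) /\
  (forall W m, component V W -> W x -> has_dim W m -> (m <= k)%N).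

(* Q holds at all points of a nonempty Zariski open subset of W. *)
Definition generically W (Q : proj F n -> Prop) :=
  exists Z, [/\ zariski_closed Z, ~ (W `<=` Z) &
                forall x, W x -> ~ Z x -> Q x].

Definition differential f (u v : 'rV[F]_n.+1) : F :=
  \sum_(i < n.+1) (f^`M(i)).@[u 0] * v 0 i.

(* Tangent vectors at x to {f = 0}, lifted to F^(n+1): by Euler's identity this
   subspace contains the line x, and T_x is its quotient by x (twisted).  Hence
   linear dimensions below exceed those of tangent spaces by one. *)
Definition tangent f x : set 'rV[F]_n.+1 :=
  [set v | forall u, u \in val x -> differential f u v = 0].

Definition has_linear_dim (T : set 'rV[F]_n.+1) k :=
  exists2 U : {vspace 'rV[F]_n.+1}, T = [set v | v \in U] & \dim U = k.

Definition vanishing_ideal V : set {mpoly F[n.+1]} :=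
  [set f | homogeneous f /\ forall x, V x -> vanishes f x].

Definition zariski_tangent V x : set 'rV[F]_n.+1 :=
  [set v | forall f, vanishing_ideal V f -> tangent f x v].

Definition smooth_at V x :=
  V x /\ exists2 k, local_dim V x k & has_linear_dim (zariski_tangent V x) k.+1.

(* f is a reduced equation of a hypersurface of degree e, so that e is the
   degree of the algebraic set {f = 0}. *)
Definition hypersurface_equation e f :=
  [/\ (0 < e)%N, f != 0, f \is e.-homog &
      forall g h, f = g ^+ 2 * h -> (msize g <= 1)%N].

(* Hyperplanes in T_x P^n are in general position when they intersect in
   codimension k, their number. *)
Definition tangents_in_general_position k (f : 'I_k -> {mpoly F[n.+1]}) x :=
  exists2 m : nat, has_linear_dim [set v | forall i, tangent (f i) x v] m &
             (m + k = n.+1)%N.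

Definition complete_intersection V k (e : k.-tuple nat) :=
  [/\ zariski_closed V,
      exists2 m, pure_dim V m & (m + k = n)%N &
      exists f : 'I_k -> {mpoly F[n.+1]},
        [/\ forall i, hypersurface_equation (tnth e i) (f i),
            V = \bigcap_i zero_set [set f i] &
            forall W, component V W ->
              generically W (fun x =>
                smooth_at V x /\ tangents_in_general_position f x)]].

(* The columns of l are k linear forms on F^(n+1). *)
Definition linear_section k (l : 'M[F]_(n.+1, k)) : set (proj F n) :=
  [set x : proj F n | forall u, u \in val x -> u *m l = 0].

(* The degree of V is the number of points in which V meets the intersection
   of dim V generic hyperplanes. *)
Definition has_degree V delta :=
  exists2 k, has_dim V k &
    exists2 G : {mpoly F[n.+1 * k]}, G != 0 &
      forall l : 'M[F]_(n.+1, k), G.@[mxvec l 0] != 0 ->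
        V `&` linear_section l #= `I_delta.

End AlgebraicSets.

(* Hyperplanes of P^n are the n-dimensional subspaces of F^(n+1); n of them are
   in general position iff they meet in a 1-dimensional subspace. *)
Record cage (F : fieldType) (n d : nat) := Cage {
  hyperplane : 'I_n -> 'I_d -> {vspace 'rV[F]_n.+1};
  hyperplane_dim : forall j i, \dim (hyperplane j i) = n;
  cage_transversal : forall I : {ffun 'I_n -> 'I_d},
    \dim (\bigcap_(j < n) hyperplane j (I j))%VS == 1%N;
  cage_distinct : injective (fun I : {ffun 'I_n -> 'I_d} =>
    (\bigcap_(j < n) hyperplane j (I j))%VS)
}.

Definition node (F : fieldType) (n d : nat) (K : cage F n d)
    (I : {ffun 'I_n -> 'I_d}) : proj F n :=
  exist _ (\bigcap_(j < n) hyperplane K j (I j))%VS (cage_transversal K I).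

(* The orderings are the permutations o j; indices in 'I_d start at 0, whence
   the successors. *)
Definition supra_simplicial (F : fieldType) (n d : nat) (K : cage F n d)
    (A : set (proj F n)) :=
  exists o : 'I_n -> {perm 'I_d},
    A = [set node K [ffun j => o j (I j)] | I in
          [set I : {ffun 'I_n -> 'I_d} |
            (\sum_(j < n) (I j).+1 <= d + n)%N]].

(* Main.v *)
(* Let L_j be the product of the d linear forms of colour j.  A form of degree
   at most d vanishing on a supra-simplicial set of nodes is a linear
   combination of the L_j, so V is cut out by r independent combinations
   g_1, ..., g_r, which choosing r pivot colours completes by k = n - r forms
   L_j to a system with the same span as all the L_j.  The n forms of this
   system meet exactly in the nodes, transversally, and generate the ideal of
   the nodes.  Lifting arcs at the nodes, one deduces that a homogeneous
   polynomial in lam^d (lam a linear form vanishing at no node) and the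
   remaining L_j is regular modulo (g_1, ..., g_r); hence on each component of
   V these k + 1 forms are algebraically independent.  They have no common zero
   on V, so each component has dimension k and contains a node, where the
   differentials of g_1, ..., g_r are independent.  This gives purity,
   smoothness and transversality.  For the degree, two transversal systems of n
   forms with the same degrees have equally many zeros, and V meets the k
   hyperplanes numbered 0 of the other colours in d^r nodes.

   Everything rests on the Nullstellensatz over an uncountable algebraically
   closed field; dimension is controlled by algebraically independent forms. *)

Require Import Defs.
From mathcomp Require Import all_boot all_order all_algebra.
From mathcomp Require Import complex mpoly boolp classical_sets reals.
From mathcomp Require Import cardinality perm.
From mathcomp Require Import zify ring lra.

Set Implicit Arguments.
Unset Strict Implicit.
Unset Printing Implicit Defensive.
Import Order.TTheory GRing.Theory Num.Theory.
Local Open Scope classical_set_scope.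
Local Open Scope ring_scope.

(** * The Nullstellensatz *)

(** The bound d + n is a dimension count. With indices from 0 it reads sum I_k <= d; all C(d+n, n)
    points of that simplex would determine a form of degree d, but the n vertices I_k = d are
    missing because indices stop at d - 1. So the vanishing forms have dimension n, and the n
    products L_j fill that space. The obstacle is a component of V that might avoid every node,
    since arcs and differentials only see the nodes. The bridge is global: the n forms generate the
    whole ideal of the nodes, so vanishing at the nodes becomes membership in an ideal, one order at
    a time, until degree reasons end the descent. The resulting regularity holds along all of V and
    so reaches every component. The form lam enters as lam^d to give all k + 1 parameters one common
    degree, which makes the cone over a component surject onto affine (k+1)-space. The comparison of
    numbers of zeros rests on growth rates: up to lower order terms, a transversal system with t
    zeros needs t copies of the monomials in its forms to span the forms of a given degree. *)

Definition has_many (T : eqType) (A : set T) :=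
  forall k, exists s : seq T, [/\ uniq s, size s = k & forall a, a \in s -> A a].

(* Stated as a pigeonhole principle: countably many sets covering the field
   cannot all be finite. *)
Definition uncountable_field (F : fieldType) :=
  forall A : nat -> set F, (forall a, exists n, A n a) -> exists n, has_many (A n).

Lemma not_has_many (T : eqType) (A : set T) :
  ~ has_many A -> exists L : seq T, forall a, A a -> a \in L.
Proof.
move=> /existsNP [k].
pose Q j := `[< exists s : seq T, [/\ uniq s, size s = j & forall a, a \in s -> A a] >].
move=> nk; have Q0 : exists j, Q j by exists 0%N; apply/asboolP; exists [::].
have Qle j : Q j -> (j <= k)%N.
  move=> /asboolP [s [us ss sA]]; rewrite leqNgt; apply/negP => lt_kj; apply: nk.
  exists (take k s); split; first exact: take_uniq.
    by rewrite size_take ss lt_kj.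
  by move=> a /mem_take; exact: sA.
case: (ex_maxnP Q0 Qle) => j /asboolP [s [us ss sA]] jmax.
exists s => a Aa; apply/negPn/negP => as_; have := jmax j.+1.
rewrite ltnn => /(_ _) H; suff: false by []; apply: H.
apply/asboolP; exists (a :: s); rewrite /= as_ us ss; split=> // b.
by rewrite inE => /orP[/eqP->|/sA].
Qed.

Lemma avoid_interval (R : realFieldType) (L : seq R) (a b : R) : a < b ->
  exists c d, [/\ a <= c, c < d, d <= b & forall x, c <= x <= d -> x \notin L].
Proof.
move=> ab; elim: L => [|y L [c [d [ac cd db H]]]]; first by exists a, b.
(* The part away from [y] is kept. When [y] may equal the midpoint, the right end moves further, to
   (3c + d)/4, so that the closed interval still misses [y]. *)
have [yc|cy] := ltrP y ((c + d) / 2).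
- exists ((c + d) / 2), d; split; [lra|lra|by []|] => x /andP[x1 x2].
  rewrite inE negb_or; apply/andP; split; last by apply: H; apply/andP; lra.
  by rewrite gt_eqF //; lra.
- exists c, ((3 * c + d) / 4); split; [by []|lra|lra|] => x /andP[x1 x2].
  rewrite inE negb_or; apply/andP; split; last by apply: H; apply/andP; lra.
  by rewrite lt_eqF //; lra.
Qed.

(** Cantor's nested intervals: the closed interval chosen at stage n avoids [L n], and the supremum
    of the left ends lies in all of them. *)
Lemma reals_not_covered (R : realType) (L : nat -> seq R) :
  exists x, forall n, x \notin L n.
Proof.
pose T := {p : R * R | p.1 < p.2}.
have /choice [st Hst] : forall q : nat * T, exists p : T,
   [/\ (val q.2).1 <= (val p).1, (val p).2 <= (val q.2).2 &
     forall x, (val p).1 <= x <= (val p).2 -> x \notin L q.1].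
  move=> [n [[a b] /= ab]].
  have [c [d [ac cd db H]]] := avoid_interval (L n) ab.
  by exists (exist (fun p : R * R => p.1 < p.2) (c, d) cd).
have lt01 : ((0, 1) : R * R).1 < ((0, 1) : R * R).2 by rewrite /= ltr01.
pose I := fix I n : T := if n is m.+1 then st (m, I m)
  else exist (fun p : R * R => p.1 < p.2) (0, 1) lt01.
have mono n m : (n <= m)%N -> (val (I n)).1 <= (val (I m)).1 /\
   (val (I m)).2 <= (val (I n)).2.
  move=> /subnKC <-; elim: (m - n)%N => [|j [h1 h2]]; first by rewrite addn0.
  rewrite addnS /=; have [g1 g2 _] := Hst ((n + j)%N, I (n + j)%N).
  by split; [exact: le_trans g1|exact: le_trans h2].
have bnd n m : (val (I n)).1 <= (val (I m)).2.
  have [nm|mn] := leqP n m.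
    have [h _] := mono _ _ nm; apply: le_trans h _; apply: ltW; exact: (valP (I m)).
  have [_ h] := mono _ _ (ltnW mn); apply: le_trans _ h; apply: ltW; exact: (valP (I n)).
pose E := range (fun n => (val (I n)).1).
have E0 : E !=set0 by exists (val (I 0%N)).1; exists 0%N.
have ub : has_ubound E by exists (val (I 0%N)).2 => _ [n _ <-].
exists (sup E) => n; have [_ _] := Hst (n, I n); apply.
apply/andP; split; first by apply: (ub_le_sup ub); exists n.+1.
by apply: (ge_sup E0) => _ [m _ <-]; exact: (bnd m n.+1).
Qed.

Lemma uncountable_complex (R : realType) : uncountable_field R[i].
Proof.
move=> A cov; apply: contrapT => /forallNP nA.
have /choice [L HL] n := not_has_many (nA n).
have [x Hx] := reals_not_covered (fun n => map (@complex.Re R) (L n)).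
have [n /HL xL] := cov (x%:C)%C.
by have /negP := Hx n; apply; rewrite -[x]/(complex.Re (x%:C)%C) map_f.
Qed.

(** * Polynomials determined by their values *)

Section PolynomialFunctions.
Variable F : closedFieldType.

(** If [p] were nonzero, ['X * p - 1] would be nonconstant and have a root x; then x is nonzero and
    p(x) = 1/x does not vanish. *)
Lemma poly_eq0_nz (p : {poly F}) : (forall x, x != 0 -> p.[x] = 0) -> p = 0.
Proof.
move=> p0; apply/eqP/negPn/negP => pN0.
have : size ('X * p - 1) != 1%N.
  rewrite size_polyDl; first by rewrite mulrC size_mulX // eqSS size_poly_eq0.
  by rewrite size_polyN size_poly1 mulrC size_mulX // ltnS lt0n size_poly_eq0.
move=> /closed_rootP [x]; rewrite rootE !hornerE subr_eq0 => /eqP xp.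
have [x0|/p0 px] := eqVneq x 0.
  by move/eqP: xp; rewrite x0 mul0r eq_sym oner_eq0.
by move/eqP: xp; rewrite px mulr0 eq_sym oner_eq0.
Qed.

Lemma poly_eq0_fun (p : {poly F}) : (forall x, p.[x] = 0) -> p = 0.
Proof. by move=> p0; apply: poly_eq0_nz. Qed.

End PolynomialFunctions.

Local Notation widen := (widen_ord (leqnSn _)).

Lemma widen_lift k (j : 'I_k) : widen j = lift ord_max j.
Proof. by apply/val_inj; rewrite /= /bump leqNgt ltn_ord. Qed.

Lemma muni_coef (R : ringType) k (p : {mpoly R[k.+1]}) (m : 'X_{1..k.+1}) :
  ((muni p)`_(m ord_max))@_[multinom (m (widen i)) | i < k] = p@_m.
Proof.
rewrite muniE coef_sum raddf_sum /= [in RHS](mpolyE p) raddf_sum /=.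
apply: eq_bigr => m' _; rewrite !coefZ coefXn !mcoeffZ mcoeffX.
have -> : (m' == m) = ((m ord_max == m' ord_max) &&
  ([multinom m' (widen i) | i < k] == [multinom m (widen i) | i < k])).
  apply/eqP/andP => [->|[/eqP h1 /eqP h2]]; first by rewrite !eqxx.
  apply/mnmP => i; have [j ->|->] := unliftP ord_max i; last by rewrite h1.
  have := congr1 (fun q : 'X_{1..k} => q j) h2; rewrite !mnmE.
  by rewrite -widen_lift.
case: (m ord_max == m' ord_max); last by rewrite /= mulr0 mcoeff0 mulr0.
by rewrite mulr1 mcoeffZ mcoeffX andTb.
Qed.

Lemma muni_eq0 (R : ringType) k (p : {mpoly R[k.+1]}) : muni p = 0 -> p = 0.
Proof.
by move=> p0; apply/mpolyP => m; rewrite -muni_coef p0 coef0 !mcoeff0.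
Qed.

Lemma meval_muni (R : comRingType) k (p : {mpoly R[k.+1]}) (a : 'I_k.+1 -> R) :
  p.@[a] = (map_poly (meval (fun i => a (widen i))) (muni p)).[a ord_max].
Proof.
rewrite mevalE muniE rmorph_sum /= horner_sum; apply: eq_bigr => m _.
rewrite -!mul_polyC !rmorphM /= !map_polyC /= map_polyXn !hornerE /=.
rewrite -mul_mpolyC mevalM mevalC mevalX big_ord_recr /=.
by rewrite -mulrA; congr (_ * (_ * _)); apply: eq_bigr => i _; rewrite mnmE.
Qed.

Lemma mpoly_eq0_fun (F : closedFieldType) k (p : {mpoly F[k]}) :
  (forall a, p.@[a] = 0) -> p = 0.
Proof.
elim: k p => [|k IH] p p0.
  by rewrite (nvar0_mpolyC p); have := p0 (fun=> 0); rewrite {1}(nvar0_mpolyC p) mevalC => ->.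
apply: muni_eq0; apply/polyP => j; rewrite coef0; apply: IH => a.
suff /polyP/(_ j) : map_poly (meval a) (muni p) = 0 by rewrite coef_map coef0.
apply: poly_eq0_fun => x.
pose b (i : 'I_k.+1) := if unlift ord_max i is Some j then a j else x.
have bw i : b (widen i) = a i.
  by rewrite /b widen_lift liftK.
have := p0 b; rewrite meval_muni {2}/b unlift_none.
suff -> : map_poly (meval (fun i => b (widen i))) (muni p) = map_poly (meval a) (muni p) by [].
by apply: eq_map_poly => q; apply: meval_eq.
Qed.

Lemma mpoly_neq0_fun (F : closedFieldType) k (p : {mpoly F[k]}) :
  p != 0 -> exists a, p.@[a] != 0.
Proof.
move=> pN0; apply: contrapT => /forallNP h; move/eqP: pN0; apply.
by apply: mpoly_eq0_fun => a; apply/eqP/negPn/negP; exact: h.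
Qed.

(** * Ideals and congruences *)

Definition is_ideal (S : comNzRingType) (I : set S) :=
  [/\ I 0, forall f g, I f -> I g -> I (f + g) & forall f g, I g -> I (f * g)].

Section Ideals.
Variables (S : comNzRingType) (I : set S).
Hypothesis idI : is_ideal I.

Lemma ideal0 : I 0. Proof. by case: idI. Qed.
Lemma idealD f g : I f -> I g -> I (f + g). Proof. by case: idI => _ + _; apply. Qed.
Lemma idealMl f g : I g -> I (f * g). Proof. by case: idI => _ _; apply. Qed.
Lemma idealMr f g : I g -> I (g * f). Proof. by rewrite mulrC; apply: idealMl. Qed.
Lemma idealN f : I f -> I (- f). Proof. by rewrite -mulN1r; apply: idealMl. Qed.
Lemma idealB f g : I f -> I g -> I (f - g).
Proof. by move=> If Ig; apply: idealD => //; apply: idealN. Qed.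
Lemma ideal_sum (T : Type) (r : seq T) (Q : pred T) (h : T -> S) :
  (forall i, Q i -> I (h i)) -> I (\sum_(i <- r | Q i) h i).
Proof. by move=> H; apply: big_ind => //; [exact: ideal0|exact: idealD]. Qed.

Lemma idealMcong a b c d : I (a - b) -> I (c - d) -> I (a * c - b * d).
Proof.
move=> h1 h2; have -> : a * c - b * d = c * (a - b) + b * (c - d) by ring.
by apply: idealD; apply: idealMl.
Qed.

Lemma idealXcong a b e : I (a - b) -> I (a ^+ e - b ^+ e).
Proof.
move=> ab; elim: e => [|e IH]; first by rewrite !expr0 subrr; apply: ideal0.
by rewrite !exprS; apply: idealMcong.
Qed.

Lemma mmap1_cong k (x y : 'I_k -> S) (m : 'X_{1..k}) :
  (forall i, I (x i - y i)) -> I (mmap1 x m - mmap1 y m).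
Proof.
move=> xy; rewrite /mmap1.
elim/big_rec2: _ => [|i u v _ H]; first by rewrite subrr; apply: ideal0.
by apply: idealMcong => //; apply: idealXcong.
Qed.

Lemma mmap_cong (R : comNzRingType) k (phi : {rmorphism R -> S}) (x y : 'I_k -> S)
    (f : {mpoly R[k]}) :
  (forall i, I (x i - y i)) -> I (mmap phi x f - mmap phi y f).
Proof.
move=> xy; rewrite /mmap -sumrB; apply: ideal_sum => m _.
by rewrite -mulrBr; apply: idealMl; apply: mmap1_cong.
Qed.

End Ideals.

(** The ideal generated by the finite family [h]: the coefficients [w] are ring elements, not
    scalars. *)
Definition in_span_of (S : comNzRingType) (T : finType) (h : T -> S) (f : S) :=
  exists w : T -> S, f = \sum_t h t * w t.

Lemma in_span_ideal (S : comNzRingType) (T : finType) (h : T -> S) :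
  is_ideal [set f | in_span_of h f].
Proof.
split; first by exists (fun=> 0); rewrite big1 // => i _; rewrite mulr0.
  move=> f g [w1 ->] [w2 ->]; exists (fun i => w1 i + w2 i).
  by rewrite -big_split /=; apply: eq_bigr => i _; rewrite mulrDr.
move=> f g [w1 ->]; exists (fun i => f * w1 i).
by rewrite mulr_sumr; apply: eq_bigr => i _; rewrite mulrCA.
Qed.

Lemma in_span_gen (S : comNzRingType) (T : finType) (h : T -> S) i : in_span_of h (h i).
Proof.
exists (fun j => (j == i)%:R); rewrite (bigD1 i) //= eqxx mulr1 big1 ?addr0 // => j /negPf ->.
by rewrite mulr0.
Qed.

Lemma dependent_family (F : fieldType) (T1 T2 : finType) (c : T1 -> T2 -> F) :
  (#|T2| < #|T1|)%N ->
  exists2 p : T1 -> F, (exists t, p t != 0) & forall j, \sum_t p t * c t j = 0.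
Proof.
move=> lt; pose M : 'M[F]_(#|T1|, #|T2|) := \matrix_(i, j) c (enum_val i) (enum_val j).
have /matrix0Pn [i [j Kij]] : kermx M != 0.
  by rewrite kermx_eq0 /row_free ltn_eqF // (leq_ltn_trans (rank_leq_col M)).
exists (fun t => kermx M i (enum_rank t)); first by exists (enum_val j); rewrite enum_valK.
move=> t; have /matrixP/(_ i (enum_rank t)) := mulmx_ker M.
rewrite !mxE => H; rewrite -[RHS]H (reindex (@enum_val _ predT)) /=; last first.
  by apply: onW_bij; apply: enum_val_bij.
by apply: eq_bigr => s _; rewrite enum_valK [M _ _]mxE enum_rankK.
Qed.

Section Nullstellensatz.
Variables (F : closedFieldType) (Func : uncountable_field F) (k : nat).
Implicit Types (I : set {mpoly F[k]}) (f g : {mpoly F[k]}).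

Section PrimeAvoidingPowers.
Variables (P : set {mpoly F[k]}) (f : {mpoly F[k]}).
Hypothesis idP : is_ideal P.
Hypothesis fP : forall N, ~ P (f ^+ N).
Hypothesis maxP : forall g, ~ P g -> exists N u, P (f ^+ N - u * g).

(** [maxP] expresses that [P] is maximal among the ideals free of powers of [f]: some power lies in
    P + (g). With [a] and [b] both outside [P], the product of two such powers would lie in P + (ab)
    = P. *)
Lemma avoiding_prime a b : P (a * b) -> P a \/ P b.
Proof.
move=> Pab; case: (pselect (P a)) => [|na]; [by left|].
case: (pselect (P b)) => [|nb]; [by right|].
have [N [u Hu]] := maxP na; have [M [v Hv]] := maxP nb.
case: (fP (N := (N + M)%N)); rewrite exprD.
have -> : f ^+ N * f ^+ M = (f ^+ N * f ^+ M - (u * a) * (v * b)) + (u * v) * (a * b) by ring.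
by apply: (idealD idP); [apply: (idealMcong idP)|apply: (idealMl idP)].
Qed.

(** Over a closed field [q] splits into linear factors, and primality puts one of the g - r into
    [P]; the multiplier [h] is cancelled on the way. *)
Lemma avoiding_split (q : {poly F}) g h : q != 0 -> ~ P h ->
  P (h * (map_poly (@mpolyC k F) q).[g]) -> exists r, P (g - r%:MP).
Proof.
move=> q0 nh; have [rs Hrs] := closed_field_poly_normal q.
have lq : lead_coef q != 0 by rewrite lead_coef_eq0.
suff : P (h * \prod_(z <- rs) (g - z%:MP)) -> exists r, P (g - r%:MP).
  move=> H Pq; apply: H.
  have E : (map_poly (@mpolyC k F) q).[g] =
    (lead_coef q)%:MP * \prod_(z <- rs) (g - z%:MP).
    rewrite {1}Hrs map_polyZ /= rmorph_prod /= hornerZ horner_prod; congr (_ * _).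
    by apply: eq_bigr => z _; rewrite rmorphB /= map_polyX map_polyC /= !hornerE.
  have -> : h * \prod_(z <- rs) (g - z%:MP) =
    (lead_coef q)^-1%:MP * (h * (map_poly (@mpolyC k F) q).[g]).
    by rewrite E -[LHS]mul1r -mpolyC1 -(mulVf lq) mpolyCM; ring.
  exact: (idealMl idP).
elim: rs {Hrs} h nh => [|z rs IH] h nh; first by rewrite big_nil mulr1.
rewrite big_cons mulrA => /avoiding_prime [/avoiding_prime [//|]|].
  by exists z.
move=> H; apply: (IH 1) => [|]; first exact: (fP (N := 0%N)).
by rewrite mul1r.
Qed.

(* If no residue existed, each X_i - a would divide a power of f modulo P; for
   infinitely many a with the same power and cofactors of bounded degree, the
   cofactors are linearly dependent, which yields a relation to which
   [avoiding_split] applies. *)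
Lemma avoiding_residue (i : 'I_k) : exists a, P ('X_i - a%:MP).
Proof.
apply: contrapT => /forallNP na.
(* A countable cover: [a] has class (N, s) when f^N is a multiple of X_i - a modulo [P] with a
   cofactor of size at most s. *)
pose A n : set F := fun a => if (unpickle n : option (nat * nat)) is Some (N, s) then
  exists2 u : {mpoly F[k]}, (msize u <= s)%N & P (f ^+ N - u * ('X_i - a%:MP)) else False.
have [|n] := Func (A := A).
  move=> a; have [N [u Hu]] := maxP (na a).
  by exists (pickle (N, msize u)); rewrite /A pickleK; exists u.
rewrite /A; case: unpickle => [[N s]|]; last first.
  by move=> /(_ 1%N) [[|a s] [_ // _ /(_ a)]]; rewrite inE eqxx => /(_ isT).
move=> /(_ (#|{: 'X_{1..k < s}}|.+1)) [as_ [uas sas Has]].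
pose a (j : 'I_(#|{: 'X_{1..k < s}}|.+1)) := as_`_j.
have ainj : injective a.
  move=> x y /eqP; rewrite /a nth_uniq ?sas ?ltn_ord //.
  by move/eqP/val_inj.
have /choice [u Hu] j : exists u : {mpoly F[k]},
    (msize u <= s)%N /\ P (f ^+ N - u * ('X_i - (a j)%:MP)).
  have aj : a j \in as_ by rewrite mem_nth ?sas.
  by have [u u1 u2] := Has _ aj; exists u.
have [|p [j0 pj0] Hp] := @dependent_family F 'I_(#|{: 'X_{1..k < s}}|.+1)
  ('X_{1..k < s}) (fun j m => (u j)@_m).
  by rewrite card_ord.
(* Multiplying f^N = u_j (X_i - a_j) by p_j and the other linear factors, then summing, gives f^N
   q(X_i) = W * sum_j p_j u_j = 0 modulo [P]. At a_j0 only the term j0 of [q] survives, so [q] is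
   nonzero. *)
pose q : {poly F} := \sum_j p j *: \prod_(l | l != j) ('X - (a l)%:P).
have q0 : q != 0.
  have qj0 : q.[a j0] = p j0 * \prod_(l | l != j0) (a j0 - a l).
    rewrite horner_sum (bigD1 j0) //= hornerZ horner_prod.
    under eq_bigr do rewrite !hornerE.
    rewrite [X in _ + X]big1 ?addr0 // => j jj0.
    rewrite hornerZ horner_prod (bigD1 j0) 1?eq_sym //= !hornerE. by rewrite /= subrr mulr0 mul0r.
  apply/eqP => q0; move/eqP: qj0; rewrite q0 horner0 eq_sym mulf_eq0 (negPf pj0) /=.
  rewrite prodf_seq_eq0 => /hasP [l _ /andP[lj]]; rewrite subr_eq0 => /eqP/ainj /eqP.
  by rewrite eq_sym (negPf lj).
have [|r] := @avoiding_split q 'X_i (f ^+ N) q0 (@fP N); last exact: na.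
pose W := \prod_l ('X_i - (a l)%:MP) : {mpoly F[k]}.
have pu0 : \sum_j (p j)%:MP * u j = 0.
  apply/mpolyP => m; rewrite mcoeff0 raddf_sum /=.
  under eq_bigr do rewrite mcoeffCM.
  have [ms|ms] := ltnP (mdeg m) s; first exact: (Hp (BMultinom ms)).
  apply: big1 => j _; rewrite memN_msupp_eq0 ?mulr0 //.
  by apply: msize_mdeg_ge; apply: leq_trans ms; case: (Hu j).
have -> : f ^+ N * (map_poly (@mpolyC k F) q).['X_i] =
  \sum_j ((p j)%:MP * \prod_(l | l != j) ('X_i - (a l)%:MP)) *
     (f ^+ N - u j * ('X_i - (a j)%:MP)) + W * \sum_j (p j)%:MP * u j.
  rewrite rmorph_sum /= horner_sum !mulr_sumr -big_split /=; apply: eq_bigr => j _.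
  rewrite map_polyZ /= hornerZ rmorph_prod horner_prod /= /W [X in _ = _ + X * _](bigD1 j) //=.
  under eq_bigr do rewrite rmorphB /= map_polyX map_polyC /= !hornerE.
  ring.
rewrite pu0 mulr0 addr0; apply: (ideal_sum idP) => j _; apply: (idealMl idP).
by case: (Hu j).
Qed.

End PrimeAvoidingPowers.

Theorem nullstellensatz I f : is_ideal I ->
  (forall a, (forall g, I g -> g.@[a] = 0) -> f.@[a] = 0) -> exists N, I (f ^+ N).
Proof.
move=> idI van; apply: contrapT => /forallNP fI.
(* The union with [I] is there because [Zorn_bigcup] also asks for the union of the empty chain,
   which is empty. *)
pose Q (X : set {mpoly F[k]}) := is_ideal (X `|` I) /\ forall N, ~ (X `|` I) (f ^+ N).
have [|A [[idA fA] maxA]] := @Zorn_bigcup _ Q.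
  move=> C CQ tot; split; last by move=> N [[X /CQ [_ fX] Xf]|/fI //]; apply: (fX N); left.
  split; first by right; exact: ideal0.
    move=> u v [[X CX Xu]|Iu] [[Y CY Yv]|Iv].
    - case: (tot _ _ CX CY) => [XY|YX].
        have [idY _] := CQ _ CY.
        have [h|h] : (Y `|` I) (u + v) by apply: (idealD idY); left=> //; apply: XY.
          by left; exists Y.
        by right.
      have [idX _] := CQ _ CX.
      have [h|h] : (X `|` I) (u + v) by apply: (idealD idX); left=> //; apply: YX.
        by left; exists X.
      by right.
    - have [idX _] := CQ _ CX.
      have [h|h] : (X `|` I) (u + v) by apply: (idealD idX); [left|right].
        by left; exists X.
      by right.
    - have [idX _] := CQ _ CY.
      have [h|h] : (Y `|` I) (u + v) by apply: (idealD idX); [right|left].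
        by left; exists Y.
      by right.
    - by right; apply: idealD.
  move=> u v [[X CX Xv]|Iv]; last by right; apply: idealMl.
  have [idX _] := CQ _ CX.
  have [h|h] : (X `|` I) (u * v) by apply: (idealMl idX); left.
    by left; exists X.
  by right.
pose P := A `|` I; have idP : is_ideal P := idA; have fP N : ~ P (f ^+ N) := fA N.
have maxP g : ~ P g -> exists N u, P (f ^+ N - u * g).
  move=> nPg; apply: contrapT => H.
  pose J : set {mpoly F[k]} := [set h | exists u, P (h - u * g)].
  have PJ : P `<=` J by move=> h Ph; exists 0; rewrite mul0r subr0.
  have idJ : is_ideal J.
    split; first by apply: PJ; exact: (ideal0 idP).
      move=> h1 h2 [u1 H1] [u2 H2]; exists (u1 + u2).
      have -> : h1 + h2 - (u1 + u2) * g = (h1 - u1 * g) + (h2 - u2 * g) by ring.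
      exact: (idealD idP).
    move=> h1 h2 [u H2]; exists (h1 * u).
    have -> : h1 * h2 - h1 * u * g = h1 * (h2 - u * g) by ring.
    exact: (idealMl idP).
  have JI : J `|` I = J.
    by apply/seteqP; split=> [h [//|Ih]|h Jh]; [apply: PJ; right|left].
  apply: (maxA J).
    split; first by move=> h Ah; apply: PJ; left.
    move=> JA; apply: nPg; left; apply: JA; exists 1; rewrite mul1r subrr; exact: (ideal0 idP).
  split; rewrite JI // => N [u Hu]; apply: H; by exists N, u.
have /choice [a Ha] i := avoiding_residue idP fP maxP i.
(* All residues modulo [P] are constants. Hence the point [a] is a zero of [I], so f(a) = 0, and [f]
   itself falls into [P]. *)
have key g : P (g - (g.@[a])%:MP).
  have := @mmap_cong _ P idP F k (@mpolyC k F) (fun i => 'X_i) (fun i => (a i)%:MP) g Ha.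
  congr (P (_ - _)).
    by rewrite [RHS]mpolyE; apply: eq_bigr => m _; rewrite mul_mpolyC /mmap1 -mpolyXE_id.
  rewrite mevalE raddf_sum /=; apply: eq_bigr => m _; rewrite mpolyCM rmorph_prod.
  by congr (_ * _); apply: eq_bigr => i _; rewrite rmorphXn.
have fa0 : f.@[a] = 0.
  apply: van => g Ig; apply/eqP/negPn/negP => ga.
  apply: (fP 0%N); rewrite expr0.
  have -> : 1 = ((g.@[a])^-1)%:MP * (g - (g - (g.@[a])%:MP)) :> {mpoly F[k]}.
    by rewrite opprB addrC subrK -mpolyCM mulVf // mpolyC1.
  by apply: (idealMl idP); apply: (idealB idP) => //; right.
by apply: (fP 1%N); have := key f; rewrite fa0 mpolyC0 subr0 expr1.
Qed.

End Nullstellensatz.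

(** * Cones, algebraic independence and dimension *)

Lemma mpoly_sum_homog (R : nzRingType) k (f : {mpoly R[k]}) :
  f = \sum_(d < msize f) pihomog mdeg d f.
Proof. exact: pihomog_partitionE. Qed.

Lemma pihomog_big (R : nzRingType) k (f : {mpoly R[k]}) d : (msize f <= d)%N ->
  pihomog mdeg d f = 0.
Proof.
move=> fd; rewrite pihomogE big_seq_cond big_pred0 // => m.
by apply/negP => /andP[/msize_mdeg_lt lt /eqP E]; move: lt; rewrite E ltnNge fd.
Qed.

Lemma pihomogM (R : comNzRingType) k (w z : {mpoly R[k]}) D e : z \is e.-homog ->
  pihomog mdeg D (w * z) = if (e <= D)%N then pihomog mdeg (D - e) w * z else 0.
Proof.
move=> hz; rewrite {1}(mpoly_sum_homog w) mulr_suml raddf_sum /=.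
have H (d : nat) : pihomog mdeg D (pihomog mdeg d w * z) =
    if (d + e == D)%N then pihomog mdeg d w * z else 0.
  have hd : pihomog mdeg d w * z \is (d + e).-homog.
    by apply: dhomogM => //; apply: pihomogP.
  by case: eqP => [<-|/eqP ne]; [rewrite pihomog_dE|rewrite (pihomog_ne0 ne hd)].
under eq_bigr do rewrite H.
case: leqP => [eD|De]; last by apply: big1 => i _; case: eqP => // E; lia.
have [lt|ge] := ltnP (D - e) (msize w).
  rewrite (bigD1 (Ordinal lt)) //= subnK // eqxx big1 ?addr0 // => i /eqP ne.
  by case: eqP => // E; case: ne; apply/val_inj => /=; lia.
rewrite (pihomog_big ge) mul0r big1 // => i _; case: eqP => // E.
by have := ltn_ord i; lia.
Qed.

Lemma msizeM_idomain (R : idomainType) k (p q : {mpoly R[k]}) :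
  (msize (p * q) <= (msize p + msize q).-1)%N.
Proof.
have [->|p0] := eqVneq p 0; first by rewrite mul0r msize0.
have [->|q0] := eqVneq q 0; first by rewrite mulr0 msize0.
by rewrite msizeM.
Qed.

Section Cones.
Variables (F : closedFieldType) (n : nat).
Local Notation B := {mpoly F[n.+1]}.
Local Notation V := 'rV[F]_n.+1.
Implicit Types (f g : B) (u v : V) (Z W : set (proj F n)) (x : proj F n).

Lemma meval_mulX (m : 'X_{1..n.+1}) (c : F) u :
  ('X_[m] : B).@[(c *: u) 0] = c ^+ mdeg m * ('X_[m] : B).@[u 0].
Proof.
rewrite !mevalX mdegE -prodrXr -big_split /=.
by apply: eq_bigr => i _; rewrite mxE exprMn.
Qed.

Lemma dhomog_meval f e (c : F) u : f \is e.-homog ->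
  f.@[(c *: u) 0] = c ^+ e * f.@[u 0].
Proof.
move=> /dhomogP hf; rewrite (mpolyE f) !raddf_sum /= mulr_sumr big_seq [RHS]big_seq.
apply: eq_bigr => m mf; rewrite !mevalZ meval_mulX (hf _ mf).
by rewrite mulrCA.
Qed.

(** The values f(cu) form a polynomial in c whose coefficients are the values at [u] of the
    homogeneous components. *)
Lemma pihomog_vanish f u d : (forall c, f.@[(c *: u) 0] = 0) ->
  (pihomog mdeg d f).@[u 0] = 0.
Proof.
move=> f0; have [lt|ge] := ltnP d (msize f); last by rewrite pihomog_big ?meval0.
have E : \poly_(i < msize f) (pihomog mdeg i f).@[u 0] = 0.
  apply: poly_eq0_fun => c; rewrite horner_poly -[RHS](f0 c).
  rewrite [in RHS](mpoly_sum_homog f) raddf_sum /=; apply: eq_bigr => i _.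
  by rewrite (dhomog_meval _ _ (pihomogP _ _ _)) mulrC.
by have := coef_poly (msize f) (fun i => (pihomog mdeg i f).@[u 0]) d; rewrite E lt coef0.
Qed.

Lemma proj_rep x : exists2 u, u != 0 & val x = <[u]>%VS.
Proof.
have d1 : \dim (val x) = 1%N by apply/eqP; exact: (valP x).
have x0 : val x != 0%VS by rewrite -dimv_eq0 d1.
exists (vpick (val x)); first by rewrite vpick0.
apply/esym/eqP; rewrite eqEdim d1 dim_vline vpick0 x0 andbT.
by rewrite -memvE memv_pick.
Qed.

Lemma pt_subproof u : u != 0 -> \dim <[u]>%VS == 1%N.
Proof. by move=> u0; rewrite dim_vline u0. Qed.

Definition pt u (u0 : u != 0) : proj F n := exist _ <[u]>%VS (pt_subproof u0).

Lemma ptP x u (u0 : u != 0) : u \in val x -> x = pt u0.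
Proof.
move=> ux; apply/val_inj/esym/eqP; rewrite eqEdim /= -memvE ux.
by rewrite (eqP (valP x)) dim_vline u0.
Qed.

Lemma vanishesP f x u : homogeneous f -> u != 0 -> u \in val x ->
  (vanishes f x <-> f.@[u 0] = 0).
Proof.
move=> [e hf] u0 ux; split=> [|fu w]; first exact.
by rewrite (ptP u0 ux) /= => /vlineP [c ->]; rewrite (dhomog_meval _ _ hf) fu mulr0.
Qed.

(** Zero is put in even for empty [Z], so that every cone is nonempty and closed under scaling. *)
Definition cone Z : set V := [set u | u = 0 \/ exists2 x, Z x & u \in val x].

Definition cone_vanish f Z := forall u, cone Z u -> f.@[u 0] = 0.

Lemma cone0 Z : cone Z 0. Proof. by left. Qed.

Lemma coneZ Z u c : cone Z u -> cone Z (c *: u).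
Proof.
move=> [->|[x Zx ux]]; first by rewrite scaler0; left.
by right; exists x => //; rewrite memvZ.
Qed.

Lemma coneS Z W : Z `<=` W -> cone Z `<=` cone W.
Proof. by move=> ZW u [->|[x /ZW Wx ux]]; [left|right; exists x]. Qed.

Lemma cone_pt Z u (u0 : u != 0) : cone Z u <-> Z (pt u0).
Proof.
split=> [[u00|[x Zx /(ptP u0) <-//]]|Zu]; first by have := u0; rewrite {1}u00 eqxx.
by right; exists (pt u0) => //=; rewrite memv_line.
Qed.

Lemma cone_vanishD f g Z : cone_vanish f Z -> cone_vanish g Z -> cone_vanish (f + g) Z.
Proof. by move=> hf hg u Zu; rewrite mevalD hf ?hg ?addr0. Qed.

Lemma cone_vanishMl f g Z : cone_vanish g Z -> cone_vanish (f * g) Z.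
Proof. by move=> hg u Zu; rewrite mevalM hg ?mulr0. Qed.

Lemma cone_vanish_pihomog f Z d : cone_vanish f Z -> cone_vanish (pihomog mdeg d f) Z.
Proof. by move=> hf u Zu; apply: pihomog_vanish => c; apply: hf; apply: coneZ. Qed.

Lemma closed_separation Z u : zariski_closed Z -> ~ cone Z u ->
  exists s, [/\ homogeneous s, cone_vanish s Z & s.@[u 0] != 0].
Proof.
move=> [S hS ->] nZu; have u0 : u != 0 by apply/eqP => u0; apply: nZu; left.
have [s Ss su] : exists2 s, S s & s.@[u 0] != 0.
  apply: contrapT => H; apply: nZu; apply/(cone_pt _ u0) => s Ss.
  apply/(vanishesP (hS _ Ss) u0); first exact: memv_line.
  by apply/eqP/negPn/negP => su; apply: H; exists s.
have /rV0Pn [i ui] := u0; have [e he] := hS _ Ss.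
(* The coordinate factor makes the form vanish at the origin, which lies in every cone, even when
   [s] is a constant. *)
exists (s * 'X_i); split.
- by exists (e + 1)%N; apply: dhomogM => //; rewrite dhomogX /= mdeg1.
- move=> w [->|[x Zx wx]]; rewrite mevalM mevalXU; first by rewrite mxE mulr0.
  by rewrite (Zx _ Ss) ?mul0r.
- by rewrite mevalM mevalXU mulf_neq0.
Qed.

Lemma closedI Z W : zariski_closed Z -> zariski_closed W -> zariski_closed (Z `&` W).
Proof.
move=> [S hS ->] [T hT ->]; exists (S `|` T); first by move=> f [/hS|/hT].
apply/seteqP; split=> x.
  by move=> [h1 h2] f [/h1|/h2].
by move=> h; split=> f ?; apply: h; [left|right].
Qed.

Lemma closed_zero f : homogeneous f -> zariski_closed (zero_set [set f]).
Proof. by move=> hf; exists [set f] => // g ->. Qed.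

Lemma zero_set1P f x : zero_set [set f] x <-> vanishes f x.
Proof. by split=> [|h g ->//]; apply. Qed.

Lemma closedT : zariski_closed (@setT (proj F n)).
Proof. by exists set0 => //; apply/seteqP; split=> x // _ f. Qed.

Lemma cone_vanish_sub f Z x : cone_vanish f Z -> Z x -> vanishes f x.
Proof. by move=> h Zx u ux; apply: h; right; exists x. Qed.

Lemma sub_closedP Z W : zariski_closed W ->
  (forall s, homogeneous s -> cone_vanish s W -> cone_vanish s Z) -> Z `<=` W.
Proof.
move=> cW H x Zx; have [u u0 xu] := proj_rep x.
have xE : x = pt u0 by apply: val_inj.
rewrite xE; apply/cone_pt; apply: contrapT => /(closed_separation cW) [s [hs sW]].
by rewrite (H s hs sW) ?eqxx //; right; exists x => //; rewrite xu memv_line.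
Qed.

(* Evaluation at vectors of the cone replaces the coordinate ring of [Z]. *)
Definition alg_indep Z q (y : 'I_q -> B) := forall P : {mpoly F[q]},
  (forall u, cone Z u -> P.@[fun i => (y i).@[u 0]] = 0) -> P = 0.

Definition no_common_zero Z k (z : 'I_k -> B) :=
  forall u, cone Z u -> (forall i, (z i).@[u 0] = 0) -> u = 0.

Hypothesis Func : uncountable_field F.

(** Projective Nullstellensatz: each variable has a power in [I], and a monomial of degree above the
    sum of these exponents is divisible by one of the powers. *)
Lemma ideal_high_degree (I : set B) : is_ideal I ->
  (forall u, (forall g, I g -> g.@[u 0] = 0) -> u = 0) ->
  exists N, forall m : 'X_{1..n.+1}, (N <= mdeg m)%N -> I 'X_[m].
Proof.
move=> idI zI.
have /choice [N HN] (i : 'I_n.+1) : exists N, I (('X_i : B) ^+ N).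
  apply: (nullstellensatz Func idI) => a Ha.
  have E g : g.@[(\row_j a j : V) 0] = g.@[a] by apply: meval_eq => j; rewrite mxE.
  have /rowP/(_ i) : (\row_j a j : V) = 0 by apply: zI => g /Ha; rewrite E.
  by rewrite mevalXU !mxE.
exists (\sum_i N i).+1 => m Nm.
have [i Ni] : exists i, (N i <= m i)%N.
  apply: contrapT => /forallNP H; have : (mdeg m <= \sum_i N i)%N.
    by rewrite mdegE; apply: leq_sum => i _; have /negP := H i; rewrite -ltnNge => /ltnW.
  by rewrite leqNgt Nm.
have -> : 'X_[m] = 'X_[m - U_(i) *+ N i] * ('X_i : B) ^+ N i.
  rewrite mpolyXn -mpolyXD submK //; apply/mnm_lepP => j; rewrite mulmnE mnm1E.
  by case: eqP => [<-|]; rewrite ?mul1n ?mul0n.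
exact: idealMl.
Qed.

Section Counting.
Variables (k q : nat) (z : 'I_k -> B) (e : 'I_k -> nat) (Z : set (proj F n)).
Hypotheses (cZ : zariski_closed Z) (zh : forall i, z i \is (e i).-homog).
Hypotheses (e0 : forall i, (0 < e i)%N) (zZ : no_common_zero Z z).

Lemma generators_high_degree : exists N, forall m : 'X_{1..n.+1}, (N <= mdeg m)%N ->
  exists w : 'I_k -> B, cone_vanish ('X_[m] - \sum_i w i * z i) Z.
Proof.
pose I : set B := [set f | exists w : 'I_k -> B, cone_vanish (f - \sum_i w i * z i) Z].
apply: (@ideal_high_degree I).
  split.
  - exists (fun=> 0) => u Zu; rewrite mevalB meval0 rmorph_sum /= big1 ?subr0 // => i _.
    by rewrite mul0r meval0.
  - move=> f g [w hw] [w' hw']; exists (fun i => w i + w' i).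
    have -> : f + g - \sum_i (w i + w' i) * z i =
      (f - \sum_i w i * z i) + (g - \sum_i w' i * z i).
      under eq_bigr do rewrite mulrDl.
      by rewrite big_split /=; ring.
    exact: cone_vanishD.
  - move=> f g [w hw]; exists (fun i => f * w i).
    have -> : f * g - \sum_i f * w i * z i = f * (g - \sum_i w i * z i).
      by rewrite mulrBr mulr_sumr; congr (_ - _); apply: eq_bigr => i _; rewrite mulrA.
    exact: cone_vanishMl.
move=> u Hu; apply: contrapT => /eqP u0.
have Zu : cone Z u.
  apply: contrapT => /(closed_separation cZ) [s [_ sZ /eqP]]; apply; apply: Hu.
  exists (fun=> 0) => v Zv; rewrite mevalB sZ // rmorph_sum /= big1 ?subr0 // => i _.
  by rewrite mul0r meval0.
move/eqP: u0; apply; apply: (zZ Zu) => i; apply: Hu.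
exists (fun j => (j == i)%:R) => v Zv.
rewrite mevalB (bigD1 i) //= eqxx mul1r big1 ?addr0 ?subrr // => j ji.
by rewrite (negPf ji) mul0r.
Qed.

Section Span.
Variable N : nat.
Hypothesis HN : forall m : 'X_{1..n.+1}, (N <= mdeg m)%N ->
  exists w : 'I_k -> B, cone_vanish ('X_[m] - \sum_i w i * z i) Z.

Let T D := ('X_{1..n.+1 < N} * {ffun 'I_k -> 'I_D.+1})%type.
Let phi D (t : T D) : B := 'X_[t.1] * \prod_i z i ^+ (t.2 i).
Let sp D f := exists c : T D -> F, forall u, cone Z u ->
  f.@[u 0] = \sum_t c t * (phi t).@[u 0].

Let spD D f g : sp D f -> sp D g -> sp D (f + g).
Proof.
move=> [c hc] [c' hc']; exists (fun t => c t + c' t) => u Zu.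
rewrite mevalD hc // hc' // -big_split /=.
by apply: eq_bigr => t _; rewrite mulrDl.
Qed.

Let spZ D f a : sp D f -> sp D (a *: f).
Proof.
move=> [c hc]; exists (fun t => a * c t) => u Zu.
by rewrite mevalZ hc // mulr_sumr; apply: eq_bigr => t _; rewrite mulrA.
Qed.

Let sp0 D : sp D 0.
Proof. by exists (fun=> 0) => u _; rewrite meval0 big1 // => t _; rewrite mul0r. Qed.

Let sp_sum D (I : Type) (r : seq I) (Q : pred I) (h : I -> B) :
  (forall i, Q i -> sp D (h i)) -> sp D (\sum_(i <- r | Q i) h i).
Proof. by move=> H; apply: big_ind; [exact: sp0|exact: spD|exact: H]. Qed.

Let sp_cong D f g : cone_vanish (f - g) Z -> sp D g -> sp D f.
Proof.
move=> fg [c hc]; exists c => u Zu; rewrite -hc //; apply/eqP.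
by rewrite -subr_eq0 -mevalB fg.
Qed.

Let sp_gen D (b : 'X_{1..n.+1}) (gam : 'I_k -> nat) : (mdeg b < N)%N ->
  (forall i, (gam i <= D)%N) -> sp D ('X_[b] * \prod_i z i ^+ gam i).
Proof.
move=> bN gD; pose t0 : T D := (BMultinom bN, [ffun i => inord (gam i)]).
exists (fun t => (t == t0)%:R) => u _; rewrite (bigD1 t0) //= eqxx mul1r [X in _ + X]big1 ?addr0.
  apply: (congr1 (fun f : B => f.@[u 0])); rewrite /phi /=; congr (_ * _).
  by apply: eq_bigr => i _; rewrite ffunE inordK // ltnS.
by move=> t /negPf ->; rewrite mul0r.
Qed.

Let sp_mono D D' f : (D <= D')%N -> sp D f -> sp D' f.
Proof.
move=> DD [c hc]; apply: (@sp_cong _ _ (\sum_t c t *: phi t)).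
  move=> u Zu; rewrite mevalB hc // rmorph_sum /=; apply/eqP; rewrite subr_eq0; apply/eqP.
  by apply: eq_bigr => t _; rewrite mevalZ.
apply: sp_sum => t _; apply: spZ; apply: (@sp_gen _ _ (fun i => t.2 i)); first exact: bmdeg.
by move=> i; apply: leq_trans DD; rewrite -ltnS.
Qed.

Let sp_mulz D f i : sp D f -> sp D.+1 (f * z i).
Proof.
move=> [c hc]; apply: (@sp_cong _ _ (\sum_t c t *: (phi t * z i))).
  move=> u Zu; rewrite mevalB mevalM hc // rmorph_sum /= mulr_suml.
  apply/eqP; rewrite subr_eq0; apply/eqP; apply: eq_bigr => t _.
  by rewrite mevalZ [(phi t * z i).@[_]]mevalM mulrA.
apply: sp_sum => t _; apply: spZ.
have -> : phi t * z i = 'X_[t.1] * \prod_j z j ^+ (t.2 j + (j == i))%N.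
  rewrite /phi -mulrA; congr (_ * _); rewrite (bigD1 i) //= [RHS](bigD1 i) //= eqxx.
  rewrite mulrAC addn1 exprSr; congr (_ * _).
  by apply: eq_bigr => j /negPf ->; rewrite addn0.
apply: (@sp_gen _ _ (fun j => t.2 j + (j == i))%N); first exact: bmdeg.
by move=> j; have := ltn_ord (t.2 j); case: (j == i); lia.
Qed.

(** Strong induction on the degree: on the cone a monomial of degree at least [N] equals some sum of
    w_i z_i, and in degree [D] only the components of w_i of degree D - e_i < D contribute. *)
Lemma span_homog D f : f \is D.-homog -> sp D f.
Proof.
elim/ltn_ind: D f => D IH f /dhomogP hf.
rewrite (mpolyE f) big_seq; apply: sp_sum => m /hf mD; apply: spZ.
have [lt|ge] := ltnP D N.
  have -> : 'X_[m] = 'X_[m] * \prod_i z i ^+ 0 :> B by rewrite big1 ?mulr1.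
  by apply: (@sp_gen _ _ (fun=> 0%N)); rewrite ?mD.
have [w Hw] : exists w : 'I_k -> B, cone_vanish ('X_[m] - \sum_i w i * z i) Z.
  by apply: HN; rewrite mD.
have hm : ('X_[m] : B) \is D.-homog by rewrite dhomogX mD.
have := cone_vanish_pihomog D Hw; rewrite raddfB /= (pihomog_dE hm) => H; apply: (sp_cong H).
rewrite (raddf_sum (pihomog mdeg D)); apply: sp_sum => i _ /=; rewrite (pihomogM _ _ (zh i)).
case: ifP => eD; last exact: sp0.
apply: (@sp_mono (D - e i).+1); first by have := e0 i; lia.
by apply: sp_mulz; apply: IH; [have := e0 i; lia|exact: pihomogP].
Qed.

Lemma span_all D f : (msize f <= D.+1)%N -> sp D f.
Proof.
move=> fD; rewrite (mpoly_sum_homog f); apply: sp_sum => d _.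
by apply: (@sp_mono d); [have := ltn_ord d; lia|apply: span_homog; exact: pihomogP].
Qed.

End Span.

(* On the cone of [Z], products of monomials in [z] and finitely many monomials
   span all polynomials, which makes O(D^k) of them up to degree D; there are
   about D^q monomials in [y]. *)
Theorem indep_le_generators (y : 'I_q -> B) : alg_indep Z y -> (q <= k)%N.
Proof.
move=> yi; rewrite leqNgt; apply/negP => kq.
have [N HN] := generators_high_degree.
(* [E] bounds the degrees of the [y i], and [D] those of their products with exponents below [M].
   [M] is chosen so that the C0 (D + 1)^k spanning products are fewer than the M^q products of the
   [y i]. *)
pose E := (\sum_i msize (y i))%N; pose C0 := #|{: 'X_{1..n.+1 < N}}|.
pose M := (C0 * (E * q + 1) ^ k + 1)%N; pose D := (E * q * M)%N.
pose al (t : {ffun 'I_q -> 'I_M}) : B := \prod_i y i ^+ t i.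
have size_al t : (msize (al t) <= D.+1)%N.
  have sX (f : B) j s : (msize f <= s.+1)%N -> (msize (f ^+ j) <= (s * j).+1)%N.
    move=> fs; elim: j => [|j IH]; first by rewrite expr0 msize1.
    rewrite exprS mulnS; apply: leq_trans (msizeM_idomain _ _) _.
    by move: (msize f) (msize (f ^+ j)) fs IH => a b; lia.
  have : (msize (al t) <= (\sum_(i < q) E * M).+1)%N.
    rewrite /al; elim/big_rec2: _ => [|i a f _ IH]; first by rewrite msize1.
    apply: leq_trans (msizeM_idomain _ _) _.
    have yE : (msize (y i) <= E.+1)%N by rewrite /E (bigD1 i) //=; lia.
    have h1 := sX _ (t i) _ yE.
    have : (E * t i <= E * M)%N by rewrite leq_mul2l ltnW ?orbT.
    by move: (msize f) (msize (_ ^+ _)) IH h1 => a1 b1; lia.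
  by rewrite sum_nat_const card_ord /D; congr (_ <= _.+1)%N; ring.
have /choice [c Hc] t := span_all HN (size_al t).
have [|p [t0 pt0] Hp] := @dependent_family F _ _ c.
  rewrite card_prod !card_ffun !card_ord -/C0.
  have h1 : (D.+1 <= (E * q + 1) * M)%N by rewrite /D /M; lia.
  have h2 : (D.+1 ^ k <= (E * q + 1) ^ k * M ^ k)%N.
    by rewrite -expnMn; case: (k) => // k'; rewrite leq_exp2r.
  have h3 : (M * M ^ k <= M ^ q)%N by rewrite -expnS leq_pexp2l // /M addn1.
  apply: leq_trans h3; apply: leq_ltn_trans (leq_mul (leqnn C0) h2) _.
  have M0 : (0 < M ^ k)%N by rewrite expn_gt0 /M addn1.
  by rewrite mulnA ltn_pmul2r // /M [X in (_ < X)%N]addn1.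
have P0 : \sum_t p t *: 'X_[[multinom (t i : nat) | i < q]] = 0 :> {mpoly F[q]}.
  apply: yi => u Zu; rewrite raddf_sum /=.
  have E1 t : (p t *: 'X_[[multinom (t i : nat) | i < q]] : {mpoly F[q]}).@[fun i => (y i).@[u 0]]
     = \sum_s p t * c t s * ('X_[s.1] * \prod_i z i ^+ (s.2 i) : B).@[u 0].
    rewrite mevalZ mevalX (_ : \prod_i _ = (al t).@[u 0]).
      by rewrite Hc // mulr_sumr; apply: eq_bigr => s _; rewrite mulrA.
    by rewrite rmorph_prod; apply: eq_bigr => i _; rewrite mnmE rmorphXn.
  under eq_bigr do rewrite E1.
  by rewrite exchange_big big1 //= => s _; rewrite -mulr_suml Hp mul0r.
move/eqP: pt0; apply; move/mpolyP/(_ [multinom (t0 i : nat) | i < q]): P0.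
rewrite mcoeff0 raddf_sum /= (bigD1 t0) //= mcoeffZ mcoeffX eqxx mulr1 big1 ?addr0 // => t tt0.
rewrite mcoeffZ mcoeffX; case: eqP => [E1|]; last by rewrite mulr0.
case/eqP: tt0; apply/ffunP => i; apply/val_inj.
by have := congr1 (fun m : 'X_{1..q} => m i) E1; rewrite !mnmE.
Qed.

End Counting.
End Cones.

(** * Chains of irreducible closed sets *)

Section Dimension.
Variables (F : closedFieldType) (n : nat).
Hypothesis Func : uncountable_field F.
Local Notation B := {mpoly F[n.+1]}.
Local Notation V := 'rV[F]_n.+1.
Implicit Types (f g : B) (u v : V) (Z W : set (proj F n)) (x : proj F n).

Lemma meval_mmap k (y : 'I_k -> B) (P : {mpoly F[k]}) u :
  (mmap (@mpolyC n.+1 F) y P).@[u 0] = P.@[fun i => (y i).@[u 0]].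
Proof.
rewrite /mmap rmorph_sum mevalE /=; apply: eq_bigr => m _.
rewrite mevalM mevalC rmorph_prod; congr (_ * _).
by apply: eq_bigr => i _; rewrite rmorphXn.
Qed.

Lemma dhomog_meval0 f e : f \is e.-homog -> (0 < e)%N -> f.@[(0 : V) 0] = 0.
Proof. by move=> hf e0; rewrite -(scale0r (0 : V)) (dhomog_meval _ _ hf) expr0n gtn_eqF ?mul0r. Qed.

Lemma alg_indepS Z W q (y : 'I_q -> B) : Z `<=` W -> alg_indep Z y -> alg_indep W y.
Proof. by move=> ZW yZ P HP; apply: yZ => u Zu; apply: HP; apply: coneS Zu. Qed.

Lemma cone_vanishP f W : W !=set0 -> (cone_vanish f W <-> forall x, W x -> vanishes f x).
Proof.
move=> [x0 Wx0]; split=> [h x Wx|h u [->|[x Wx ux]]]; first exact: (cone_vanish_sub h).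
  by apply: (h x0) => //; rewrite mem0v.
exact: (h x).
Qed.

(* If the value [a] were missed, the [k] forms a_j y_i - a_i y_j would have no
   common zero, contradicting [indep_le_generators]. *)
Lemma cone_surjective Z k (y : 'I_k.+1 -> B) e (a : 'I_k.+1 -> F) :
  zariski_closed Z -> (0 < e)%N -> (forall i, y i \is e.-homog) ->
  alg_indep Z y -> no_common_zero Z y ->
  exists2 u, cone Z u & forall i, (y i).@[u 0] = a i.
Proof.
move=> cZ e0 yh yi yz.
have [/forallP a0|/forallPn [j aj]] := boolP [forall i, a i == 0].
  exists 0; first exact: cone0.
  by move=> i; rewrite (eqP (a0 i)); apply: dhomog_meval0 (yh i) e0.
apply: contrapT => Hno.
pose z (i : 'I_k) : B := a j *: y (lift j i) - a (lift j i) *: y j.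
have zh i : z i \is e.-homog by apply: rpredB; apply: rpredZ.
suff zz : no_common_zero Z z.
  by have := indep_le_generators Func cZ zh (fun=> e0) zz yi; rewrite ltnn.
move=> u Zu zu; have yu i : a j * (y i).@[u 0] = a i * (y j).@[u 0].
  have [i' ->|-> //] := unliftP j i.
  by have /eqP := zu i'; rewrite mevalB !mevalZ subr_eq0 => /eqP.
have [yj0|yj0] := eqVneq (y j).@[u 0] 0.
  apply: (yz _ Zu) => i; have /eqP := yu i; rewrite yj0 mulr0 mulf_eq0 (negPf aj).
  by move/eqP.
pose c := (y j).@[u 0] / a j; have c0 : c != 0 by rewrite mulf_neq0 ?invr_eq0.
have [t Ht] : exists t, root ('X^e - (c^-1)%:P) t.
  by apply/closed_rootP; rewrite size_XnsubC // eqSS -lt0n.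
case: Hno; exists (t *: u); first exact: coneZ.
move=> i; rewrite (dhomog_meval _ _ (yh i)).
move: Ht; rewrite rootE !hornerE subr_eq0 => /eqP ->.
apply: (mulfI aj); rewrite mulrCA yu /c; field.
by rewrite ?aj ?yj0.
Qed.

(** The vanishing ideal of an irreducible set is prime. Closed sets are cut out by forms, so the
    homogeneous components of [Q] are treated one at a time, each multiplied by [h]. *)
Lemma irreducible_cancel W h Q : irreducible W -> homogeneous h ->
  ~ cone_vanish h W -> cone_vanish (h * Q) W -> cone_vanish Q W.
Proof.
move=> [_ Wn0 irrW] hh nh hQ; have [e he] := hh.
have Qd d : forall x, W x -> vanishes (pihomog mdeg d Q) x.
  have hd : homogeneous (pihomog mdeg d Q) by exists d; apply: pihomogP.
  have hQd : cone_vanish (pihomog mdeg d Q * h) W.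
    have := cone_vanish_pihomog (d + e) hQ.
    by rewrite mulrC (pihomogM _ _ he) leq_addl addnK.
  have [|h1|h1] := irrW _ _ (closed_zero hh) (closed_zero hd).
  - move=> x Wx; have [u u0 xu] := proj_rep x.
    have ux : u \in val x by rewrite xu memv_line.
    have /eqP : (pihomog mdeg d Q * h).@[u 0] = 0 by apply: hQd; right; exists x.
    rewrite mevalM mulf_eq0 => /orP[/eqP E|/eqP E]; [right|left]; apply/zero_set1P.
      by apply/(vanishesP hd u0 ux).
    by apply/(vanishesP hh u0 ux).
  - by case: nh; apply/(cone_vanishP _ Wn0) => x /h1/zero_set1P.
  - by move=> x /h1/zero_set1P.
apply/(cone_vanishP _ Wn0) => x Wx u ux.
by rewrite (mpoly_sum_homog Q) rmorph_sum /= big1 // => d _; apply: (Qd d x).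
Qed.

(** The new element is a form [h] vanishing on [W] but not on [W']. Write a relation on [W'] as a
    polynomial in [h]: restriction to [W] kills its constant coefficient by independence, and
    irreducibility of [W'] then allows division by [h]. *)
Lemma alg_indep_step W W' q (y : 'I_q -> B) : irreducible W' -> zariski_closed W ->
  W `<=` W' -> ~ (W' `<=` W) -> alg_indep W y ->
  exists y' : 'I_q.+1 -> B, alg_indep W' y'.
Proof.
move=> irr cW WW' nW'W yW.
have [h [hh hW hW']] : exists h, [/\ homogeneous h, cone_vanish h W & ~ cone_vanish h W'].
  apply: contrapT => H; apply: nW'W; apply: (sub_closedP cW) => s hs sW.
  by apply: contrapT => ns; apply: H; exists s.
exists (fun i => if unlift ord_max i is Some j then y j else h) => P HP.
apply: muni_eq0.
pose ev (p : {poly {mpoly F[q]}}) u :=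
  (map_poly (meval (fun i => (y i).@[u 0])) p).[h.@[u 0]].
have : forall u, cone W' u -> ev (muni P) u = 0.
  move=> u /HP; rewrite meval_muni unlift_none => E; rewrite /ev -[RHS]E.
  congr (_.[_]); apply: eq_map_poly => c; apply: meval_eq => i.
  by rewrite widen_lift liftK.
elim/poly_ind: (muni P) => [//|p c IH] Hp.
have c0 : c = 0.
  apply: yW => u Wu; have := Hp u (coneS WW' Wu).
  by rewrite /ev rmorphD rmorphM /= map_polyC map_polyX /= !hornerE hW // mulr0 add0r.
rewrite c0 addr0 IH ?mul0r // => u Wu.
pose Q := (map_poly (mmap (@mpolyC n.+1 F) y) p).[h].
have evQ (w : V) : Q.@[w 0] = ev p w.
  rewrite /Q /ev -horner_map -map_poly_comp; congr (_.[_]).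
  by apply: eq_map_poly => c'; exact: meval_mmap.
rewrite -evQ; apply: (irreducible_cancel irr hh hW') Wu => w Ww.
rewrite mevalM evQ; have := Hp w Ww.
by rewrite c0 addr0 /ev rmorphM /= map_polyX hornerMX mulrC.
Qed.

Lemma chain_mono Z m c i j : irreducible_chain Z m c -> (i <= j)%N -> (j <= m)%N ->
  c i `<=` c j.
Proof.
move=> [_ cS _] /subnKC <-; elim: (j - i)%N => [|d IH]; first by rewrite addn0 => _ x.
rewrite addnS => lt; apply: subset_trans (IH (ltnW lt)) _.
by case: (cS _ lt).
Qed.

Lemma chain_alg_indep Z m c : irreducible_chain Z m c ->
  exists y : 'I_m.+1 -> B, alg_indep Z y.
Proof.
move=> [cirr cS cZ].
suff H i : (i <= m)%N -> exists y : 'I_i.+1 -> B, alg_indep (c i) y.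
  by have [y yi] := H m (leqnn m); exists y; apply: alg_indepS yi.
elim: i => [_|i IH im].
  have irr := cirr 0%N (leq0n m); have [_ c0 _] := irr.
  (* The induction starts below the chain, at the empty set, whose cone is the origin and on which
     the empty family is independent. This accounts for m + 1 elements from a chain with m steps. *)
  apply: (@alg_indep_step set0 _ 0 (fun=> 0) irr) => //.
  - exists [set 1]; first by move=> f ->; exists 0%N; exact: dhomog1 mdeg.
    apply/seteqP; split=> [//|x] /zero_set1P /(_ 0); rewrite mem0v meval1 => /(_ isT) /eqP.
    by rewrite oner_eq0.
  - by move=> s; case: c0 => x /s.
  - move=> P HP; have := nvar0_mpolyC P; move: (P@_0%MM) => a E; subst P.
    by have := HP 0 (cone0 _); rewrite mevalC => ->; rewrite mpolyC0.
have [y yi] := IH (ltnW im); have [cs ncs] := cS _ im.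
have [ci _ _] := cirr _ (ltnW im).
exact: (alg_indep_step (cirr _ im) ci cs ncs yi).
Qed.

Theorem chain_length_lt Z k (z : 'I_k -> B) (e : 'I_k -> nat) m c : zariski_closed Z ->
  (forall i, z i \is (e i).-homog) -> (forall i, (0 < e i)%N) -> no_common_zero Z z ->
  irreducible_chain Z m c -> (m < k)%N.
Proof.
by move=> cZ zh e0 zz /chain_alg_indep [y yi]; exact: (indep_le_generators Func cZ zh e0 zz yi).
Qed.

Lemma closed_mem Z x : zariski_closed Z ->
  (forall s, homogeneous s -> cone_vanish s Z -> vanishes s x) -> Z x.
Proof.
move=> cZ H; have [u u0 xu] := proj_rep x.
have xE : x = pt u0 by apply: val_inj.
rewrite xE; apply/cone_pt; apply: contrapT => /(closed_separation cZ) [s [hs sZ]].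
by rewrite (H s hs sZ) ?eqxx // xu memv_line.
Qed.

(* Zorn's lemma: a minimal closed subset on which no element of [Sig] vanishes
   identically is irreducible. *)
Lemma irreducible_avoiding (Sig : set B) Z : zariski_closed Z ->
  (forall s t, Sig s -> Sig t -> Sig (s * t)) ->
  (exists2 s, Sig s & s.@[(0 : V) 0] = 0) ->
  (forall s, Sig s -> ~ cone_vanish s Z) ->
  exists W, [/\ irreducible W, W `<=` Z & forall s, Sig s -> ~ cone_vanish s W].
Proof.
move=> cZ SM [s0 Ss0 s00] SZ.
(* Zorn's lemma is stated for unions, so minimal closed subsets are sought through their
   complements. *)
pose K (X : set (proj F n)) := Z `&` ~` X.
pose P X := zariski_closed (K X) /\ forall s, Sig s -> ~ cone_vanish s (K X).
have K0 : K set0 = Z by rewrite /K setC0 setIT.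
have P0 : P set0 by rewrite /P K0.
have [|X [[cX sX] maxX]] := @Zorn_bigcup _ P.
  move=> C CP tot.
  (* Adding [set0] makes the chain nonempty without changing its union. *)
  have [C' [C'P C'tot C'e] C'0] : exists2 C', [/\ C' `<=` P, total_on C' subset & C' set0] &
      \bigcup_(X in C) X = \bigcup_(X in C') X.
    exists (C `|` [set set0]).
      split; [by move=> X [/CP|->]| |by right].
      move=> X Y [CX|->] [CY|->]; [exact: tot|by right|by left|by left].
    by rewrite bigcup_setU bigcup_set1 setU0.
  rewrite C'0; set U := \bigcup_(X in C') X.
  have KU X : C' X -> K U `<=` K X.
    by move=> CX x [Zx nU]; split=> // Xx; apply: nU; exists X.
  have memKU x : (forall X, C' X -> K X x) -> K U x.
    move=> H; split; first by have [] := H _ C'e.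
    by move=> [X CX]; have [] := H _ CX.
  split.
    exists [set s | homogeneous s /\ exists2 X, C' X & cone_vanish s (K X)].
      by move=> s [].
    apply/seteqP; split=> [x Kx s [_ [X CX sX]]|x Hx].
      exact: (cone_vanish_sub sX (KU _ CX _ Kx)).
    apply: memKU => X CX; have [cX _] := C'P _ CX.
    by apply: (closed_mem cX) => s hs sX; apply: Hx; split=> //; exists X.
  move=> s Ss sU.
  (* Compactness: the polynomials vanishing on some member of the chain form an ideal. If [s]
     vanishes on the intersection, the Nullstellensatz puts a power of [s] in it, so [s] already
     vanishes on one member. *)
  pose I : set B := [set f | exists2 X, C' X & cone_vanish f (K X)].
  have idI : is_ideal I.
    split; first by exists set0 => // u _; rewrite meval0.
      move=> f g [X CX fX] [Y CY gY].
      have [XY|YX] := C'tot _ _ CX CY.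
        exists Y => //; apply: cone_vanishD => // u Yu; apply: fX; apply: coneS Yu.
        by move=> x [Zx nYx]; split=> // /XY.
      exists X => //; apply: cone_vanishD => // u Xu; apply: gY; apply: coneS Xu.
      by move=> x [Zx nYx]; split=> // /YX.
    by move=> f g [X CX gX]; exists X => //; apply: cone_vanishMl.
  have [|N [X CX sN]] := nullstellensatz Func (f := s) idI.
    move=> a Ha; pose u : V := \row_i a i.
    have E g : g.@[u 0] = g.@[a] by apply: meval_eq => j; rewrite mxE.
    rewrite -E; apply: sU; have [->|u0] := eqVneq u 0; first exact: cone0.
    apply/(cone_pt _ u0)/memKU => Y CY; apply/(cone_pt _ u0).
    have [cY _] := C'P _ CY; apply: contrapT => /(closed_separation cY) [t [_ tY /eqP]].
    by apply; rewrite E; apply: Ha; exists Y.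
  have [_ nX] := C'P _ CX; apply: (nX _ Ss) => u Xu.
  by have /eqP := sN _ Xu; rewrite rmorphXn expf_eq0 => /andP[_ /eqP].
exists (K X); split=> //; last by move=> x [].
split=> // [|Z1 Z2 c1 c2 H].
  apply: contrapT => /nonemptyPn E; apply: (sX _ Ss0); rewrite E.
  by move=> u [->|[x []]].
apply: contrapT => /not_orP [n1 n2].
(* By minimality some element of [Sig] vanishes on each proper closed part; the product of two such
   elements would vanish on all of [K X]. *)
have sub (Zi : set (proj F n)) : zariski_closed Zi -> ~ (K X `<=` Zi) ->
    exists2 s, Sig s & cone_vanish s (K X `&` Zi).
  move=> ci ni; apply: contrapT => Hs; apply: (maxX (X `|` ~` Zi)).
    split; first by left.
    move=> sub; apply: ni => x [Zx nXx]; apply: contrapT => nZi.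
    by apply: nXx; apply: sub; right.
  have E : K (X `|` ~` Zi) = K X `&` Zi by rewrite /K setCU setCK setIA.
  split; first by rewrite E; apply: closedI.
  by move=> s Ss; rewrite E => sv; apply: Hs; exists s.
have [s1 S1 v1] := sub _ c1 n1; have [s2 S2 v2] := sub _ c2 n2.
apply: (sX _ (SM _ _ S1 S2)) => u [->|[x Kx ux]]; rewrite mevalM.
  by rewrite v1 ?mul0r //; left.
case: (H _ Kx) => Zx; first by rewrite v1 ?mul0r //; right; exists x.
by rewrite v2 ?mulr0 //; right; exists x.
Qed.

(** By [cone_surjective] the remaining forms take all values where the last one is 0, so no nonzero
    polynomial in them vanishes on the section. [irreducible_avoiding] finds an irreducible subset
    on which this persists. *)
Lemma irreducible_section W k (y : 'I_k.+2 -> B) e : irreducible W -> (0 < e)%N ->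
  (forall i, y i \is e.-homog) -> alg_indep W y -> no_common_zero W y ->
  exists W', [/\ irreducible W', W' `<=` W, forall x, W' x -> vanishes (y ord_max) x,
    alg_indep W' (fun i => y (widen i)) & no_common_zero W' (fun i => y (widen i))].
Proof.
move=> irr e0 yh yi yz; have [cW Wn0 _] := irr.
have hm : homogeneous (y ord_max) by exists e.
pose sub P := mmap (@mpolyC n.+1 F) (fun i : 'I_k.+1 => y (widen i)) P.
pose Sig : set B := [set s | exists2 P, P != 0 & s = sub P].
have [||||W' [irr' W'Z W'S]] := @irreducible_avoiding Sig (W `&` zero_set [set y ord_max]).
- by apply: closedI => //; apply: closed_zero.
- move=> s t [P P0 ->] [Q Q0 ->]; exists (P * Q); first by rewrite mulf_neq0.
  by rewrite /sub rmorphM.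
- exists (sub 'X_0); first by exists 'X_0 => //; rewrite -msize_poly_eq0 msizeX.
  by rewrite meval_mmap mevalXU (dhomog_meval0 (yh _) e0).
- move=> s [P P0 ->] Hs; have [a Pa] := mpoly_neq0_fun P0.
  pose b (i : 'I_k.+2) := if unlift ord_max i is Some j then a j else 0.
  have [u Wu ub] := cone_surjective b cW e0 yh yi yz.
  have Zu : cone (W `&` zero_set [set y ord_max]) u.
    have [->|u0] := eqVneq u 0; first exact: cone0.
    apply/(cone_pt _ u0); split; first exact/(cone_pt _ u0).
    apply/zero_set1P/(vanishesP hm u0); first exact: memv_line.
    by rewrite ub /b unlift_none.
  move/eqP: Pa; apply; rewrite -(Hs u Zu) meval_mmap; apply: meval_eq => i.
  by rewrite ub /b widen_lift liftK.
exists W'; split=> //.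
- by move=> x /W'Z [].
- by move=> x /W'Z [_ /zero_set1P].
- move=> P HP; apply/eqP/negPn/negP => P0; apply: (W'S (sub P)); first by exists P.
  by move=> u /HP; rewrite meval_mmap.
- move=> u W'u Hu; apply: yz; first by apply: coneS W'u => x /W'Z [].
  move=> i; have [j ->|->] := unliftP ord_max i; first by rewrite -widen_lift.
  case: W'u => [->|[x /W'Z [_ /zero_set1P h] /h //]].
  exact: dhomog_meval0 (yh _) e0.
Qed.

(** The sections use every form except the one numbered 0, and the bottom of the chain lies on all
    of them; later this places a node on each component. *)
Lemma chain_exists k : forall W (y : 'I_k.+1 -> B) e, irreducible W -> (0 < e)%N ->
  (forall i, y i \is e.-homog) -> alg_indep W y -> no_common_zero W y ->
  exists2 c, irreducible_chain W k c &
    forall x, c 0%N x -> W x /\ forall i, i != ord0 -> vanishes (y i) x.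
Proof.
elim: k => [|k IH] W y e irr e0 yh yi yz.
  exists (fun=> W); first by split.
  by move=> x Wx; split=> // i; rewrite (ord1 i) eqxx.
have [W' [irr' W'W W'y yi' yz']] := irreducible_section irr e0 yh yi yz.
have [c cc c0] := IH W' _ e irr' e0 (fun i => yh _) yi' yz'.
have [c1 c2 c3] := cc.
exists (fun i => if (i <= k)%N then c i else W).
  split=> //; last by rewrite ltnn.
    by move=> i _; case: ifP => // /c1.
  move=> i; rewrite ltnS => ik; rewrite ik; case: ifP => [lt|nlt]; first exact: c2.
  have -> : i = k by apply/eqP; rewrite eqn_leq ik leqNgt nlt.
  split; first exact: subset_trans c3 W'W.
  move=> Wc; have ymax u : cone W u -> (y ord_max).@[u 0] = 0.
    move=> [->|[x /Wc/c3/W'y h /h //]]; exact: dhomog_meval0 (yh _) e0.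
  have /eqP : 'X_ord_max = 0 :> {mpoly F[k.+2]}.
    by apply: yi => u Wu; rewrite mevalXU ymax.
  by rewrite -msize_poly_eq0 msizeX.
move=> x /c0 [W'x Hx]; split; first exact: W'W.
move=> i; have [j ->|->] := unliftP ord_max i; last by move=> _; apply: W'y.
by rewrite -widen_lift => j0; apply: Hx; apply: contra_neq j0 => ->; apply: val_inj.
Qed.

Lemma component_exists Z K x : zariski_closed Z ->
  (forall m c, irreducible_chain Z m c -> (m <= K)%N) -> Z x ->
  exists2 W, component Z W & W x.
Proof.
move=> cZ bnd Zx.
(* The closure of [x]. It shows that chains whose bottom contains [x] exist; the bound gives a
   longest one, and its top is a component. *)
pose W0 := zero_set [set f | homogeneous f /\ vanishes f x].
have W0x : W0 x by move=> f [].
have W0sub Z' : zariski_closed Z' -> Z' x -> W0 `<=` Z'.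
  by move=> [S hS ->] Sx y W0y f Sf; apply: W0y; split; [exact: hS|exact: Sx].
have irr0 : irreducible W0.
  split; [by exists [set f | homogeneous f /\ vanishes f x] => // f []|by exists x|].
  by move=> Z1 Z2 c1 c2 H; case: (H _ W0x) => h; [left|right]; apply: W0sub.
pose Q m := `[< exists2 c, irreducible_chain Z m c & c 0%N x >].
have Q0 : exists m, Q m.
  exists 0%N; apply/asboolP; exists (fun=> W0) => //; split=> //; exact: W0sub.
have Qle m : Q m -> (m <= K)%N by move=> /asboolP [c /bnd].
case: (ex_maxnP Q0 Qle) => m /asboolP [c cc c0] mmax; have [c1 c2 c3] := cc.
exists (c m); last exact: (chain_mono cc (leq0n m) (leqnn m)).
split; [exact: c1|exact: c3|] => W' irr' W'Z cW'.
apply/seteqP; split=> //; apply: contrapT => nsub.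
have := mmax m.+1; rewrite ltnn => H; suff: false by []; apply: H; apply/asboolP.
exists (fun i => if (i <= m)%N then c i else W'); last by [].
split; last by rewrite ltnn.
  by move=> i _; case: ifP => // /c1.
move=> i; rewrite ltnS => im; rewrite im; case: ifP => [lt|nlt]; first exact: c2.
by have -> : i = m by apply/eqP; rewrite eqn_leq im leqNgt nlt.
Qed.

Lemma has_dim_uniq Z k k' : has_dim Z k -> has_dim Z k' -> k = k'.
Proof.
move=> [[c cc] h] [[c' cc'] h']; apply/eqP; rewrite eqn_leq.
by rewrite (h' _ _ cc) (h _ _ cc').
Qed.

End Dimension.

(** * Polynomial arcs *)

Lemma mpoly_ring_ind (R : comNzRingType) k (P : {mpoly R[k]} -> Prop) :
  (forall c, P c%:MP) -> (forall i, P 'X_i) ->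
  (forall f g, P f -> P g -> P (f + g)) -> (forall f g, P f -> P g -> P (f * g)) ->
  forall f, P f.
Proof.
move=> PC PX PD PM; elim/mpolyind => [|c m f _ _ Pf]; first by rewrite -mpolyC0.
apply: PD => //; rewrite -mul_mpolyC; apply: (PM) => //; rewrite mpolyXE_id.
apply: big_ind => [||i _]; [by rewrite -mpolyC1|exact: PM|].
by elim: (m i) => [|j IH]; rewrite ?expr0 -?mpolyC1 // exprS; apply: PM.
Qed.

Definition modX (F : nzRingType) K (p q : {poly F}) := exists r, p - q = r * 'X^K.

Section Arcs.
Variables (F : fieldType) (m : nat).
Implicit Types (f g : {mpoly F[m]}) (gam : 'I_m -> {poly F}) (p w : 'I_m -> F).

Definition dif f p w : F := \sum_i (f^`M(i)).@[p] * w i.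

Definition along gam f : {poly F} := mmap (@polyC F) gam f.

Lemma alongD gam f g : along gam (f + g) = along gam f + along gam g.
Proof. exact: rmorphD. Qed.
Lemma alongM gam f g : along gam (f * g) = along gam f * along gam g.
Proof. exact: rmorphM. Qed.
Lemma alongX gam f e : along gam (f ^+ e) = along gam f ^+ e.
Proof. exact: rmorphXn. Qed.
Lemma along_sum gam (I : Type) (r : seq I) (Q : pred I) (h : I -> {mpoly F[m]}) :
  along gam (\sum_(i <- r | Q i) h i) = \sum_(i <- r | Q i) along gam (h i).
Proof. exact: rmorph_sum. Qed.
Lemma along_prod gam (I : Type) (r : seq I) (Q : pred I) (h : I -> {mpoly F[m]}) :
  along gam (\prod_(i <- r | Q i) h i) = \prod_(i <- r | Q i) along gam (h i).
Proof. exact: rmorph_prod. Qed.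
Lemma alongC gam c : along gam c%:MP = c%:P.
Proof. exact: mmapC. Qed.
Lemma along_var gam i : along gam 'X_i = gam i.
Proof. by rewrite /along mmapX mmap1U. Qed.

Lemma horner_along gam f t : (along gam f).[t] = f.@[fun i => (gam i).[t]].
Proof.
rewrite /along /mmap horner_sum mevalE; apply: eq_bigr => mo _.
rewrite hornerM hornerC horner_prod; congr (_ * _).
by apply: eq_bigr => i _; rewrite horner_exp.
Qed.

Lemma modX_ideal K : is_ideal [set p : {poly F} | exists r, p = r * 'X^K].
Proof.
split; first by exists 0; rewrite mul0r.
- by move=> f g [r ->] [s ->]; exists (r + s); rewrite mulrDl.
- by move=> f g [r ->]; exists (f * r); rewrite mulrA.
Qed.

Lemma modXW K K' (p q : {poly F}) : (K <= K')%N -> modX K' p q -> modX K p q.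
Proof. by move=> le [r E]; exists (r * 'X^(K' - K)); rewrite E -mulrA -exprD subnK. Qed.

Lemma modX_trans K (p q r : {poly F}) : modX K p q -> modX K q r -> modX K p r.
Proof.
move=> [a Ea] [b Eb]; exists (a + b).
by rewrite mulrDl -Ea -Eb; ring.
Qed.

Lemma along_cong K gam gam' f : (forall i, modX K (gam i) (gam' i)) ->
  modX K (along gam f) (along gam' f).
Proof. exact: (mmap_cong (modX_ideal K)). Qed.

Lemma poly_at0 (q : {poly F}) : exists s, q = (q.[0])%:P + 'X * s.
Proof.
have : root (q - (q.[0])%:P) 0 by rewrite rootE !hornerE subrr.
by move=> /factor_theorem [s Hs]; exists s; rewrite mulrC -['X]subr0 -polyC0 -Hs; ring.
Qed.

Lemma difM f g p w : dif (f * g) p w = f.@[p] * dif g p w + g.@[p] * dif f p w.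
Proof.
rewrite /dif !mulr_sumr -big_split /=; apply: eq_bigr => i _.
by rewrite mderivM mevalD !mevalM; ring.
Qed.

Lemma difD f g p w : dif (f + g) p w = dif f p w + dif g p w.
Proof. by rewrite /dif -big_split /=; apply: eq_bigr => i _; rewrite mderivD mevalD mulrDl. Qed.

Lemma difC c p w : dif c%:MP p w = 0.
Proof. by rewrite /dif big1 // => i _; rewrite mderivC meval0 mul0r. Qed.

Lemma dif_var i p w : dif 'X_i p w = w i.
Proof.
have S0 : (U_(i) - U_(i) = 0 :> 'X_{1..m})%MM by apply/mnmP => l; rewrite mnmBE mnm0E subnn.
rewrite /dif (bigD1 i) //= mderivX mnm1E eqxx scale1r S0 mpolyX0 meval1 mul1r.
rewrite big1 ?addr0 // => j ji.
by rewrite mderivX mnm1E eq_sym (negPf ji) scale0r meval0 mul0r.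
Qed.

Lemma along_taylor j gam f w :
  exists r, along (fun i => gam i + (w i)%:P * 'X^(j.+1)) f =
    along gam f + (dif f (fun i => (gam i).[0]) w)%:P * 'X^(j.+1) + r * 'X^(j.+2).
Proof.
elim/mpoly_ring_ind: f => [c|i|f g [r Hr] [s Hs]|f g [r Hr] [s Hs]].
- by exists 0; rewrite !alongC difC polyC0 !mul0r !addr0.
- by exists 0; rewrite !along_var dif_var mul0r addr0.
- by exists (r + s); rewrite !alongD Hr Hs difD polyCD; ring.
- have [a1 Ea] := poly_at0 (along gam f); have [b1 Eb] := poly_at0 (along gam g).
  rewrite !horner_along in Ea Eb.
  rewrite !alongM Hr Hs difM !(polyCD, polyCM).
  move: (along gam f) (along gam g) Ea Eb => a b Ea Eb.
  set a0 := (f.@[_])%:P in Ea *; set b0 := (g.@[_])%:P in Eb *.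
  set D := (dif f _ _)%:P; set E := (dif g _ _)%:P.
  exists (a1 * E + b1 * D + D * E * 'X^j + a * s + b * r + (D * s + E * r) * 'X^(j.+1)
    + r * s * 'X^(j.+2)).
  rewrite Ea Eb !exprS; move: ('X^j) => Y; ring.
Qed.

Lemma along_line p v f :
  exists r, along (fun i => (p i)%:P + (v i)%:P * 'X^1) f =
    (f.@[p])%:P + (dif f p v)%:P * 'X + r * 'X^2.
Proof.
have [r ->] := along_taylor 0 (fun i => (p i)%:P) f v; exists r.
have -> : along (fun i => (p i)%:P) f = (f.@[p])%:P.
  rewrite /along /mmap mevalE rmorph_sum /=; apply: eq_bigr => mo _.
  by rewrite polyCM rmorph_prod; congr (_ * _); apply: eq_bigr => i _; rewrite rmorphXn.
have -> : dif f (fun i => ((p i)%:P).[0]) v = dif f p v.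
  by rewrite /dif; apply: eq_bigr => i _; congr (_ * _); apply: meval_eq => l; rewrite hornerC.
by rewrite expr1.
Qed.

Section Lifting.
Variables (T : Type) (G : T -> {mpoly F[m]}) (tau : T -> {poly F}) (p : 'I_m -> F).
Hypothesis surj : forall b : T -> F, exists w, forall i, dif (G i) p w = b i.

(* Hensel lifting along polynomial arcs, one power of the parameter at a time. *)
Lemma arc_lift K gam : (0 < K)%N -> (forall i, (gam i).[0] = p i) ->
  (forall i, modX K (along gam (G i)) (tau i)) -> forall K', (K <= K')%N ->
  exists gam', [/\ forall i, (gam' i).[0] = p i, forall i, modX K (gam' i) (gam i) &
    forall i, modX K' (along gam' (G i)) (tau i)].
Proof.
move=> K0 gp Gt K' /subnKC <-; elim: (K' - K)%N => [|d [gam1 [g1 g2 g3]]].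
  by rewrite addn0; exists gam; split=> // i; exists 0; rewrite subrr mul0r.
have /choice [c Hc] i : exists c, along gam1 (G i) - tau i = c * 'X^(K + d) by apply: g3.
have [w Hw] := surj (fun i => - (c i).[0]).
have KE : (K + d = (K + d).-1.+1)%N by rewrite prednK // addn_gt0 K0.
exists (fun i => gam1 i + (w i)%:P * 'X^((K + d).-1.+1)); split=> i.
- by rewrite !hornerE /= g1 expr0n /= mulr0 addr0.
- have [r E] := g2 i; exists (r + (w i)%:P * 'X^d).
  by rewrite mulrDl -E -mulrA -exprD -KE addnC; ring.
- have [r ->] := along_taylor (K + d).-1 gam1 (G i) w.
  rewrite addnS -KE; have -> : dif (G i) (fun i => (gam1 i).[0]) w = - (c i).[0].
    by rewrite -Hw /dif; apply: eq_bigr => l _; congr (_ * _); apply: meval_eq.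
  have [s Es] := poly_at0 (c i); exists (s + r).
  have -> : along gam1 (G i) = tau i + c i * 'X^(K + d) by rewrite -(Hc i); ring.
  by rewrite {1}Es polyCN exprS; ring.
Qed.

End Lifting.

(** The line p + vX satisfies the equations modulo X^2 and lifts to an arc satisfying them modulo
    X^(M+1). Along it f^M is divisible by X^(M+1), so f is divisible by X^2, and its linear
    coefficient is the differential. This serves forms known only to lie in the radical of (G). *)
Lemma tangent_of_power q (G : 'I_q -> {mpoly F[m]}) p v f M (w : 'I_q -> {mpoly F[m]}) :
  (forall b : 'I_q -> F, exists w, forall i, dif (G i) p w = b i) ->
  (forall i, (G i).@[p] = 0) -> (forall i, dif (G i) p v = 0) ->
  f ^+ M = \sum_i G i * w i -> dif f p v = 0.
Proof.
move=> surj Gp Gv E.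
have fp : f.@[p] = 0.
  have /eqP : (f ^+ M).@[p] = 0.
    by rewrite E rmorph_sum /= big1 // => i _; rewrite mevalM Gp mul0r.
  by rewrite rmorphXn expf_eq0 => /andP[_ /eqP].
pose gam i := (p i)%:P + (v i)%:P * 'X^1.
have gam0 i : (gam i).[0] = p i.
  by rewrite /gam hornerD hornerM hornerXn !hornerC expr0n mulr0 addr0.
have tay g : modX 2 (along gam g) ((g.@[p])%:P + (dif g p v)%:P * 'X).
  by have [r ->] := along_line p v g; exists r; ring.
have [|gam' [g1 g2 g3]] := arc_lift (K := 2) (tau := fun=> 0) surj isT gam0 _
  (leq_maxl 2 M.+1).
  by move=> i; have := tay (G i); rewrite Gp Gv polyC0 mul0r addr0.
have [r Hr] : modX 2 (along gam' f) ((dif f p v)%:P * 'X).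
  by apply: modX_trans (along_cong f g2) _; have := tay f; rewrite fp polyC0 add0r.
have [s Hs] : modX M.+1 (along gam' (f ^+ M)) 0.
  rewrite E along_sum; apply: (modXW (leq_maxr 2 _)); rewrite /modX subr0.
  apply: (ideal_sum (modX_ideal _)) => i _; rewrite alongM.
  by apply: (idealMr (modX_ideal _)); have := g3 i; rewrite /modX subr0.
have {}Hr : along gam' f = ((dif f p v)%:P + r * 'X) * 'X.
  by move/eqP: Hr; rewrite subr_eq => /eqP ->; ring.
move: Hs; rewrite alongX subr0 Hr exprMn exprS [s * _]mulrA => /mulIf.
move/(_ (monic_neq0 (monicXn _ _))) => /(congr1 (horner^~ 0)).
rewrite horner_exp !hornerM hornerD hornerM !hornerX !hornerC !mulr0 addr0 => /eqP.
by rewrite expf_eq0 => /andP[_ /eqP].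
Qed.

End Arcs.

(** * Forms vanishing on the nodes of a grid *)

Section LinearForms.
Variables (F : closedFieldType) (n : nat).
Local Notation B := {mpoly F[n.+1]}.
Local Notation V := 'rV[F]_n.+1.
Implicit Types (f g : B) (u v a : V).

Definition lform a : B := \sum_i a 0 i *: 'X_i.

Lemma lform_eval a v : (lform a).@[v 0] = \sum_i a 0 i * v 0 i.
Proof. by rewrite rmorph_sum /=; apply: eq_bigr => i _; rewrite mevalZ mevalXU. Qed.

Lemma lform_homog a : lform a \is 1.-homog.
Proof. by apply: rpred_sum => i _; apply: rpredZ; rewrite dhomogX /= mdeg1. Qed.

Lemma lformD a u v : (lform a).@[(u + v) 0] = (lform a).@[u 0] + (lform a).@[v 0].
Proof. by rewrite !lform_eval -big_split /=; apply: eq_bigr => i _; rewrite mxE mulrDr. Qed.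

Lemma lformZ a c v : (lform a).@[(c *: v) 0] = c * (lform a).@[v 0].
Proof. by rewrite (dhomog_meval _ _ (lform_homog a)) expr1. Qed.

Lemma lformB a u v : (lform a).@[(u - v) 0] = (lform a).@[u 0] - (lform a).@[v 0].
Proof. by rewrite -scaleN1r lformD lformZ mulN1r. Qed.

(** The substitution changes the variables by multiples of the linear form, so the values of [f]
    differ by a multiple of it. When the form is 1 at [v0], the substitution is the projection along
    [v0] onto the hyperplane. *)
Lemma lform_division a v0 f : exists f1 : B, forall v,
  f.@[v 0] = f.@[(v - (lform a).@[v 0] *: v0) 0] + (lform a).@[v 0] * f1.@[v 0].
Proof.
pose I := [set p : B | exists r, p = r * lform a].
have idI : is_ideal I.
  split; first by exists 0; rewrite mul0r.
    by move=> g h [r ->] [s ->]; exists (r + s); rewrite mulrDl.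
  by move=> g h [r ->]; exists (g * r); rewrite mulrA.
have [i|f1 E] := @mmap_cong _ I idI F n.+1 (@mpolyC n.+1 F) (fun i => 'X_i)
  (fun i => 'X_i - v0 0 i *: lform a) f.
  by exists (v0 0 i)%:MP; rewrite opprB addrC subrK mul_mpolyC.
exists f1 => v; have /(congr1 (meval (v 0))) := E.
rewrite mevalB mevalM !meval_mmap => /eqP; rewrite subr_eq => /eqP E1.
rewrite [X in X + _](_ : _ = f.@[fun i => ('X_i - v0 0 i *: lform a).@[v 0]]).
  by rewrite addrC [_ * f1.@[_]]mulrC -E1; apply: meval_eq => i; rewrite mevalXU.
by apply: meval_eq => i; rewrite !mxE mevalB mevalZ mevalXU mulrC.
Qed.

Lemma line_vanish f v : (forall t, t != 0 -> f.@[(t *: v) 0] = 0) -> f.@[(0 : V) 0] = 0.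
Proof.
move=> H; pose P := along (fun i => (v 0 i)%:P * 'X) f.
have PE t : P.[t] = f.@[(t *: v) 0].
  by rewrite horner_along; apply: meval_eq => i; rewrite mxE hornerM hornerX hornerC mulrC.
have P0 : P = 0 by apply: poly_eq0_nz => t /H; rewrite PE.
by rewrite -(scale0r v) -PE P0 horner0.
Qed.

End LinearForms.

Section Grid.
Variables (F : closedFieldType) (n d : nat) (l : nat -> nat -> 'rV[F]_n.+1).
Local Notation B := {mpoly F[n.+1]}.
Local Notation V := 'rV[F]_n.+1.
Implicit Types (f g : B) (u v : V) (I s : nat -> nat).

Definition ell k i v : F := (lform (l k i)).@[v 0].
(** Multi-indices are total functions on [nat] of which only the values below [n] count; the
    inductions can then alter one entry with [upd]. *)
Definition valid I := forall k, (k < n)%N -> (I k < d)%N.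
Definition on_node I v := forall k, (k < n)%N -> ell k (I k) v = 0.
(* The subspace where the colours k >= j take the hyperplane numbered [I k]; the
   inductions below are on [j], from the nodes (j = 0) to the whole space. *)
Definition flat I j v := forall k, (k < n)%N -> (j <= k)%N -> ell k (I k) v = 0.
Definition color_form k : B := \prod_(i < d) lform (l k i).

Hypothesis d_gt0 : (0 < d)%N.
Hypothesis grid_dual : forall I j, valid I -> (j < n)%N ->
  exists v, ell j (I j) v = 1 /\ forall k, (k < n)%N -> k != j -> ell k (I k) v = 0.
Hypothesis grid_node : forall I, valid I -> exists2 v, v != 0 & on_node I v.
Hypothesis grid_distinct : forall I v j i, valid I -> v != 0 -> on_node I v ->
  (j < n)%N -> (i < d)%N -> i != I j -> ell j i v != 0.

Lemma ell_eq0F I v j i : valid I -> v != 0 -> on_node I v -> (j < n)%N -> (i < d)%N ->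
  i != I j -> (ell j i v == 0) = false.
Proof. by move=> vI v0 nv jn id ij; apply: negbTE; exact: (grid_distinct vI). Qed.

Definition upd I j t k := if k == j then t else I k.

Lemma upd_same I j t : upd I j t j = t. Proof. by rewrite /upd eqxx. Qed.

Lemma upd_gt I j t k : (j < k)%N -> upd I j t k = I k.
Proof. by rewrite /upd; case: eqP => // ->; rewrite ltnn. Qed.

Lemma upd_valid I j t : valid I -> (t < d)%N -> valid (upd I j t).
Proof. by move=> vI td k kn; rewrite /upd; case: eqP => // _; apply: vI. Qed.

Lemma flat0 I v : flat I 0 v <-> on_node I v.
Proof. by split=> H k kn; [apply: H|move=> _; apply: H]. Qed.

Lemma flat_at0 I j : flat I j 0.
Proof. by move=> k _ _; rewrite /ell -(scale0r (0 : V)) lformZ mul0r. Qed.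

Lemma flatZ I j c v : flat I j v -> flat I j (c *: v).
Proof. by move=> H k kn jk; rewrite /ell lformZ -/(ell _ _ _) H ?mulr0. Qed.

Lemma color_form_eval k v : (color_form k).@[v 0] = \prod_(i < d) ell k i v.
Proof. exact: rmorph_prod. Qed.

Lemma color_form_homog k : color_form k \is d.-homog.
Proof.
have -> : d = (\sum_(i < d) 1)%N by rewrite sum1_card card_ord.
rewrite /color_form; move: (d) => d'.
by elim/big_rec2: _ => [|i e p _ hp]; [exact: dhomog1|apply: dhomogM => //; apply: lform_homog].
Qed.

Lemma color_form_node I k v : valid I -> on_node I v -> (k < n)%N -> (color_form k).@[v 0] = 0.
Proof.
by move=> vI nI kn; rewrite color_form_eval (bigD1 (Ordinal (vI _ kn))) //= nI ?mul0r.
Qed.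

Definition vanish_nodes (Q : (nat -> nat) -> Prop) f :=
  forall I, valid I -> Q I -> forall v, v != 0 -> on_node I v -> f.@[v 0] = 0.

Lemma node_vanish I f : valid I -> vanish_nodes (fun I' => I' = I) f ->
  forall v, on_node I v -> f.@[v 0] = 0.
Proof.
move=> vI H v nv; have [->|v0] := eqVneq v 0; last exact: (H I).
have [p p0 np] := grid_node vI; apply: (line_vanish (v := p)) => t t0.
apply: (H I) => //; first by rewrite scaler_eq0 negb_or t0.
by apply/flat0; apply: flatZ; apply/flat0.
Qed.

(** The dual vector at index [t] of colour [j] is annihilated by the equations of the later colours,
    so projecting along it carries the larger flat into the smaller one, where [f] vanishes. *)
Lemma flat_division I j t f : valid I -> (j < n)%N -> (t < d)%N ->
  (forall v, flat (upd I j t) j v -> f.@[v 0] = 0) ->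
  exists f1 : B, forall v, flat I j.+1 v -> f.@[v 0] = ell j t v * f1.@[v 0].
Proof.
move=> vI jn td H; have [v0] := grid_dual (upd_valid j vI td) jn.
rewrite upd_same => -[v01 v0k].
have [f1 E] := lform_division (l j t) v0 f.
exists f1 => v fv; rewrite E H ?add0r // => k kn.
rewrite leq_eqVlt => /orP[/eqP <-|jk].
  by rewrite upd_same /ell lformB lformZ -!/(ell _ _ _) v01 mulr1 subrr.
rewrite upd_gt // /ell lformB lformZ -!/(ell _ _ _) fv //.
by have := v0k k kn; rewrite upd_gt // => -> //; rewrite ?mulr0 ?subrr // gtn_eqF.
Qed.

Lemma flat_division_homog I j t f e : valid I -> (j < n)%N -> (t < d)%N ->
  f \is e.+1.-homog -> (forall v, flat (upd I j t) j v -> f.@[v 0] = 0) ->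
  exists2 f1 : B, f1 \is e.-homog &
    forall v, flat I j.+1 v -> f.@[v 0] = ell j t v * f1.@[v 0].
Proof.
move=> vI jn td hf H; have [f1 E] := flat_division vI jn td H.
exists (pihomog mdeg e f1); first exact: pihomogP.
move=> v fv; have : (pihomog mdeg e.+1 (f - f1 * lform (l j t))).@[v 0] = 0.
  apply: pihomog_vanish => c; rewrite mevalB mevalM E; last exact: flatZ.
  by rewrite mulrC subrr.
rewrite raddfB /= (pihomog_dE hf) (pihomogM _ _ (lform_homog _)) ltnS leq0n subn1 /=.
by rewrite mevalB mevalM => /eqP; rewrite subr_eq0 mulrC => /eqP.
Qed.

(** An inner induction on [t] divides out the hyperplanes of colour [j] one by one. The cofactor [b]
    still vanishes at the nodes of the hyperplane numbered [t], because the factors numbered below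
    [t] do not vanish there; after [d] rounds the product is the colour form. *)
Lemma color_forms_generate_flat j : (j <= n)%N -> forall I f, valid I ->
  vanish_nodes (fun I' => forall k, (k < n)%N -> (j <= k)%N -> I' k = I k) f ->
  exists w : nat -> B, forall v, flat I j v ->
    f.@[v 0] = \sum_(k < j) (color_form k).@[v 0] * (w k).@[v 0].
Proof.
elim: j => [_ I f vI H|j IH jn I f vI H].
  exists (fun=> 0) => v /flat0 nv; rewrite big_ord0; apply: (node_vanish vI) nv.
  by move=> I' vI' ->; apply: H.
suff Ht t : (t <= d)%N -> exists w : nat -> B, exists b : B, forall v, flat I j.+1 v ->
    f.@[v 0] = \sum_(k < j) (color_form k).@[v 0] * (w k).@[v 0] +
      (\prod_(i < t) ell j i v) * b.@[v 0].
  have [w [b Hb]] := Ht d (leqnn d).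
  exists (fun k => if (k < j)%N then w k else b) => v fv.
  rewrite big_ord_recr /= ltnn Hb // color_form_eval; congr (_ + _).
  by apply: eq_bigr => k _; rewrite ltn_ord.
elim: t => [_|t IHt td].
  exists (fun=> 0), f => v _; rewrite big_ord0 mul1r big1 ?add0r // => k _.
  by rewrite meval0 mulr0.
have [w [b Hb]] := IHt (ltnW td).
have vI1 : valid (upd I j t) by apply: upd_valid.
have [|w' Hw'] := IH (ltnW jn) (upd I j t) b vI1.
  move=> I' vI' HI' v v0 nv.
  have I'j : I' j = t by rewrite HI' ?upd_same.
  have I'k k : (k < n)%N -> (j < k)%N -> I' k = I k.
    by move=> kn jk; rewrite HI' ?upd_gt // ltnW.
  have fv : flat I j.+1 v by move=> k kn jk; rewrite -I'k //; apply: nv.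
  have := Hb v fv; rewrite (H I' vI') // big1 ?add0r => [|k _].
    move/esym/eqP; rewrite mulf_eq0 => /orP[|/eqP //].
    rewrite prodf_seq_eq0 => /hasP [i _ /=]; rewrite (ell_eq0F vI' v0 nv) ?I'j ?ltn_eqF //.
    exact: leq_trans (ltn_ord i) (ltnW td).
  by rewrite (color_form_node vI') ?mul0r //; apply: ltn_trans (ltn_ord k) _.
pose g := b - \sum_(k < j) color_form k * w' k.
have gE v : g.@[v 0] = b.@[v 0] - \sum_(k < j) (color_form k).@[v 0] * (w' k).@[v 0].
  by rewrite mevalB rmorph_sum /=; congr (_ - _); apply: eq_bigr => k _; rewrite mevalM.
have [|g1 Hg1] := @flat_division I j t g vI jn td.
  by move=> v /Hw' E; rewrite gE E subrr.
exists (fun k => w k + (\prod_(i < t) lform (l j i)) * w' k), g1 => v fv.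
have Eb : b.@[v 0] = \sum_(k < j) (color_form k).@[v 0] * (w' k).@[v 0] +
    ell j t v * g1.@[v 0] by rewrite -Hg1 // gE; ring.
rewrite Hb // Eb big_ord_recr /= mulrDr addrA -mulrA; congr (_ + _).
rewrite mulr_sumr -big_split /=; apply: eq_bigr => k _.
have Ep : (\prod_(i < t) lform (l j i) : B).@[v 0] = \prod_(i < t) ell j i v.
  exact: rmorph_prod.
by rewrite mevalD mevalM Ep mulrDr; congr (_ + _); rewrite mulrCA.
Qed.

Theorem color_forms_generate f : vanish_nodes (fun=> True) f ->
  exists w : 'I_n -> B, f = \sum_(k < n) color_form k * w k.
Proof.
move=> H; have [|w Hw] := @color_forms_generate_flat n (leqnn n) (fun=> 0%N) f (fun _ _ => d_gt0).
  by move=> I vI _; apply: H.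
exists (fun k => w k); apply/eqP; rewrite -subr_eq0; apply/eqP/mpoly_eq0_fun => a.
pose v : V := \row_i a i; rewrite -(@meval_eq _ _ (v 0)) => [|i]; last by rewrite mxE.
rewrite mevalB Hw => [|k kn]; last by rewrite leqNgt kn.
by rewrite rmorph_sum /= -sumrB big1 // => k _; rewrite mevalM subrr.
Qed.

(** Newton interpolation on a simplicial array. The case of one colour less gives vanishing on the
    hyperplane numbered [s j]; division by its equation lowers the degree by one and shifts the
    array by one step in colour [j]. *)
Lemma unisolvent j : (j <= n)%N -> forall e I s f, valid I -> f \is e.-homog ->
  (forall k, (k < j)%N -> (s k + e < d)%N) ->
  vanish_nodes (fun I' => [/\ forall k, (k < n)%N -> (j <= k)%N -> I' k = I k,
     forall k, (k < j)%N -> (s k <= I' k)%N & (\sum_(k < j) (I' k - s k) <= e)%N]) f ->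
  forall v, flat I j v -> f.@[v 0] = 0.
Proof.
elim: j => [_ e I s f vI hf _ H v /flat0 nv|j IH jn e].
  apply: (node_vanish vI) nv => I' vI' ->; apply: H => //.
  by split=> //; rewrite big_ord0.
elim: e => [|e IHe] I s f vI hf Hs H.
all: have sjd : (s j < d)%N by have := Hs j (leqnn _); lia.
all: have vI1 : valid (upd I j (s j)) by apply: upd_valid.
all: have Hj : forall v, flat (upd I j (s j)) j v -> f.@[v 0] = 0.
1,3: apply: (IH (ltnW jn) _ _ s f vI1 hf) => [k kj|I' vI' [H1 H2 H3]];
  first (by apply: Hs; rewrite ltnS ltnW);
  have I'j : I' j = s j by [rewrite H1 ?upd_same];
  apply: H => //; split;
  [by move=> k kn jk; rewrite H1 ?upd_gt // ltnW
  |by move=> k; rewrite ltnS leq_eqVlt => /orP[/eqP -> |/H2 //]; rewrite I'j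
  |by rewrite big_ord_recr /= I'j subnn addn0].
  (* In degree 0 the form is constant, and the origin lies in every flat. *)
  move=> v _; have := Hj 0 (@flat_at0 (upd I j (s j)) j).
  by rewrite -(scale0r v) (dhomog_meval _ _ hf) expr0 mul1r.
have [f1 hf1 E] := flat_division_homog vI jn sjd hf Hj.
move=> v fv; rewrite E // (IHe I (upd s j (s j).+1) f1) ?mulr0 //.
  move=> k kj; have := Hs k kj; rewrite /upd; case: eqP => [->|_]; lia.
move=> I' vI' [H1 H2 H3] v' v0 nv.
have I'j : (s j < I' j)%N by have := H2 j (leqnn _); rewrite upd_same.
have fv' : flat I j.+1 v' by move=> k kn jk; rewrite -H1 //; apply: nv.
have : f.@[v' 0] = 0.
  apply: (H I' vI' _ v' v0 nv); split=> //.
    move=> k kj; have := H2 k kj; rewrite /upd; case: eqP => [->|//]; lia.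
  move: H3; rewrite !big_ord_recr /= upd_same.
  rewrite (eq_bigr (fun k : 'I_j => (I' k - s k)%N)) => [|k _]; first lia.
  by rewrite /upd ltn_eqF.
rewrite E // => /eqP; rewrite mulf_eq0 => /orP[|/eqP //].
by rewrite (ell_eq0F vI' v0 nv) // ltn_eqF.
Qed.

(** Colour [j] has only the [e] indices from [t] to d - 1 left, so the simplex of size [e] lacks
    exactly the vertex of index [d]. One condition fewer than unisolvence leaves a line of
    solutions, spanned by the product of the remaining hyperplanes. *)
Lemma unisolvent_short j : (j < n)%N -> forall e I t f, valid I -> f \is e.-homog ->
  (0 < t)%N -> (t + e = d)%N ->
  vanish_nodes (fun I' => [/\ forall k, (k < n)%N -> (j < k)%N -> I' k = I k,
     (t <= I' j)%N & (\sum_(k < j) I' k + (I' j - t) <= e)%N]) f ->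
  exists c, forall v, flat I j.+1 v -> f.@[v 0] = c * \prod_(t <= i < d) ell j i v.
Proof.
move=> jn; elim=> [|e IHe] I t f vI hf t0 te H.
  exists f.@[(0 : V) 0] => v _; rewrite -te addn0 big_geq // mulr1.
  by rewrite -(scale0r v) (dhomog_meval _ _ hf) expr0 mul1r.
have td : (t < d)%N by lia.
have vI1 : valid (upd I j t) by apply: upd_valid.
have [|f1 hf1 E] := flat_division_homog vI jn td hf.
  apply: (unisolvent (ltnW jn) (s := fun=> 0%N) vI1 hf) => [k kj|I' vI' [H1 _ H3]]; first lia.
  have I'j : I' j = t by rewrite H1 ?upd_same.
  apply: H => //; split; first by move=> k kn jk; rewrite H1 ?upd_gt // ltnW.
    by rewrite I'j.
  by rewrite I'j subnn addn0; move: H3; under eq_bigr do rewrite subn0.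
have [|||c Hc] := IHe I t.+1 f1 vI hf1; [by []|lia| |].
  move=> I' vI' [H1 H2 H3] v' v0 nv.
  have fv' : flat I j.+1 v' by move=> k kn jk; rewrite -H1 //; apply: nv.
  have : f.@[v' 0] = 0 by apply: (H I' vI' _ v' v0 nv); split=> //; lia.
  rewrite E // => /eqP; rewrite mulf_eq0 => /orP[|/eqP //].
  by rewrite (ell_eq0F vI' v0 nv) // ltn_eqF.
by exists c => v fv; rewrite E // Hc // [in RHS]big_ltn // mulrCA.
Qed.

(** Restriction to the hyperplane numbered 0 of colour [j] yields the coefficients of the earlier
    colours. The difference is divisible by that hyperplane, and its quotient of degree d - 1 falls
    under [unisolvent_short] with t = 1, which supplies the rest of the colour form. *)
Lemma simplex_span_flat j : (j <= n)%N -> forall I f, valid I -> f \is d.-homog ->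
  vanish_nodes (fun I' => (forall k, (k < n)%N -> (j <= k)%N -> I' k = I k) /\
    (\sum_(k < j) I' k <= d)%N) f ->
  exists c : nat -> F, forall v, flat I j v ->
    f.@[v 0] = \sum_(k < j) c k * (color_form k).@[v 0].
Proof.
elim: j => [_ I f vI hf H|j IH jn I f vI hf H].
  exists (fun=> 0) => v /flat0 nv; rewrite big_ord0; apply: (node_vanish vI) nv.
  by move=> I' vI' ->; apply: H => //; rewrite big_ord0.
have vI1 : valid (upd I j 0) by apply: upd_valid.
have [|c Hc] := IH (ltnW jn) _ f vI1 hf.
  move=> I' vI' [H1 H2]; apply: H => //; split.
    by move=> k kn jk; rewrite H1 ?upd_gt // ltnW.
  by rewrite big_ord_recr /= [I' j]H1 ?upd_same ?addn0.
pose g := f - \sum_(k < j) c k *: color_form k.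
have gE v : g.@[v 0] = f.@[v 0] - \sum_(k < j) c k * (color_form k).@[v 0].
  by rewrite mevalB rmorph_sum /=; congr (_ - _); apply: eq_bigr => k _; rewrite mevalZ.
have hg : g \is d.-1.+1.-homog.
  rewrite prednK //; apply: rpredB => //; apply: rpred_sum => k _; apply: rpredZ.
  exact: color_form_homog.
have [|g1 hg1 E] := flat_division_homog vI jn d_gt0 hg.
  by move=> v /Hc Ev; rewrite gE Ev subrr.
have [||c' Hc'] := unisolvent_short jn vI hg1 (ltn0Sn 0); first by rewrite add1n prednK.
  move=> I' vI' [H1 H2 H3] v' v0 nv.
  have fv' : flat I j.+1 v' by move=> k kn jk; rewrite -H1 //; apply: nv.
  have : g.@[v' 0] = 0.
    rewrite gE (H I' vI' _ v' v0 nv) ?sub0r; last first.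
      split=> //; rewrite big_ord_recr /=.
      by move: H2 H3 d_gt0; move: (\sum_(k < j) I' k)%N (I' j) => S x; lia.
    rewrite big1 ?oppr0 // => k _; rewrite (color_form_node vI') ?mulr0 //.
    by apply: ltn_trans (ltn_ord k) _.
  rewrite E // => /eqP; rewrite mulf_eq0 => /orP[|/eqP //].
  by rewrite (ell_eq0F vI' v0 nv) // ltn_eqF.
exists (fun k => if (k < j)%N then c k else c') => v fv.
rewrite big_ord_recr /= ltnn.
under eq_bigr do rewrite ltn_ord.
apply/eqP; rewrite addrC -subr_eq -gE E // Hc' // color_form_eval mulrCA.
by rewrite -(big_mkord xpredT (fun i => ell j i v)) [in X in _ == X]big_ltn.
Qed.

Theorem simplex_span f e : f != 0 -> f \is e.-homog -> (e <= d)%N ->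
  vanish_nodes (fun I => (\sum_(k < n) I k <= d)%N) f ->
  exists c : 'I_n -> F, f = \sum_(k < n) c k *: color_form k.
Proof.
move=> f0 hf ed H.
have vI : valid (fun=> 0%N) by move=> k _.
have all_flat v : flat (fun=> 0%N) n v by move=> k kn; rewrite leqNgt kn.
have fun_eq g : (forall v : V, f.@[v 0] = g.@[v 0]) -> f = g.
  move=> fg; apply/eqP; rewrite -subr_eq0; apply/eqP/mpoly_eq0_fun => a.
  pose v : V := \row_i a i; rewrite -(@meval_eq _ _ (v 0)) => [|i]; last by rewrite mxE.
  by rewrite mevalB fg subrr.
move: ed; rewrite leq_eqVlt => /orP[/eqP ed|ed].
  rewrite ed in hf.
  have [|c Hc] := simplex_span_flat (leqnn n) vI hf; first by move=> I vI' [_ ]; apply: H.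
  exists (fun k => c k); apply: fun_eq => v; rewrite Hc // rmorph_sum /=.
  by apply: eq_bigr => k _; rewrite mevalZ.
(* Below degree [d] no vertex of the simplex is missing, and unisolvence forces f = 0. *)
case/eqP: f0; apply: fun_eq => v; rewrite meval0.
apply: (unisolvent (leqnn n) (s := fun=> 0%N) vI hf) => // I vI' [_ _ le].
by apply: H => //; apply: leq_trans (ltnW ed); move: le; under eq_bigr do rewrite subn0.
Qed.

End Grid.

(** * Components of the pencil *)

Section Domination.
Variables (F : closedFieldType) (n d r k : nat).
Hypothesis Func : uncountable_field F.
Local Notation B := {mpoly F[n.+1]}.
Local Notation V := 'rV[F]_n.+1.
Variables (gR : 'I_r -> B) (gK : 'I_k -> B) (lam : B) (N : set V).
Hypothesis d_gt0 : (0 < d)%N.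
Hypothesis gRh : forall i, gR i \is d.-homog.
Hypothesis gKh : forall i, gK i \is d.-homog.
Hypothesis lamh : lam \is 1.-homog.
Hypothesis generate : forall f : B, (forall p, N p -> f.@[p 0] = 0) ->
  exists w w', f = \sum_i gR i * w i + \sum_i gK i * w' i.
Hypothesis gRN : forall p i, N p -> (gR i).@[p 0] = 0.
Hypothesis gKN : forall p i, N p -> (gK i).@[p 0] = 0.
Hypothesis lamN : forall p, N p -> lam.@[p 0] != 0.
Hypothesis difN : forall p (b : 'I_r -> F) (b' : 'I_k -> F) c, N p -> exists w : 'I_n.+1 -> F,
  [/\ forall i, dif (gR i) (p 0) w = b i, forall i, dif (gK i) (p 0) w = b' i &
    dif lam (p 0) w = c].

Definition cons_fun (T : Type) (c : T) (a : 'I_k -> T) (i : 'I_k.+1) : T :=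
  if unlift ord0 i is Some j then a j else c.

Definition params : 'I_k.+1 -> B := cons_fun (lam ^+ d) gK.

Lemma params_homog i : params i \is d.-homog.
Proof.
rewrite /params /cons_fun; case: unlift => [j|]; first exact: gKh.
by rewrite -[d in d.-homog]mul1n; apply: dhomogMn.
Qed.

Let at_params (P : {mpoly F[k.+1]}) : B := mmap (@mpolyC n.+1 F) params P.

Lemma node_arc p (a : 'I_k -> F) K : N p -> exists gam : 'I_n.+1 -> {poly F},
  [/\ forall i, (gam i).[0] = p 0 i, forall i, modX K.+1 (along gam (gR i)) 0,
    forall i, modX K.+1 (along gam (gK i)) ((a i)%:P * 'X) &
    modX K.+1 (along gam lam) (lam.@[p 0])%:P].
Proof.
move=> Np.
pose G (t : option ('I_r + 'I_k)) : B :=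
  match t with None => lam | Some (inl i) => gR i | Some (inr i) => gK i end.
pose tau (t : option ('I_r + 'I_k)) : {poly F} :=
  match t with None => (lam.@[p 0])%:P | Some (inl i) => 0 | Some (inr i) => (a i)%:P * 'X end.
have [b|||gam [g1 _ g3]] := @arc_lift F n.+1 _ G tau (p 0) _ 1 (fun i => (p 0 i)%:P) isT _ _ K.+1 isT.
- have [w [w1 w2 w3]] := difN (fun i => b (Some (inl i))) (fun i => b (Some (inr i))) (b None) Np.
  by exists w => -[[i|i]|]; [exact: w1|exact: w2|exact: w3].
- by move=> i; rewrite hornerC.
- move=> t; have [s ->] := poly_at0 (along (fun i => (p 0 i)%:P) (G t)).
  have -> : (along (fun i => (p 0 i)%:P) (G t)).[0] = (G t).@[p 0].
    by rewrite horner_along; apply: meval_eq => i; rewrite hornerC.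
  case: t s => [[i|i]|] s /=; rewrite ?gRN ?gKN // ?polyC0.
  + by exists s; rewrite expr1; ring.
  + by exists (s - (a i)%:P); rewrite expr1; ring.
  + by exists s; rewrite expr1; ring.
exists gam; split=> // [i|i|]; first exact: (g3 (Some (inl i))).
  exact: (g3 (Some (inr i))).
exact: (g3 None).
Qed.

(** Along the arcs the first parameter is constant to high order, with value lam(p)^d; [P] has to
    survive on each such slice. *)
Definition generic_in_params (P : {mpoly F[k.+1]}) :=
  forall c, c != 0 -> exists a : 'I_k -> F, P.@[cons_fun c a] != 0.

(** Along the arc [u] is t^j times a series with constant term Q(a) at [p], and [at_params P] is a
    nonzero polynomial [pi] in t, up to high order. Since their product vanishes, Q(a) is 0 at [p]
    whenever P(c, a) is not, hence for all a. *)
Lemma leading_coef_vanish P u w (Q : {mpoly B[k]}) j : generic_in_params P ->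
  Q \is j.-homog -> at_params P * u = \sum_i gR i * w i ->
  (exists w', u = \sum_i gR i * w' i + Q.@[gK]) ->
  forall al p, N p -> (Q@_al).@[p 0] = 0.
Proof.
move=> Pgen hQ Pu [w' uE] al p Np.
pose c := lam.@[p 0] ^+ d; have c0 : c != 0 by rewrite expf_neq0 ?lamN.
pose Qp : {mpoly F[k]} := map_mpoly (meval (p 0)) Q.
suff Qp0 : Qp = 0 by rewrite -mcoeff_map_mpoly -/Qp Qp0 mcoeff0.
pose Pc : {mpoly F[k]} := mmap (@mpolyC k F) (cons_fun c%:MP (fun i => 'X_i)) P.
have PcE a : Pc.@[a] = P.@[cons_fun c a].
  rewrite /Pc /mmap rmorph_sum mevalE /=; apply: eq_bigr => m _.
  rewrite mevalM mevalC rmorph_prod; congr (_ * _).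
  apply: eq_bigr => i _; rewrite rmorphXn /= /cons_fun; congr (_ ^+ _).
  by case: unlift => [i'|]; rewrite ?mevalXU ?mevalC.
have Pc0 : Pc != 0.
  have [a Pa] := Pgen c c0; apply/eqP => E.
  by move: Pa; rewrite -PcE E meval0 eqxx.
suff : Qp * Pc = 0 by move/eqP; rewrite mulf_eq0 (negPf Pc0) orbF => /eqP.
apply: mpoly_eq0_fun => a; rewrite mevalM PcE.
have [->|Pa] := eqVneq P.@[cons_fun c a] 0; first by rewrite mulr0.
suff -> : Qp.@[a] = 0 by rewrite mul0r.
pose pi : {poly F} := mmap (@polyC F) (cons_fun c%:P (fun i => (a i)%:P * 'X)) P.
have pi0 : pi != 0.
  apply/eqP => /(congr1 (horner^~ 1)); rewrite horner0 => E.
  move/eqP: Pa; apply; rewrite -E /pi /mmap horner_sum mevalE.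
  apply: eq_bigr => m _; rewrite hornerM hornerC horner_prod; congr (_ * _).
  apply: eq_bigr => i _; rewrite horner_exp /cons_fun; congr (_ ^+ _).
  by case: unlift => [i'|]; rewrite ?hornerM ?hornerX ?hornerC ?mulr1.
(* [j] orders account for the factor t^j; the remaining ones exceed the degree of [pi], so that
   divisibility forces q(0) = 0. *)
have [gam [g0 gR0 gKa gl]] := node_arc a (j + size pi) Np.
set K := (j + size pi).+1 in gR0 gKa gl.
have idK := modX_ideal F K.
have sumR (v : 'I_r -> B) : modX K (along gam (\sum_i gR i * v i)) 0.
  rewrite /modX subr0 along_sum; apply: (ideal_sum idK) => i _; rewrite alongM.
  by apply: (idealMr idK); have := gR0 i; rewrite /modX subr0.
pose q : {poly F} := \sum_(m <- msupp Q) along gam Q@_m * (\prod_i a i ^+ m i)%:P.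
have q0 : q.[0] = Qp.@[a].
  rewrite /q /Qp /map_mpoly /mmap horner_sum rmorph_sum /=; apply: eq_bigr => m _.
  rewrite hornerM hornerC mevalM mevalC horner_along rmorph_prod /=; congr (_ * _).
    exact: meval_eq.
  by apply: eq_bigr => i _; rewrite rmorphXn /= mevalXU.
have HQ : modX K (along gam u) (q * 'X^j).
  have -> : along gam u = along gam (\sum_i gR i * w' i) + along gam Q.@[gK].
    by rewrite uE alongD.
  apply: (@modX_trans _ _ _ (0 + along gam Q.@[gK])).
    by have [s Hs] := sumR w'; exists s; rewrite -Hs; ring.
  rewrite add0r mevalE along_sum /q mulr_suml /modX -sumrB big_seq.
  apply: (ideal_sum idK) => m mQ; rewrite alongM -mulrA -mulrBr; apply: (idealMl idK).
  have -> : (\prod_i a i ^+ m i)%:P * 'X^j = mmap1 (fun i => (a i)%:P * 'X) m.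
    have /dhomogP/(_ m mQ) /= <- := hQ.
    rewrite rmorph_prod /= mdegE -prodrXr -big_split /=.
    by apply: eq_bigr => i _; rewrite exprMn rmorphXn.
  have -> : along gam (\prod_i gK i ^+ m i) = mmap1 (fun i => along gam (gK i)) m.
    by rewrite along_prod; apply: eq_bigr => i _; rewrite alongX.
  exact: (mmap1_cong idK).
have HP : modX K (along gam (at_params P)) pi.
  have -> : along gam (at_params P) = mmap (@polyC F) (fun i => along gam (params i)) P.
    rewrite /at_params /mmap along_sum; apply: eq_bigr => m _.
    rewrite alongM alongC along_prod; congr (_ * _).
    by apply: eq_bigr => i _; rewrite alongX.
  apply: (mmap_cong idK) => i; rewrite /params /cons_fun; case: unlift => [i'|].
    exact: gKa.
  by rewrite alongX /c polyC_exp; apply: (idealXcong idK).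
have H0 : modX K (q * 'X^j * pi) 0.
  have idM : modX K (along gam u * along gam (at_params P)) (q * 'X^j * pi).
    exact: (idealMcong idK).
  have [s Hs] := sumR w; have [t Ht] := idM.
  exists (s - t); rewrite mulrBl -Hs -Ht -Pu alongM; ring.
have [s Hs] := H0; rewrite subr0 in Hs.
have {Hs} dv : 'X^((size pi).+1) %| q * pi.
  apply/dvdpP; exists s; apply: (mulIf (monic_neq0 (monicXn F j))).
  by rewrite -[RHS]mulrA -exprD addSn addnC -Hs; ring.
apply/eqP/negPn/negP => Qa.
have cop : coprimep 'X^((size pi).+1) q.
  by rewrite coprimep_expl // coprimep_sym coprimepX rootE q0.
move: dv; rewrite (Gauss_dvdpr _ cop) => /dvdp_leq -/(_ pi0).
by rewrite size_polyXn ltnNge leqnSn.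
Qed.

(* [P(params)] is a non-zero-divisor modulo [gR]: by induction on j, u lies in
   (gR) + (gK)^j, since along arcs with gR = 0 and gK = a t the leading
   coefficients vanish at the nodes and hence lie in (gR, gK).  For j larger
   than the degree of u the second summand disappears. *)
Lemma params_regular_mod P u w e : generic_in_params P -> u \is e.-homog ->
  at_params P * u = \sum_i gR i * w i -> exists w', u = \sum_i gR i * w' i.
Proof.
move=> Pgen hu Pu.
have step j : exists2 Q : {mpoly B[k]}, Q \is j.-homog &
    exists w', u = \sum_i gR i * w' i + Q.@[gK].
  elim: j => [|j [Q hQ uE]].
    exists u%:MP.
      by rewrite -[u%:MP]mulr1 mul_mpolyC; apply: rpredZ; apply: dhomog1.
    by exists (fun=> 0); rewrite mevalC big1 ?add0r // => i _; rewrite mulr0.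
  have Qv := leading_coef_vanish Pgen hQ Pu uE; have [w0 {}uE] := uE.
  have /choice [vv Hvv] (m : 'X_{1..k}) : exists v : ('I_r -> B) * ('I_k -> B),
      Q@_m = \sum_i gR i * v.1 i + \sum_i gK i * v.2 i.
    have [v1 [v2 E]] := generate (fun p Np => Qv m p Np).
    by exists (v1, v2).
  exists (\sum_(m <- msupp Q) \sum_i (vv m).2 i *: ('X_[m] * 'X_i)).
    rewrite big_seq; apply: rpred_sum => m mQ; apply: rpred_sum => i _; apply: rpredZ.
    rewrite -mpolyXD dhomogX /= mdegD mdeg1 addn1.
    by have /dhomogP/(_ m mQ) /= -> := hQ.
  exists (fun i => w0 i + \sum_(m <- msupp Q) (vv m).1 i * \prod_s gK s ^+ m s).
  under eq_bigr do rewrite mulrDr.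
  rewrite big_split /= -addrA {1}uE; congr (_ + _).
  rewrite mevalE rmorph_sum /=.
  under [X in _ = X + _]eq_bigr do rewrite mulr_sumr.
  rewrite exchange_big -big_split /=; apply: eq_bigr => m _.
  rewrite {1}Hvv mulrDl !mulr_suml rmorph_sum /=; congr (_ + _).
    by apply: eq_bigr => i _; rewrite mulrA.
  apply: eq_bigr => i _; rewrite mevalZ mevalM mevalXU mevalX; ring.
(* The terms of Q(gK) are now multiples of forms of degree d (e + 1) > e, so they do not contribute
   to the component of degree [e], which is [u]. *)
have [Q hQ [w' uE]] := step e.+1.
exists (fun i => if (d <= e)%N then pihomog mdeg (e - d) (w' i) else 0).
rewrite -[LHS](pihomog_dE hu) {1}uE raddfD /= mevalE !raddf_sum /=.
rewrite [X in _ + X]big1_seq ?addr0 => [|m /andP[_ mQ]].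
  apply: eq_bigr => i _; rewrite mulrC (pihomogM _ _ (gRh i)).
  by case: ifP => _; rewrite ?mulr0 // mulrC.
have hm : \prod_i gK i ^+ m i \is (d * e.+1).-homog.
  have /dhomogP/(_ m mQ) /= <- := hQ; rewrite mdegE big_distrr /=.
  elim/big_rec2: _ => [|i p s _ hp]; first exact: dhomog1.
  by apply: dhomogM => //; apply: dhomogMn.
rewrite (pihomogM _ _ hm) ifF //; apply/negbTE; rewrite -ltnNge.
by apply: leq_trans (leq_pmull _ d_gt0).
Qed.

(** Scaling spreads vanishing on one slice to all points with nonzero first coordinate, so
    [P * 'X_ord0] vanishes everywhere. *)
Lemma homogeneous_generic (P : {mpoly F[k.+1]}) e : P != 0 -> P \is e.-homog ->
  generic_in_params P.
Proof.
move=> P0 hP c c0; apply: contrapT => /forallNP Ha.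
have {}Ha a : P.@[cons_fun c a] = 0 by apply/eqP/negPn/negP; exact: Ha.
case/eqP: P0; have /eqP : P * 'X_ord0 = 0.
  apply: mpoly_eq0_fun => b; rewrite mevalM mevalXU.
  have [->|b0] := eqVneq (b ord0) 0; first by rewrite mulr0.
  have := dhomog_meval (b ord0 / c) (\row_i cons_fun c (fun i => b (lift ord0 i) * c / b ord0) i) hP.
  rewrite (meval_eq (v2 := b)) => [->|i].
    rewrite (meval_eq (v2 := cons_fun c (fun i => b (lift ord0 i) * c / b ord0))) => [|i].
      by rewrite Ha mulr0 mul0r.
    by rewrite mxE.
  rewrite !mxE /cons_fun; have [j ->|->] := unliftP ord0 i; field.
    by rewrite ?c0 ?b0.
  by rewrite ?c0 ?b0.
rewrite mulf_eq0 => /orP[/eqP //|].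
by rewrite -msize_poly_eq0 msizeX.
Qed.

(** A relation on [W] gives a form [h] that is regular modulo (gR) and vanishes on [W]. If u h^a
    vanished on the zero set, a power of it and then, by regularity, a power of u would lie in (gR),
    so u would vanish on [W]. Hence some irreducible subset carries all u h^a with u nonzero on [W];
    it contains [W], equals it by maximality, and yet [h] vanishes there. *)
Theorem component_dominates W : component (zero_set (range gR)) W -> alg_indep W params.
Proof.
set Z := zero_set (range gR) => -[irrW WZ maxW] P HP; have [cW Wn0 _] := irrW.
apply/eqP/negPn/negP => P0.
have [e [Pe0 hPe]] : exists e, pihomog mdeg e P != 0 /\ pihomog mdeg e P \is e.-homog.
  apply: contrapT => /forallNP H; move/eqP: P0; apply; rewrite (mpoly_sum_homog P) big1 // => e _.
  by apply/eqP/negPn/negP => ne; apply: (H e); split=> //; apply: pihomogP.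
have Pgen := homogeneous_generic Pe0 hPe.
pose h := at_params (pihomog mdeg e P).
have evat Q (u : V) : (at_params Q).@[u 0] = Q.@[fun i => (params i).@[u 0]] by apply: meval_mmap.
have hW : cone_vanish h W.
  move=> u Wu; rewrite /h evat.
  rewrite -(@meval_eq _ _ ((\row_i (params i).@[u 0] : 'rV[F]_k.+1) 0)) => [|i]; last by rewrite mxE.
  apply: pihomog_vanish => c.
  have [t Ht] : exists t, root ('X^d - c%:P) t.
    by apply/closed_rootP; rewrite size_XnsubC // eqSS -lt0n.
  have tc : t ^+ d = c by move: Ht; rewrite rootE !hornerE subr_eq0 => /eqP.
  rewrite -(HP _ (coneZ t Wu)); apply: meval_eq => i.
  by rewrite !mxE (dhomog_meval _ _ (params_homog i)) tc.
have hh : homogeneous h.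
  exists (d * e)%N; rewrite /h /at_params /mmap big_seq; apply: rpred_sum => m mP.
  rewrite mul_mpolyC; apply: rpredZ.
  have /dhomogP/(_ m mP) /= <- := hPe; rewrite /mmap1 mdegE big_distrr /=.
  elim/big_rec2: _ => [|i p s _ hp]; first exact: dhomog1.
  by apply: dhomogM => //; apply: dhomogMn; apply: params_homog.
have cZ : zariski_closed Z.
  by exists (range gR) => // _ [i _ <-]; exists d.
pose Sig : set B := [set s | exists u N', [/\ homogeneous u, ~ cone_vanish u W & s = u * h ^+ N']].
have one_in : [/\ homogeneous (1 : B) & ~ cone_vanish (1 : B) W].
  split; first by exists 0%N; apply: dhomog1.
  by move/(_ 0 (cone0 _)) => /eqP; rewrite meval1 oner_eq0.
have [|||W' [irr' W'Z W'S]] := irreducible_avoiding Func (Sig := Sig) cZ.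
- move=> s t [u [a [hu nu ->]]] [v [b [hv nv ->]]]; exists (u * v), (a + b)%N; split.
  + by have [e1 h1] := hu; have [e2 h2] := hv; exists (e1 + e2)%N; apply: dhomogM.
  + by move=> uv; apply: nv; apply: (irreducible_cancel irrW hu nu uv).
  + by rewrite exprD; ring.
- exists h; last exact: (hW 0 (cone0 _)).
  by have [h1 h2] := one_in; exists 1, 1%N; split=> //; rewrite mul1r expr1.
- move=> s [u [a [[eu hu] nu ->]]] uh; apply: nu.
  pose J : set B := [set f | exists w, f = \sum_i gR i * w i].
  have idJ : is_ideal J.
    split; first by exists (fun=> 0); rewrite big1 // => i _; rewrite mulr0.
      move=> f g [w1 ->] [w2 ->]; exists (fun i => w1 i + w2 i).
      by rewrite -big_split /=; apply: eq_bigr => i _; rewrite mulrDr.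
    move=> f g [w1 ->]; exists (fun i => f * w1 i).
    by rewrite mulr_sumr; apply: eq_bigr => i _; rewrite mulrCA.
  have [|M [w Hw]] := nullstellensatz Func (f := u * h ^+ a) idJ.
    move=> x Hx; pose v : V := \row_i x i.
    have E g : g.@[v 0] = g.@[x] by apply: meval_eq => j; rewrite mxE.
    rewrite -E; apply: uh; have [->|v0] := eqVneq v 0; first exact: cone0.
    apply/(cone_pt _ v0) => _ [i _ <-].
    apply/(vanishesP _ v0); [by exists d|exact: memv_line|rewrite E; apply: Hx].
    exists (fun j => (j == i)%:R); rewrite (bigD1 i) //= eqxx mulr1 big1 ?addr0 // => j /negPf ->.
    by rewrite mulr0.
  have [|||w' Hw'] := @params_regular_mod (pihomog mdeg e P ^+ (a * M)) (u ^+ M) w (eu * M).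
  - apply: (@homogeneous_generic _ (e * (a * M))); first by rewrite expf_neq0.
    exact: dhomogMn.
  - exact: dhomogMn.
  - rewrite -Hw exprMn -exprM mulrC; congr (_ * _).
    by rewrite /h /at_params rmorphXn.
  move=> v Wv; have /eqP : (u ^+ M).@[v 0] = 0.
    rewrite Hw' rmorph_sum /= big1 // => i _; rewrite mevalM.
    have -> : (gR i).@[v 0] = 0; last by rewrite mul0r.
    case: Wv => [->|[x /WZ Zx vx]]; first exact: dhomog_meval0 (gRh i) d_gt0.
    by apply: (Zx (gR i)) => //; exists i.
  by rewrite rmorphXn expf_eq0 => /andP[_ /eqP].
have W'W : W' = W.
  apply: maxW => //; apply: sub_closedP; first by case: irr'.
  move=> s hs sW'; apply: contrapT => ns; apply: (W'S s) => //.
  by exists s, 0%N; split=> //; rewrite expr0 mulr1.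
have [h1 h2] := one_in; apply: (W'S h); last by rewrite W'W.
by exists 1, 1%N; split=> //; rewrite mul1r expr1.
Qed.

End Domination.

(** * Zeros of transversal systems *)

Section WeightedSimplices.
Variables (n : nat) (e : 'I_n -> nat).
Hypothesis e_gt0 : forall i, (0 < e i)%N.

Definition weight (al : 'I_n -> nat) := (\sum_i e i * al i)%N.

(** The bound [L] makes the type finite; by [simplex_width] it does not affect the count once it
    reaches [M]. *)
Definition simplex L M := [set al : {ffun 'I_n -> 'I_L.+1} | (weight (fun i => al i) <= M)%N]%SET.

Lemma simplexS L M M' : (M <= M')%N -> simplex L M \subset simplex L M'.
Proof. by move=> le; apply/fintype.subsetP => al; rewrite !inE => /leq_trans; apply. Qed.

Lemma simplex_gt0 L M : (0 < #|simplex L M|)%N.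
Proof.
apply/card_gt0P; exists [ffun=> ord0]; rewrite inE /weight big1 // => i _.
by rewrite ffunE muln0.
Qed.

Lemma simplex_double L M : (#|simplex L (2 * M)| <= 2 ^ n * #|simplex L M|)%N.
Proof.
pose half (al : {ffun 'I_n -> 'I_L.+1}) : {ffun 'I_n -> 'I_L.+1} * {ffun 'I_n -> bool} :=
  ([ffun i => inord ((al i)./2)], [ffun i => odd (al i)]).
have hE (al : {ffun 'I_n -> 'I_L.+1}) i :
      (inord ((al i)./2) : 'I_L.+1) = (al i)./2 :> nat.
  by rewrite inordK // ltnS; have := ltn_ord (al i); lia.
have inj : injective half.
  move=> al be [/ffunP h1 /ffunP h2]; apply/ffunP => i; apply/val_inj => /=.
  have := congr1 val (h1 i); have := h2 i; rewrite !ffunE /= !hE => E1 E2.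
  by rewrite -(odd_double_half (al i)) -(odd_double_half (be i)) E1 E2.
rewrite -(card_imset _ inj).
have -> : (2 ^ n * #|simplex L M|)%N = #|finset.setX (simplex L M) [set: {ffun 'I_n -> bool}]|.
  by rewrite cardsX cardsT card_ffun card_bool card_ord mulnC.
apply/subset_leq_card/fintype.subsetP => _ /imsetP [al + ->]; rewrite !inE andbT.
rewrite /weight => le; have : (2 * \sum_i e i * (al i)./2 <= 2 * M)%N.
  apply: leq_trans le; rewrite big_distrr /=; apply: leq_sum => i _.
  by rewrite mulnCA leq_mul2l; apply/orP; right; lia.
rewrite leq_mul2l /=; apply: leq_trans; apply: leq_sum => i _.
by rewrite ffunE /= hE.
Qed.

(* The number of points of the simplex grows at most polynomially, so that its
   outer layer of fixed width is negligible. *)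
Lemma simplex_growth q t c C0 : (forall N, (c <= N)%N ->
    (t * #|simplex N (N - c)| <= q * #|simplex N N| +
      C0 * #|simplex N N :\: simplex N (N - c)|)%N) ->
  (forall L N, (N <= L)%N -> #|simplex L N| = #|simplex N N|) -> (t <= q)%N.
Proof.
move=> H HL; rewrite leqNgt; apply/negP => qt.
pose a N := #|simplex N N|.
have aS N M : (N <= M)%N -> (a N <= a M)%N.
  by move=> le; rewrite /a -(HL M N le); apply: subset_leq_card; apply: simplexS.
have a2 M : (a (2 * M) <= 2 ^ n * a M)%N.
  rewrite /a -(HL (2 * M)%N M); first exact: simplex_double.
  lia.
pose c' := c.+1; pose C := (q.+1 + C0)%N.
have key N : (c' <= N)%N -> (a N <= C * (a N - a (N - c')))%N.
  move=> cN; have := H N (ltnW cN).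
  rewrite cardsD (finset.setIidPr (simplexS _ (leq_subr _ _))) -/(a N).
  rewrite (HL N) ?leq_subr // -/(a (N - c)%N).
  have h1 : (a (N - c') <= a (N - c))%N by apply: aS; lia.
  have h2 : (a (N - c) <= a N)%N by apply: aS; lia.
  have h3 : (q.+1 * a (N - c) <= t * a (N - c))%N by rewrite leq_mul2r qt orbT.
  move: (a N) (a (N - c')%N) (a (N - c)%N) h1 h2 h3 => x z y h1 h2 h3 h4.
  rewrite /C; nia.
(* By [key] each layer of width c' is at least a fraction 1/C of the simplex. Summing [J] layers
   gives J a(J c') <= C a(2 J c') <= C 2^n a(J c'), impossible for this [J]. *)
pose J := (C * 2 ^ n).+1.
have tel j : ((\sum_(i < j) a ((J + i.+1) * c')) <= C * (a ((J + j) * c') - a (J * c')))%N.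
  elim: j => [|j IH]; first by rewrite big_ord0.
  rewrite big_ord_recr /=.
  have := key ((J + j.+1) * c')%N; rewrite leq_pmull ?addnS // => /(_ isT).
  have -> : ((J + j).+1 * c' - c' = (J + j) * c')%N by rewrite mulSn addKn.
  have h1 : (a (J * c') <= a ((J + j) * c'))%N by apply: aS; rewrite leq_mul2r leq_addr orbT.
  have h2 : (a ((J + j) * c') <= a ((J + j).+1 * c'))%N by apply: aS; rewrite leq_mul2r leqnSn orbT.
  move: IH h1 h2; move: (\sum_(i < j) _)%N (a (J * c')%N) (a ((J + j) * c')%N) (a ((J + j).+1 * c')%N).
  by move=> S x y z; nia.
have lower : (J * a (J * c') <= \sum_(i < J) a ((J + i.+1) * c'))%N.
  rewrite -[X in (X * _)%N]card_ord -sum_nat_const; apply: leq_sum => i _.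
  by apply: aS; rewrite leq_mul2r leq_addr orbT.
have := leq_trans lower (tel J); have := a2 (J * c')%N.
have -> : ((J + J) * c' = 2 * (J * c'))%N by rewrite addnn -mul2n mulnA.
have a0 : (0 < a (J * c'))%N by exact: simplex_gt0.
move: (a (J * c')%N) (a (2 * (J * c'))%N) a0 => x y x0 h1 h2.
have : (J * x <= C * (2 ^ n * x))%N.
  by apply: leq_trans h2 _; rewrite leq_mul2l; apply/orP; right; lia.
by rewrite mulnA leq_pmul2r // /J ltnn.
Qed.

Lemma simplex_width L N : (N <= L)%N -> #|simplex L N| = #|simplex N N|.
Proof.
move=> NL; pose f (al : {ffun 'I_n -> 'I_N.+1}) : {ffun 'I_n -> 'I_L.+1} :=
  [ffun i => inord (al i)].
have fE al i : f al i = al i :> nat.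
  by rewrite ffunE inordK //; have := ltn_ord (al i); lia.
have inj : injective f.
  by move=> al be E; apply/ffunP => i; apply/val_inj; rewrite /= -!fE E.
rewrite -(card_imset (mem (simplex N N)) inj); apply: eq_card => be; apply/idP/imsetP.
  rewrite inE => wb; have bN i : (be i <= N)%N.
    apply: leq_trans wb; rewrite /weight (bigD1 i) //=.
    by apply: leq_trans (leq_addr _ _); rewrite leq_pmull.
  exists [ffun i => inord (be i)].
    rewrite inE; apply: leq_trans wb; apply: leq_sum => i _.
    by rewrite ffunE inordK ?ltnS.
  by apply/ffunP => i; apply/val_inj; rewrite /= fE ffunE inordK ?ltnS.
move=> [al + ->]; rewrite !inE => wa; apply: leq_trans wa; apply: leq_sum => i _.
by rewrite fE.
Qed.

End WeightedSimplices.

(** * Linear spans and interpolation at finitely many points *)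

Section Spans.
Variables (F : fieldType) (W : lmodType F).
Implicit Types (G : set W) (f g : W).

(** The linear span, encoded impredicatively: membership comes with its induction principle and
    carries no index set until [spans_finite]. *)
Definition spans G f := forall P : set W, P 0 -> (forall f g, P f -> P g -> P (f + g)) ->
  (forall a f, P f -> P (a *: f)) -> G `<=` P -> P f.

Lemma spans_gen G f : G f -> spans G f.
Proof. by move=> Gf P _ _ _; apply. Qed.

Lemma spansD G f g : spans G f -> spans G g -> spans G (f + g).
Proof. by move=> h1 h2 P P0 PD PZ PG; apply: (PD); [exact: h1|exact: h2]. Qed.

Lemma spansZ G a f : spans G f -> spans G (a *: f).
Proof. by move=> h P P0 PD PZ PG; apply: (PZ); exact: h. Qed.

Lemma spans_sum G (I : Type) (r : seq I) (Q : pred I) (h : I -> W) :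
  (forall i, Q i -> spans G (h i)) -> spans G (\sum_(i <- r | Q i) h i).
Proof. by move=> H; apply: big_ind; [by move=> P|exact: spansD|exact: H]. Qed.

Lemma spans_finite (T : finType) (psi : T -> W) G f : G `<=` range psi -> spans G f ->
  exists c, f = \sum_t c t *: psi t.
Proof.
move=> Gpsi H; apply: (H [set g | exists c, g = \sum_t c t *: psi t]) =>
  [|_ _ [c ->] [c' ->]|a _ [c ->]|g /Gpsi [t _ <-]].
- by exists (fun=> 0); rewrite big1 // => t _; rewrite scale0r.
- exists (fun t => c t + c' t); rewrite -big_split /=.
  by apply: eq_bigr => t _; rewrite scalerDl.
- by exists (fun t => a * c t); rewrite scaler_sumr; apply: eq_bigr => t _; rewrite scalerA.
- exists (fun s => (s == t)%:R); rewrite (bigD1 t) //= eqxx scale1r big1 ?addr0 // => s /negPf ->.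
  by rewrite scale0r.
Qed.

End Spans.

Section PointConfigurations.
Variables (F : closedFieldType) (n t : nat) (p : 'I_t -> 'rV[F]_n.+1).
Hypothesis p_neq0 : forall i, p i != 0.

Lemma lform_neq0 (u : 'rV[F]_n.+1) : u != 0 -> lform u != 0.
Proof.
move=> /rV0Pn [i ui]; apply/eqP => /(congr1 (meval ((delta_mx 0 i : 'rV_n.+1) 0))).
rewrite lform_eval meval0 (bigD1 i) //= big1 ?addr0 => [|j ji].
  by rewrite mxE !eqxx mulr1 => /eqP; rewrite (negPf ui).
by rewrite mxE (negPf ji) mulr0.
Qed.

(** The pairing is symmetric, so any [a] off the zeros of the product of the [lform (p i)] will
    do. *)
Lemma avoiding_form : exists a : 'rV[F]_n.+1, forall i, (lform a).@[p i 0] != 0.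
Proof.
have /mpoly_neq0_fun [b Hb] : \prod_i lform (p i) != 0.
  by apply/prodf_neq0 => i _; apply: lform_neq0.
exists (\row_j b j) => i; move: Hb; rewrite rmorph_prod => /prodf_neq0 /(_ i isT) /=.
rewrite lform_eval -(@meval_eq _ _ ((\row_j b j : 'rV_n.+1) 0)) => [|j]; last by rewrite mxE.
rewrite lform_eval; congr (_ != _); apply: eq_bigr => j _; exact: mulrC.
Qed.

Hypothesis p_distinct : forall i j c, p i = c *: p j -> i = j.

Lemma interpolation : exists b : 'I_t -> {mpoly F[n.+1]},
  (forall i, b i \is t.-homog) /\ forall i j, (b i).@[p j 0] = (i == j)%:R.
Proof.
(* The case j = i pads the product, so that every interpolant has degree exactly [t]. *)
have sep i j : exists a : 'rV[F]_n.+1, (lform a).@[p i 0] != 0 /\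
    (j != i -> (lform a).@[p j 0] = 0).
  have [->|ji] := eqVneq j i.
    by have [a Ha] := avoiding_form; exists a.
  have /rV0Pn [k0 pk0] := p_neq0 j.
  have [/forallP H|/forallPn [k Hk]] :=
    boolP [forall k, p j 0 k0 * p i 0 k == p j 0 k * p i 0 k0].
    case/eqP: ji; apply/esym/(p_distinct (c := p i 0 k0 / p j 0 k0)).
    apply/rowP => k; rewrite mxE; apply: (mulfI pk0); rewrite (eqP (H k)).
    by rewrite mulrA mulrCA mulfV // mulr1 mulrC.
  have ev (u : 'rV[F]_n.+1) : (lform (p j 0 k0 *: delta_mx 0 k - p j 0 k *: delta_mx 0 k0)).@[u 0] =
      p j 0 k0 * u 0 k - p j 0 k * u 0 k0.
    rewrite lform_eval.
    under eq_bigr do rewrite !mxE !eqxx /= mulrBl.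
    rewrite sumrB (bigD1 k) //= (bigD1 k0 (F := fun i0 => _ * (i0 == k0)%:R * _)) //= !eqxx !mulr1.
    rewrite [X in _ + X - _]big1 ?addr0 => [|l /negPf ->]; last by rewrite mulr0 mul0r.
    by rewrite [X in _ - (_ + X)]big1 ?addr0 // => l /negPf ->; rewrite mulr0 mul0r.
  exists (p j 0 k0 *: delta_mx 0 k - p j 0 k *: delta_mx 0 k0).
  by rewrite !ev subr_eq0; split=> // _; rewrite mulrC subrr.
have /choice [a Ha] (ij : 'I_t * 'I_t) := sep ij.1 ij.2.
pose b0 i : {mpoly F[n.+1]} := \prod_j lform (a (i, j)).
have b0i i : (b0 i).@[p i 0] != 0.
  by rewrite rmorph_prod; apply/prodf_neq0 => j _; case: (Ha (i, j)).
exists (fun i => ((b0 i).@[p i 0])^-1 *: b0 i); split=> [i|i j].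
  apply: rpredZ; have -> : t = (\sum_(j < t) 1)%N by rewrite sum1_card card_ord.
  rewrite /b0; move: (a) => a'.
  elim/big_rec2: _ => [|j x y _ hy]; first exact: dhomog1.
  by apply: dhomogM => //; apply: lform_homog.
rewrite mevalZ; have [<-|ij] := eqVneq i j; first by rewrite mulVf.
rewrite [(b0 i).@[p j 0]]rmorph_prod (bigD1 j) //=.
by have [_ ->] := Ha (i, j); rewrite ?mul0r ?mulr0 // eq_sym.
Qed.

End PointConfigurations.

(** * Jacobians and bordered Jacobians *)

Lemma mderiv_lform (F : closedFieldType) n (a : 'rV[F]_n.+1) c :
  (lform a)^`M(c) = (a 0 c)%:MP.
Proof.
rewrite /lform raddf_sum /= (bigD1 c) //= big1 ?addr0 => [|i ic].
  rewrite mderivZ mderivX mnm1E eqxx scale1r.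
  have -> : (U_(c) - U_(c) = 0 :> 'X_{1..n.+1})%MM by apply/mnmP => j; rewrite mnmBE mnm0E subnn.
  by rewrite mpolyX0 -mul_mpolyC mulr1.
by rewrite mderivZ mderivX mnm1E (negPf ic) scale0r scaler0.
Qed.

Lemma dhomog_mderiv (F : idomainType) k (f : {mpoly F[k]}) e c :
  f \is e.-homog -> f^`M(c) \is e.-1.-homog.
Proof.
move=> /dhomogP hf; apply/dhomogP => m; rewrite mcoeff_msupp mcoeff_mderiv => mf.
have : (m + U_(c))%MM \in msupp f.
  by rewrite mcoeff_msupp; apply: contra_neq mf => ->; rewrite mul0rn.
by move/hf => /= <-; rewrite mdegD mdeg1 addn1.
Qed.

Lemma dhomog_det (F : comNzRingType) k N (A : 'M[{mpoly F[k]}]_N) (e : 'I_N -> nat) :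
  (forall i j, A i j \is (e i).-homog) -> \det A \is (\sum_i e i).-homog.
Proof.
move=> hA.
suff H (f : 'I_N -> 'I_N) : \prod_i A i (f i) \is (\sum_i e i).-homog.
  by apply: rpred_sum => s _; rewrite -signr_odd mulr_sign; case: (odd _); rewrite ?rpredN H.
elim/big_rec2: _ => [|i x y _ hy]; first exact: dhomog1.
exact: dhomogM.
Qed.

Lemma dif_lform (F : closedFieldType) n (a u v : 'rV[F]_n.+1) : dif (lform a) (u 0) (v 0) = (lform a).@[v 0].
Proof.
rewrite lform_eval /lform; elim: (index_enum _) => [|i s IH].
  by rewrite !big_nil -mpolyC0 difC.
by rewrite !big_cons difD IH -mul_mpolyC difM difC dif_var mevalC mulr0 addr0.
Qed.

Lemma onto_row_full (F : fieldType) a b (A : 'M[F]_(a, b)) :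
  (forall y : 'rV_b, exists w, w *m A = y) -> row_full A.
Proof.
move=> onto; apply/row_fullP.
have /choice [w Hw] (i : 'I_b) : exists w, w *m A = row i 1%:M by apply: onto.
exists (\matrix_i w i); apply/row_matrixP => i.
by rewrite row_mul rowK Hw.
Qed.

Lemma kernel_line (F : fieldType) N (A : 'M[F]_(N.+1, N)) (p q : 'rV_N.+1) :
  row_full A -> p != 0 -> p *m A = 0 -> q *m A = 0 -> exists c, q = c *: p.
Proof.
move=> /eqP fullA p0 /sub_kermxP pA /sub_kermxP qA; apply/sub_rVP.
have rp : \rank p = 1%N by rewrite rank_rV p0.
apply: submx_trans qA _; have := mxrank_leqif_sup pA.
by rewrite mxrank_ker fullA subSnn rp => -[_ <-].
Qed.

Lemma line_kernel_full (F : fieldType) N (A : 'M[F]_(N.+1, N)) (p : 'rV_N.+1) :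
  (forall q, q *m A = 0 -> exists c, q = c *: p) -> row_full A.
Proof.
move=> kerA; rewrite /row_full eqn_leq rank_leq_col /=.
have : (kermx A <= p)%MS.
  by apply/row_subP => i; apply/sub_rVP; apply: kerA; rewrite -row_mul mulmx_ker row0.
move/mxrankS/leq_trans/(_ (rank_leq_row p)).
by rewrite mxrank_ker; move: (rank_leq_row A); lia.
Qed.

Section Jacobians.
Variables (F : closedFieldType) (n : nat).
Local Notation B := {mpoly F[n.+1]}.
Local Notation V := 'rV[F]_n.+1.
Implicit Types u v w : V.

Section Submersions.
Variables (r : nat) (h : 'I_r -> B).

Definition jacobian u : 'M[F]_(n.+1, r) := \matrix_(c, i) (h i)^`M(c).@[u 0].

Lemma jacobianE u w i : (w *m jacobian u) 0 i = dif (h i) (u 0) (w 0).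
Proof. by rewrite mxE; apply: eq_bigr => c _; rewrite mxE mulrC. Qed.

Definition submersive u := forall b : 'I_r -> F,
  exists w, forall i, dif (h i) (u 0) (w 0) = b i.

Lemma submersiveP u : submersive u <-> row_full (jacobian u).
Proof.
split=> [su|/row_fullP [M HM] b].
  apply: onto_row_full => y; have [w Hw] := su (y 0).
  by exists w; apply/rowP => i; rewrite jacobianE.
by exists ((\row_i b i) *m M) => i; rewrite -jacobianE -mulmxA HM mulmx1 mxE.
Qed.

End Submersions.

Section Frames.
Variables (h : 'I_n -> B) (a : V).

(** The Jacobian of n forms in n + 1 variables, bordered by the row [a] to become square. At a
    common zero [u] it detects whether a nonzero tangent vector lies in the hyperplane a = 0. *)
Definition frame : 'M[B]_n.+1 := \matrix_(i, c)
  if unlift ord_max i is Some i' then (h i')^`M(c) else (a 0 c)%:MP.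

Lemma frame_eval u v i : (v *m (map_mx (meval (u 0)) frame)^T) 0 i =
  if unlift ord_max i is Some i' then dif (h i') (u 0) (v 0) else (lform a).@[v 0].
Proof.
rewrite mxE; case E : (unlift ord_max i) => [i'|].
  by apply: eq_bigr => c _; rewrite !mxE E mulrC.
by rewrite lform_eval; apply: eq_bigr => c _; rewrite !mxE E /= mevalC mulrC.
Qed.

Lemma frame_det_homog (e : 'I_n -> nat) : (forall i, h i \is (e i).-homog) ->
  homogeneous (\det frame).
Proof.
move=> hh; pose e' i := if unlift ord_max i is Some i' then (e i').-1 else 0%N.
exists (\sum_i e' i)%N; apply: dhomog_det => i c; rewrite mxE /e'.
case: unlift => [i'|]; first exact: dhomog_mderiv (hh i').
by rewrite -[_%:MP]mulr1 mul_mpolyC; apply: rpredZ; apply: dhomog1.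
Qed.

Lemma frame_singular u : (\det frame).@[u 0] = 0 -> exists2 v : V, v != 0 &
  (forall i, dif (h i) (u 0) (v 0) = 0) /\ (lform a).@[v 0] = 0.
Proof.
rewrite -det_map_mx -det_tr => /eqP/det0P [v v0 Mv]; exists v => //.
split=> [i|]; [have /rowP/(_ (lift ord_max i)) := Mv | have /rowP/(_ ord_max) := Mv].
  by rewrite frame_eval liftK mxE.
by rewrite frame_eval unlift_none mxE.
Qed.

Lemma frame_regular u v : (\det frame).@[u 0] != 0 ->
  (forall i, dif (h i) (u 0) (v 0) = 0) -> (lform a).@[v 0] = 0 -> v = 0.
Proof.
rewrite -det_map_mx -det_tr => dJ Hv av; apply: contrapT => /eqP v0.
move/negP: dJ; apply; apply/det0P; exists v => //; apply/rowP => i.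
by rewrite frame_eval mxE; case: unlift.
Qed.

Lemma frame_submersive u : (\det frame).@[u 0] != 0 -> submersive h u.
Proof.
rewrite -det_map_mx -det_tr -unitfE -unitmxE => Ju b.
pose y : V := \row_i (if unlift ord_max i is Some i' then b i' else 0).
exists (y *m invmx (map_mx (meval (u 0)) frame)^T) => i.
by have /rowP/(_ (lift ord_max i)) := mulmxKV Ju y; rewrite frame_eval mxE liftK.
Qed.

End Frames.
End Jacobians.

(** * Forms modulo a transversal system *)

Section Transversal.
Variables (F : closedFieldType) (n : nat).
Hypothesis Func : uncountable_field F.
Local Notation B := {mpoly F[n.+1]}.
Local Notation V := 'rV[F]_n.+1.
Implicit Types (u v : V).

Definition common_zero (h : 'I_n -> B) u := forall i, (h i).@[u 0] = 0.

Definition transversal (h : 'I_n -> B) := forall u, u != 0 -> common_zero h u ->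
  forall v, (forall i, dif (h i) (u 0) (v 0) = 0) -> exists c, v = c *: u.

Lemma transversal_submersive h u : transversal h -> u != 0 -> common_zero h u -> submersive h u.
Proof.
move=> tr u0 hu; apply/submersiveP; apply: (line_kernel_full (p := u)) => q Jq.
by apply: tr hu _ _ => // i; rewrite -jacobianE Jq mxE.
Qed.

Section Independence.
Variables (h : 'I_n -> B) (e : 'I_n -> nat) (t : nat) (p : 'I_t -> V).
Variables (b : 'I_t -> B) (l0 : B) (N M : nat).
Hypotheses (tr : transversal h) (p0 : forall i, p i != 0).
Hypothesis ph : forall i, common_zero h (p i).
Hypothesis bp : forall i j, (b i).@[p j 0] = (i == j)%:R.
Hypothesis lp : forall i, l0.@[p i 0] != 0.

Local Notation T := ('I_t * {al : {ffun 'I_n -> 'I_N.+1} | al \in simplex e N M})%type.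
Variable ex : T -> nat.
Let psi (s : T) : B := b s.1 * l0 ^+ ex s * \prod_i h i ^+ (val s.2 i).

(** Take a nonzero term of least total exponent, at the point [u]. On lines through [u] along which
    the [h i] have prescribed derivatives a_i, the lowest coefficient of the relation is a
    polynomial in a that vanishes identically; its coefficients are the [c s] at that point times
    powers of l0(u), because [b] separates the points. *)
Lemma transversal_independent (c : T -> F) :
  \sum_s c s *: psi s = 0 -> forall s, c s = 0.
Proof.
move=> sum0 s; apply/eqP/negPn/negP => cs.
pose deg (s : T) := (\sum_i val s.2 i)%N.
have [s0 cs0 smin] := arg_minnP (P := fun s => c s != 0) deg cs.
pose j := deg s0; pose u := p s0.1.
pose H : {mpoly F[n]} := \sum_s (c s * (s.1 == s0.1)%:R * (deg s == j)%:R * l0.@[u 0] ^+ ex s)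
  *: 'X_[[multinom (val s.2 i : nat) | i < n]].
have H0 : H = 0.
  apply: mpoly_eq0_fun => a.
  have [w Hw] := transversal_submersive tr (p0 s0.1) (ph s0.1) a.
  pose gam i := (u 0 i)%:P + (w 0 i)%:P * 'X^1.
  have gam0 i : (gam i).[0] = u 0 i.
    by rewrite /gam hornerD hornerM hornerXn !hornerC expr0n mulr0 addr0.
  have /choice [r Hr] i : exists r, along gam (h i) = 'X * ((a i)%:P + r * 'X).
    have [r E] := along_line (u 0) (w 0) (h i); exists r.
    by rewrite E (ph s0.1) Hw polyC0; ring.
  pose S (s : T) : {poly F} := if c s == 0 then 0 else
    c s *: (along gam (b s.1 * l0 ^+ ex s) * (\prod_i ((a i)%:P + r i * 'X) ^+ (val s.2 i)) *
      'X^(deg s - j)).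
  have SE s1 : along gam (c s1 *: psi s1) = S s1 * 'X^j.
    rewrite /S; have [->|cs1] := eqVneq (c s1) 0; first by rewrite scale0r /along mmap0 mul0r.
    rewrite -mul_mpolyC alongM alongC mul_polyC /psi alongM along_prod -scalerAl; congr (_ *: _).
    rewrite -!mulrA; congr (_ * _); rewrite -exprD subnK; last exact: smin.
    rewrite /deg -prodrXr -big_split /=; apply: eq_bigr => i _.
    by rewrite alongX Hr exprMn mulrC.
  have : \sum_s S s = 0.
    apply: (mulIf (monic_neq0 (monicXn F j))); rewrite mul0r mulr_suml.
    have E' : \sum_s along gam (c s *: psi s) = 0 by rewrite -along_sum sum0 /along mmap0.
    rewrite -[RHS]E'.
    by apply: eq_bigr => s1 _; rewrite SE.
  move/(congr1 (horner^~ 0)); rewrite horner_sum horner0 => E; rewrite -[RHS]E.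
  rewrite rmorph_sum /=; apply: eq_bigr => s1 _.
  rewrite mevalZ mevalX /S; have [->|cs1] := eqVneq (c s1) 0; first by rewrite !mul0r horner0.
  rewrite hornerZ !hornerM hornerXn expr0n subn_eq0 horner_along.
  rewrite (meval_eq _ (v2 := u 0)) // mevalM rmorphXn /= bp.
  have -> : (deg s1 <= j)%N = (deg s1 == j) by rewrite eqn_leq smin ?andbT.
  rewrite horner_prod; under [in RHS]eq_bigr do
    rewrite horner_exp hornerD hornerM hornerX hornerC mulr0 addr0.
  under [in LHS]eq_bigr do rewrite mnmE.
  ring.
have := congr1 (mcoeff [multinom (val s0.2 i : nat) | i < n]) H0.
rewrite mcoeff0 raddf_sum /= (bigD1 s0) //= big1 ?addr0 => [|s1 s10].
  rewrite mcoeffZ mcoeffX !eqxx !mulr1 => /eqP; rewrite mulf_eq0 (negPf cs0) /=.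
  by rewrite expf_eq0 (negPf (lp _)) andbF.
rewrite mcoeffZ mcoeffX; have [E1|] := eqVneq s1.1 s0.1; last by rewrite !(mulr0, mul0r).
case: (deg s1 == j); last by rewrite !(mulr0, mul0r).
case: eqP => [E2|]; last by rewrite mulr0.
case/eqP: s10; case: s1 s0 E1 E2 {cs0 smin j u H H0} => [i1 a1] [i2 a2] /= -> E2.
congr (_, _); apply/val_inj/ffunP => i; apply/val_inj.
by have := congr1 (fun m : 'X_{1..n} => m i) E2; rewrite !mnmE.
Qed.

End Independence.

Lemma vanish_on_line (q : V) (k0 : 'I_n.+1) (f : B) : q 0 k0 = 1 ->
  (forall c, f.@[(c *: q) 0] = 0) ->
  exists A : 'I_n.+1 -> B, f = \sum_k A k * ('X_k - q 0 k *: 'X_k0).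
Proof.
move=> qk0 fq.
pose I := [set g : B | exists A : 'I_n.+1 -> B, g = \sum_k A k * ('X_k - q 0 k *: 'X_k0)].
have idI : is_ideal I.
  split; first by exists (fun=> 0); rewrite big1 // => i _; rewrite mul0r.
    move=> g1 g2 [w1 ->] [w2 ->]; exists (fun i => w1 i + w2 i).
    by rewrite -big_split /=; apply: eq_bigr => i _; rewrite mulrDl.
  move=> g1 g2 [w1 ->]; exists (fun i => g1 * w1 i).
  by rewrite mulr_sumr; apply: eq_bigr => i _; rewrite mulrA.
have [i|A E] := @mmap_cong _ I idI F n.+1 (@mpolyC n.+1 F) (fun i => 'X_i)
  (fun i => q 0 i *: 'X_k0) f.
  exists (fun k => (k == i)%:R); rewrite (bigD1 i) //= eqxx mul1r big1 ?addr0 // => j /negPf ->.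
  by rewrite mul0r.
exists A; rewrite -E; have -> : mmap (@mpolyC n.+1 F) (fun i => q 0 i *: 'X_k0) f = 0.
  apply: mpoly_eq0_fun => a; pose v : V := \row_i a i.
  rewrite -(@meval_eq _ _ (v 0)) => [|i]; last by rewrite mxE.
  rewrite meval_mmap -[RHS](fq (v 0 k0)); apply: meval_eq => i.
  by rewrite mevalZ mevalXU [RHS]mxE mulrC.
rewrite subr0 [LHS]mpolyE; apply: eq_bigr => m _.
by rewrite mul_mpolyC /mmap1 -mpolyXE_id.
Qed.

Section Spanning.
Variables (h : 'I_n -> B) (e : 'I_n -> nat).
Hypotheses (tr : transversal h) (e0 : forall i, (0 < e i)%N).
Hypothesis hh : forall i, h i \is (e i).-homog.

Lemma common_zeroZ u c : common_zero h u -> common_zero h (c *: u).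
Proof. by move=> hu i; rewrite (dhomog_meval _ _ (hh i)) hu mulr0. Qed.

(** The [z k] generate the ideal of the line of [u], and h = A z. With the extra row z_k0 = 0 the
    matrix is square, and Cramer's rule puts det M times each z_k into (h). A kernel vector of M at
    [u] is tangent, so a multiple of [u], with k0-th coordinate 0; hence det M is nonzero there. *)
Lemma local_generation u : u != 0 -> common_zero h u ->
  exists2 D : B, D.@[u 0] != 0 &
    forall f : B, (forall c, f.@[(c *: u) 0] = 0) -> in_span_of h (D * f).
Proof.
move=> u0 hu; have /rV0Pn [k0 uk0] := u0.
pose q := (u 0 k0)^-1 *: u.
have qk0 : q 0 k0 = 1 by rewrite mxE mulVf.
have uq : u = u 0 k0 *: q by rewrite scalerA mulfV // scale1r.
pose z k : B := 'X_k - q 0 k *: 'X_k0.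
have zk0 : z k0 = 0 by rewrite /z qk0 scale1r subrr.
have zu k : (z k).@[u 0] = 0.
  by rewrite mevalB mevalZ !mevalXU mxE mulrAC mulVf // mul1r subrr.
have /choice [A HA] i : exists A : 'I_n.+1 -> B, h i = \sum_k A k * z k.
  apply: vanish_on_line => // c; apply: common_zeroZ; rewrite /q.
  exact: common_zeroZ.
pose M : 'M[B]_n.+1 := \matrix_(i, k)
  if unlift ord_max i is Some i' then A i' k else (k == k0)%:R.
pose zc : 'cV[B]_n.+1 := \col_k z k.
have Mz i : (M *m zc) (lift ord_max i) 0 = h i.
  by rewrite mxE HA; apply: eq_bigr => k _; rewrite !mxE liftK.
have Mzm : (M *m zc) ord_max 0 = 0.
  rewrite mxE (bigD1 k0) //= !mxE zk0 mulr0 add0r big1 // => k /negPf kk.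
  by rewrite !mxE unlift_none kk mul0r.
exists (\det M).
  rewrite -det_map_mx -det_tr; apply/det0P => -[x x0 xM].
  have Mx i : \sum_k (M i k).@[u 0] * x 0 k = 0.
    have /rowP/(_ i) := xM; rewrite !mxE => E; rewrite -[RHS]E.
    by apply: eq_bigr => k _; rewrite !mxE mulrC.
  have xk0 : x 0 k0 = 0.
    rewrite -[RHS](Mx ord_max) (bigD1 k0) //= mxE unlift_none eqxx meval1 mul1r.
    by rewrite big1 ?addr0 // => k /negPf kk; rewrite mxE unlift_none kk meval0 mul0r.
  have [|c xc] := tr u0 hu (v := x).
    move=> i; rewrite -[RHS](Mx (lift ord_max i)) HA.
    have difs (s : seq 'I_n.+1) : dif (\sum_(k <- s) A i k * z k) (u 0) (x 0) =
        \sum_(k <- s) (A i k).@[u 0] * x 0 k.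
      elim: s => [|k s IH]; first by rewrite !big_nil -mpolyC0 difC.
      rewrite !big_cons difD IH difM zu mul0r addr0 /z difD dif_var.
      by rewrite -scaleNr -mul_mpolyC difM difC dif_var mulr0 addr0 xk0 mulr0 addr0.
    by rewrite difs; apply: eq_bigr => k _; rewrite mxE liftK.
  have c0 : c = 0.
    by move: xk0; rewrite xc mxE => /eqP; rewrite mulf_eq0 (negPf uk0) orbF => /eqP.
  by move: x0; rewrite xc c0 scale0r eqxx.
move=> f fu; have [|Bf ->] := @vanish_on_line q k0 f qk0.
  by move=> c; rewrite scalerA; apply: fu.
rewrite mulr_sumr; apply: (ideal_sum (in_span_ideal h)) => k _.
rewrite mulrCA; apply: (idealMl (in_span_ideal h)).
have /matrixP/(_ k 0) : (\det M)%:M *m zc = \adj M *m (M *m zc) by rewrite mulmxA mul_adj_mx.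
rewrite -/(z k) mul_scalar_mx !mxE => ->; rewrite (bigD1 ord_max) //= Mzm mulr0 add0r.
apply: (ideal_sum (in_span_ideal h)) => i im; apply: (idealMl (in_span_ideal h)).
have [i' ->|E] := unliftP ord_max i; first by rewrite Mz; apply: in_span_gen.
by rewrite E eqxx in im.
Qed.

(** The multipliers carrying every such [f] into (h) form an ideal. It contains (h) and, for each
    nonzero common zero, the [D] of [local_generation], so its only zero is the origin. *)
Lemma colon_high_degree : exists N, forall g : B, forall m, (N <= m)%N -> g \is m.-homog ->
  forall f : B, (forall u, common_zero h u -> f.@[u 0] = 0) -> in_span_of h (g * f).
Proof.
pose I : set B := [set g | forall f : B, (forall u, common_zero h u -> f.@[u 0] = 0) ->
  in_span_of h (g * f)].
have idI : is_ideal I.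
  split; first by move=> f _; rewrite mul0r; apply: (ideal0 (in_span_ideal h)).
    move=> g1 g2 H1 H2 f Hf; rewrite mulrDl.
    by apply: (idealD (in_span_ideal h)); [apply: H1|apply: H2].
  by move=> g1 g2 H2 f Hf; rewrite -mulrA; apply: (idealMl (in_span_ideal h)); apply: H2.
have [u Hu|N HN] := ideal_high_degree Func idI.
  apply: contrapT => /eqP u0.
  have hu : common_zero h u.
    by move=> i; apply: Hu => f _; apply: (idealMr (in_span_ideal h)); apply: in_span_gen.
  have [D Du HD] := local_generation u0 hu.
  move/eqP: Du; apply; apply: Hu => f Hf; apply: HD => c; apply: Hf.
  exact: common_zeroZ.
exists N => g m Nm /dhomogP hg; rewrite (mpolyE g) big_seq.
apply: (ideal_sum idI) => mu /hg /= mdE; rewrite -mul_mpolyC; apply: (idealMl idI).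
by apply: HN; rewrite mdE.
Qed.

Variables (q : nat) (p : 'I_q -> V) (b : 'I_q -> B) (l0 : B) (N1 : nat).
Hypothesis p0 : forall i, p i != 0.
Hypothesis pall : forall u, u != 0 -> common_zero h u -> exists i c, u = c *: p i.
Hypothesis bh : forall i, b i \is N1.-homog.
Hypothesis bp : forall i j, (b i).@[p j 0] = (i == j)%:R.
Hypothesis lh : l0 \is 1.-homog.
Hypothesis lp : forall i, l0.@[p i 0] != 0.

Lemma interpolation_remainder M (f : B) : f \is M.+1.-homog -> (N1 <= M.+1)%N ->
  exists ka : 'I_q -> F, forall u, common_zero h u ->
    (f - \sum_i ka i *: (b i * l0 ^+ (M.+1 - N1))).@[u 0] = 0.
Proof.
move=> hf le; exists (fun i => f.@[p i 0] / l0.@[p i 0] ^+ (M.+1 - N1)) => u hu.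
set g := f - _; have hg : g \is M.+1.-homog.
  apply: rpredB => //; apply: rpred_sum => i _; apply: rpredZ.
  have := dhomogM (bh i) (dhomogMn (M.+1 - N1) lh).
  by rewrite mul1n subnKC.
have gp i : g.@[p i 0] = 0.
  rewrite mevalB rmorph_sum /= (bigD1 i) //= big1 ?addr0 => [|j /negPf ji].
    by rewrite mevalZ mevalM bp eqxx mul1r rmorphXn /= divfK ?subrr // expf_neq0.
  by rewrite mevalZ mevalM bp ji mul0r mulr0.
have [->|u0] := eqVneq u 0; first exact: dhomog_meval0 hg _.
by have [i [c ->]] := pall u0 hu; rewrite (dhomog_meval _ _ hg) gp mulr0.
Qed.

Lemma mnm_split (m : 'X_{1..n.+1}) N : (N <= mdeg m)%N ->
  exists2 m1 : 'X_{1..n.+1}, mdeg m1 = N & exists m2, m = (m1 + m2)%MM.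
Proof.
elim: N => [_|N IH lt].
  by exists 0%MM; [exact: mdeg0|exists m; rewrite add0m].
have [m1 m1N [m2 E]] := IH (ltnW lt).
have [i m2i] : exists i, m2 i != 0%N.
  apply: contrapT => /forallNP H; have m20 : m2 = 0%MM.
    by apply/mnmP => i; rewrite mnm0E; apply/eqP/negPn/negP; exact: H.
  by move: lt; rewrite E m20 addm0 m1N ltnn.
exists (m1 + U_(i))%MM; first by rewrite mdegD mdeg1 m1N addn1.
exists (m2 - U_(i))%MM; rewrite E -addmA [(U_(i) + _)%MM]addmC submK //.
by rewrite lep1mP.
Qed.

(** An interpolation remainder is known to lie in (h) only after multiplication by a form of degree
    at least [N]. So a monomial is split as m1 m2: m2 is interpolated with m1 as multiplier, then m1
    b_i with the leftover power of [l0] as multiplier. *)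
Lemma spanning_high_degree : exists N0, forall f m, (N0 <= m)%N -> f \is m.-homog ->
  (N1 <= m)%N /\ exists ka : 'I_q -> F,
    in_span_of h (f - \sum_i ka i *: (b i * l0 ^+ (m - N1))).
Proof.
have idh := in_span_ideal h.
have [N HN] := colon_high_degree.
have lX s : l0 ^+ s \is s.-homog by have := dhomogMn s lh; rewrite mul1n.
(* Room for the degree of m1, the degree of the interpolants, and the leftover power of [l0]. *)
exists (N.+1 + N1 + N.+1)%N => f m Nm hf.
have N1m : (N1 <= m)%N by lia.
split=> //.
pose X := [set f : B | exists ka : 'I_q -> F,
  in_span_of h (f - \sum_i ka i *: (b i * l0 ^+ (m - N1)))].
have XD f1 f2 : X f1 -> X f2 -> X (f1 + f2).
  move=> [k1 h1] [k2 h2]; exists (fun i => k1 i + k2 i).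
  under eq_bigr do rewrite scalerDl.
  by rewrite big_split /= opprD addrACA; apply: (idealD idh).
have XZ a f1 : X f1 -> X (a *: f1).
  move=> [k1 h1]; exists (fun i => a * k1 i).
  under eq_bigr do rewrite -scalerA.
  by rewrite -scaler_sumr -scalerBr -mul_mpolyC; apply: (idealMl idh).
have X0 : X 0.
  by exists (fun=> 0); rewrite big1 ?subr0 => [|i _]; [exact: (ideal0 idh)|rewrite scale0r].
have Xsum (T : Type) (s : seq T) (Q : pred T) (g : T -> B) :
    (forall i, Q i -> X (g i)) -> X (\sum_(i <- s | Q i) g i).
  by move=> H; apply: big_ind.
have Xcong f1 f2 : in_span_of h (f1 - f2) -> X f2 -> X f1.
  move=> h1 [k1 h2]; exists k1.
  by rewrite -[f1](subrK f2) -addrA; apply: (idealD idh).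
rewrite -/(X f) (mpolyE f) big_seq; apply: (Xsum) => mu mf; apply: (XZ).
have md : mdeg mu = m by have /dhomogP/(_ mu mf) := hf.
have Nmu : (N.+1 <= mdeg mu)%N by rewrite md; lia.
have [m1 m1N [m2 E]] := mnm_split Nmu.
rewrite E mpolyXD.
have m2M : mdeg m2 = (m - N.+1).-1.+1 by move: md; rewrite E mdegD m1N; lia.
have hm2 : ('X_[m2] : B) \is (m - N.+1).-1.+1.-homog by rewrite dhomogX /= m2M.
have [|ka Hka] := interpolation_remainder hm2; first by lia.
have hm1 : ('X_[m1] : B) \is N.+1.-homog by rewrite dhomogX /= m1N.
apply: (@Xcong _ ('X_[m1] * \sum_i ka i *: (b i * l0 ^+ (mdeg m2 - N1)))).
  by rewrite -mulrBr; apply: (HN _ _ (leqnSn N) hm1) => u /Hka; rewrite m2M.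
rewrite mulr_sumr; apply: (Xsum) => i _; rewrite -scalerAr; apply: (XZ).
have hmb : 'X_[m1] * b i \is (N + N1).+1.-homog by apply: (dhomogM hm1 (bh i)).
have [|kb Hkb] := interpolation_remainder hmb; first by lia.
rewrite mulrA.
apply: (@Xcong _ ((\sum_j kb j *: (b j * l0 ^+ (N.+1 + N1 - N1))) * l0 ^+ (mdeg m2 - N1))).
  rewrite -mulrBl mulrC; apply: (HN _ (mdeg m2 - N1)%N); [lia|exact: lX|].
  exact: Hkb.
rewrite mulr_suml; apply: (Xsum) => j _; rewrite -scalerAl; apply: (XZ).
rewrite -mulrA -exprD; have -> : (N.+1 + N1 - N1 + (mdeg m2 - N1) = m - N1)%N by lia.
exists (fun l => (l == j)%:R); rewrite (bigD1 j) //= eqxx scale1r big1 ?addr0.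
  by rewrite subrr; apply: (ideal0 idh).
by move=> l /negPf ->; rewrite scale0r.
Qed.

End Spanning.
End Transversal.

(** * Comparing the numbers of zeros of two systems *)

Section TransversalCount.
Variables (F : closedFieldType) (n : nat).
Hypothesis Func : uncountable_field F.
Local Notation B := {mpoly F[n.+1]}.
Local Notation V := 'rV[F]_n.+1.

Lemma spans_mul (G G' : set B) (f z : B) : spans G f -> (forall g, G g -> spans G' (g * z)) ->
  spans G' (f * z).
Proof.
move=> Gf H; apply: (Gf [set f | spans G' (f * z)]) => [|f1 f2 h1 h2|a f1 h1|g Gg] /=.
- by rewrite mul0r => P.
- by rewrite mulrDl; apply: spansD.
- by rewrite -scalerAl; apply: spansZ.
- exact: H.
Qed.

Definition monomial_in (h : 'I_n -> B) (al : 'I_n -> nat) : B := \prod_i h i ^+ al i.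

Lemma monomial_in_homog (h : 'I_n -> B) e al : (forall i, h i \is (e i).-homog) ->
  monomial_in h al \is (weight e al).-homog.
Proof.
move=> hh; rewrite /monomial_in /weight; elim/big_rec2: _ => [|i x y _ hy]; first exact: dhomog1.
by apply: dhomogM => //; apply: dhomogMn.
Qed.

Lemma monomial_in_mul h al i : monomial_in h al * h i =
  monomial_in h (fun j => al j + (j == i))%N.
Proof.
rewrite /monomial_in (bigD1 i) //= [RHS](bigD1 i) //= eqxx addn1 exprSr mulrAC; congr (_ * _).
by apply: eq_bigr => j /negPf ->; rewrite addn0.
Qed.

Lemma weight_add (e al : 'I_n -> nat) i :
  weight e (fun j => al j + (j == i))%N = (weight e al + e i)%N.
Proof.
rewrite /weight (bigD1 i) //= [in RHS](bigD1 i) //= eqxx addn1 mulnSr addnAC; congr (_ + _ + _)%N.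
by apply: eq_bigr => j /negPf ->; rewrite addn0.
Qed.

Section GradedGenerators.
Variables (h : 'I_n -> B) (e : 'I_n -> nat) (q : nat) (b : 'I_q -> B) (l0 : B) (N1 c : nat).
Hypotheses (hh : forall i, h i \is (e i).-homog) (e0 : forall i, (0 < e i)%N).
Hypothesis bh : forall i, b i \is N1.-homog.
Hypothesis lh : l0 \is 1.-homog.
Hypothesis high : forall f m, (c <= m)%N -> f \is m.-homog ->
  (N1 <= m)%N /\ exists ka : 'I_q -> F,
    in_span_of h (f - \sum_i ka i *: (b i * l0 ^+ (m - N1))).

Definition graded_generators m : set B :=
  [set g | (exists i al s, (N1 + s + weight e al = m)%N /\
             g = b i * l0 ^+ s * monomial_in h al) \/
           (exists w al, [/\ (mdeg w < c)%N, (mdeg w + weight e al = m)%N &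
             g = 'X_[w] * monomial_in h al])].

Lemma weight0 : weight e (fun=> 0%N) = 0%N.
Proof. by rewrite /weight big1 // => i _; rewrite muln0. Qed.

Lemma monomial_in0 : monomial_in h (fun=> 0%N) = 1.
Proof. by rewrite /monomial_in big1. Qed.

(** Each reduction modulo (h) lowers the degree by some e_i and stores a factor h_i in
    [monomial_in h al]; below degree [c] plain monomials are left. *)
Lemma graded_generators_span m f : f \is m.-homog -> spans (graded_generators m) f.
Proof.
elim/ltn_ind: m f => m IH f hf; have [mc|cm] := ltnP m c.
  rewrite (mpolyE f) big_seq; apply: spans_sum => w wf; apply: spansZ; apply: spans_gen.
  have wm : mdeg w = m by have /dhomogP/(_ w wf) := hf.
  right; exists w, (fun=> 0%N); split; first by rewrite wm.
    by rewrite weight0 addn0.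
  by rewrite monomial_in0 mulr1.
have [N1m [ka [w Hw]]] := high cm hf.
pose g := \sum_i ka i *: (b i * l0 ^+ (m - N1)).
have hg : g \is m.-homog.
  apply: rpred_sum => i _; apply: rpredZ.
  by have := dhomogM (bh i) (dhomogMn (m - N1) lh); rewrite mul1n subnKC.
have -> : f = g + \sum_i (if (e i <= m)%N then pihomog mdeg (m - e i) (w i) * h i else 0).
  rewrite -[LHS](subrK g) addrC; congr (_ + _).
  have hfg : f - g \is m.-homog by apply: rpredB.
  rewrite -[LHS](pihomog_dE hfg) /g Hw (raddf_sum (pihomog mdeg m)) /=.
  by apply: eq_bigr => i _; rewrite mulrC (pihomogM _ _ (hh i)).
apply: spansD.
  apply: spans_sum => i _; apply: spansZ; apply: spans_gen.
  left; exists i, (fun=> 0%N), (m - N1)%N.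
  by rewrite weight0 addn0 subnKC // monomial_in0 mulr1.
apply: spans_sum => i _; case: ifP => [eim|_]; last by move=> P.
apply: (@spans_mul (graded_generators (m - e i))).
  by apply: IH; [have := e0 i; lia|exact: pihomogP].
move=> g0 [[j [al [s [E ->]]]]|[x [al [xc E ->]]]]; apply: spans_gen.
  left; exists j, (fun l => al l + (l == i))%N, s.
  by rewrite -mulrA monomial_in_mul weight_add; split=> //; lia.
right; exists x, (fun l => al l + (l == i))%N.
by rewrite -mulrA monomial_in_mul weight_add; split=> //; lia.
Qed.

End GradedGenerators.

(* The zeros of [h] give t |S(N-c)| independent forms b_i l0^s h^al of degree
   N, and those of [h'] show that q |S(N)| + O(|S(N) - S(N-c)|) forms
   span, where S(N) counts the exponents al of weight at most N. *)
Theorem transversal_count_le (h h' : 'I_n -> B) (e : 'I_n -> nat) t q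
    (p : 'I_t -> V) (p' : 'I_q -> V) :
  (forall i, (0 < e i)%N) ->
  (forall i, h i \is (e i).-homog) -> (forall i, h' i \is (e i).-homog) ->
  transversal h -> transversal h' ->
  (forall i, p i != 0) -> (forall i, p' i != 0) ->
  (forall i j c, p i = c *: p j -> i = j) -> (forall i j c, p' i = c *: p' j -> i = j) ->
  (forall i, common_zero h (p i)) ->
  (forall u, u != 0 -> common_zero h' u -> exists i c, u = c *: p' i) ->
  (t <= q)%N.
Proof.
move=> e0 hh hh' tr tr' p0 p'0 pd pd' ph pall.
have [b [bh bp]] := interpolation p0 pd; have [b' [bh' bp']] := interpolation p'0 pd'.
have [a Ha] := avoiding_form p0; have [a' Ha'] := avoiding_form p'0.
pose l0 := lform a; pose l0' := lform a'.
have [N0 HN0] := spanning_high_degree Func tr' hh' pall bh' bp' (lform_homog a') Ha'.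
(* Adding [t] makes the exponent of [l0] in [psi1] a true difference for weights at most N - c. *)
pose c := (N0 + t)%N.
apply: (@simplex_growth _ e q t c #|{: 'X_{1..n.+1 < c}}|); last by move=> L N; apply: simplex_width.
move=> N cN.
have high f m : (c <= m)%N -> f \is m.-homog ->
  (q <= m)%N /\ exists ka : 'I_q -> F,
    in_span_of h' (f - \sum_i ka i *: (b' i * l0' ^+ (m - q))).
  by move=> cm; apply: HN0; apply: leq_trans cm; apply: leq_addr.
pose A1 := {al : {ffun 'I_n -> 'I_N.+1} | al \in simplex e N (N - c)}.
pose A2 := {al : {ffun 'I_n -> 'I_N.+1} | al \in simplex e N N}.
pose A3 := {al : {ffun 'I_n -> 'I_N.+1} | al \in simplex e N N :\: simplex e N (N - c)}.
pose wt (al : {ffun 'I_n -> 'I_N.+1}) := weight e (fun i => al i).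
pose mo (h0 : 'I_n -> B) (al : {ffun 'I_n -> 'I_N.+1}) := monomial_in h0 (fun i => al i).
pose psi1 (s : 'I_t * A1) : B := b s.1 * l0 ^+ (N - t - wt (val s.2)) * mo h (val s.2).
pose psi2 (s : 'I_q * A2 + 'X_{1..n.+1 < c} * A3) : B := match s with
  | inl s => b' s.1 * l0' ^+ (N - q - wt (val s.2)) * mo h' (val s.2)
  | inr s => 'X_[s.1] * mo h' (val s.2) end.
have h1 s : psi1 s \is N.-homog.
  have ws : (wt (val s.2) <= N - c)%N by have := valP s.2; rewrite inE.
  have := dhomogM (dhomogM (bh s.1) (dhomogMn (N - t - wt (val s.2)) (lform_homog a)))
    (monomial_in_homog (fun i => val s.2 i) hh).
  by rewrite mul1n -/(wt _) /psi1 (_ : _ + _ + _ = N)%N //; move: (wt _) ws => w; lia.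
have gens : graded_generators h' e b' l0' q c N `<=` range psi2.
  have fin al : (weight e al <= N)%N ->
      exists2 al' : {ffun 'I_n -> 'I_N.+1}, wt al' = weight e al & mo h' al' = monomial_in h' al.
    move=> wN; have alN i : (al i <= N)%N.
      apply: leq_trans wN; rewrite /weight (bigD1 i) //=.
      by apply: leq_trans (leq_addr _ _); rewrite leq_pmull.
    exists [ffun i => inord (al i)].
      by apply: eq_bigr => i _; rewrite ffunE inordK // ltnS.
    by apply: eq_bigr => i _; rewrite ffunE inordK // ltnS.
  move=> g [[i [al [s [E ->]]]]|[w [al [wc E ->]]]].
    have [|al' w1 m1] := fin al; first by lia.
    have al'P : al' \in simplex e N N by rewrite inE -/(wt al') w1; lia.
    exists (inl (i, exist _ al' al'P)) => //=; rewrite m1 w1; congr (_ * _ ^+ _ * _); lia.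
  have [|al' w1 m1] := fin al; first by lia.
  (* A cofactor of degree below [c] forces a weight above N - c, so these generators are counted by
     the outer layer. *)
  have al'P : al' \in simplex e N N :\: simplex e N (N - c).
    by rewrite !inE -/(wt al') w1; apply/andP; split; lia.
  by exists (inr (BMultinom wc, exist _ al' al'P)) => //=; rewrite m1.
have /choice [ka Hka] s : exists k, psi1 s = \sum_r k r *: psi2 r.
  apply: (spans_finite gens).
  exact: (graded_generators_span hh' e0 bh' (lform_homog a') high (h1 s)).
have : (#|{: 'I_t * A1}| <= #|{: 'I_q * A2 + 'X_{1..n.+1 < c} * A3}|)%N.
  rewrite leqNgt; apply/negP => lt.
  have [k [s0 ks0] Hk] := dependent_family ka lt.
  move/eqP: ks0; apply.
  apply: (@transversal_independent F n h e t p b l0 N (N - c) tr p0 ph bp Ha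
    (fun s => N - t - wt (val s.2))%N).
  rewrite (eq_bigr (fun s => \sum_r (k s * ka s r) *: psi2 r)).
    by rewrite exchange_big big1 //= => r _; rewrite -scaler_suml Hk scale0r.
  move=> s _; rewrite -[X in _ *: X]/(psi1 s) Hka scaler_sumr.
  by apply: eq_bigr => r _; rewrite scalerA.
by rewrite card_prod card_sum !card_prod !card_sig !card_ord.
Qed.

End TransversalCount.

Lemma pihomog_coef (R : nzRingType) k (f : {mpoly R[k]}) d m :
  (pihomog mdeg d f)@_m = if mdeg m == d then f@_m else 0.
Proof.
case: eqP => [<-|/eqP ne]; last exact: (dhomog_nemf_coeff (pihomogP _ _ _)).
rewrite [in RHS](mpoly_sum_homog f) [RHS]raddf_sum /=.
have [lt|ge] := ltnP (mdeg m) (msize f); last first.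
  rewrite pihomog_big // mcoeff0 big1 // => i _; apply: (dhomog_nemf_coeff (pihomogP _ _ _)).
  by rewrite /= neq_ltn (leq_trans (ltn_ord i) ge) orbT.
rewrite (bigD1 (Ordinal lt)) //= big1 ?addr0 // => i ne.
apply: (dhomog_nemf_coeff (pihomogP _ _ _)); apply: contra_neq ne => E.
exact: val_inj.
Qed.

(** * Generic linear sections *)

Section GenericParameters.
Variables (F : closedFieldType) (n K : nat).
Hypothesis Func : uncountable_field F.
Local Notation B := {mpoly F[n.+1]}.
Local Notation V := 'rV[F]_n.+1.
Local Notation L := {mpoly F[K]}.

Definition specialize (x : 'I_K -> F) (f : {mpoly L[n.+1]}) : B := map_mpoly (meval x) f.

Lemma specializeM x f g : specialize x (f * g) = specialize x f * specialize x g.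
Proof. exact: rmorphM. Qed.

Lemma specialize_sum x (I : Type) (r : seq I) (Q : pred I) (h : I -> {mpoly L[n.+1]}) :
  specialize x (\sum_(i <- r | Q i) h i) = \sum_(i <- r | Q i) specialize x (h i).
Proof. exact: rmorph_sum. Qed.

Definition constant_family (f : B) : {mpoly L[n.+1]} := map_mpoly (@mpolyC K F) f.

Lemma specialize_constant x f : specialize x (constant_family f) = f.
Proof.
by apply/mpolyP => m; rewrite /specialize /constant_family !mcoeff_map_mpoly /= mevalC.
Qed.

(* At x0 all monomials of some degree N are combinations of the family; with the
   same coefficients at x one gets a square matrix, whose determinant is [G]. *)
Lemma generic_no_common_zero (J : finType) (Fam : J -> {mpoly L[n.+1]}) (x0 : 'I_K -> F) :
  (forall x j, homogeneous (specialize x (Fam j))) ->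
  (forall u : V, (forall j, (specialize x0 (Fam j)).@[u 0] = 0) -> u = 0) ->
  exists2 G : L, G.@[x0] != 0 & forall x, G.@[x] != 0 ->
    forall u : V, (forall j, (specialize x (Fam j)).@[u 0] = 0) -> u = 0.
Proof.
move=> hom no0.
have [u Hu|N0 HN0] := ideal_high_degree Func
  (in_span_ideal (fun j => specialize x0 (Fam j))).
  by apply: no0 => j; apply: Hu; apply: in_span_gen.
pose N := N0.+1.
pose T : finType := {m : 'X_{1..n.+1 < N.+1} | mdeg m == N}.
have /choice [w Hw] (m : T) : exists w : J -> B,
    'X_[val (val m)] = \sum_j specialize x0 (Fam j) * w j.
  by apply: HN0; rewrite (eqP (valP m)).
pose H (m : T) : {mpoly L[n.+1]} := \sum_j Fam j * constant_family (w m j).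
pose E : 'M[L]_#|T| := \matrix_(i, j) (H (enum_val i))@_(val (val (enum_val j : T))).
have EE x i j : (map_mx (meval x) E) i j =
    (specialize x (H (enum_val i)))@_(val (val (enum_val j : T))).
  by rewrite !mxE /specialize mcoeff_map_mpoly.
exists (\det E).
  rewrite -det_map_mx (_ : map_mx _ E = 1%:M) ?det1 ?oner_eq0 //.
  apply/matrixP => i j; rewrite EE mxE specialize_sum.
  under eq_bigr do rewrite specializeM specialize_constant.
  rewrite -Hw mcoeffX; have [<-|ij] := eqVneq i j; first by rewrite eqxx.
  by case: eqP => // h; case/eqP: ij; apply: enum_val_inj; apply/val_inj/val_inj.
move=> x; rewrite -det_map_mx => dE u Hu.
have {}dE : map_mx (meval x) E \in unitmx by rewrite unitmxE unitfE.
pose mv : 'cV[F]_#|T| := \col_j ('X_[val (val (enum_val j : T))] : B).@[u 0].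
(* The matrix sends the vector of all monomials of degree [N] at [u] to the degree [N] parts of
   combinations that vanish along the line of [u]; as it is invertible, all these monomials
   vanish. *)
have mv0 : map_mx (meval x) E *m mv = 0.
  apply/matrixP => i j0; rewrite !mxE.
  have Hc c : (specialize x (H (enum_val i))).@[(c *: u) 0] = 0.
    rewrite specialize_sum rmorph_sum /= big1 // => j _; rewrite specializeM mevalM.
    by have [e he] := hom x j; rewrite (dhomog_meval _ _ he) Hu mulr0 mul0r.
  rewrite -[RHS](pihomog_vanish N Hc); set f := specialize x _.
  have -> : pihomog mdeg N f = \sum_(t : T) f@_(val (val t)) *: 'X_[val (val t)].
    apply/mpolyP => m; rewrite pihomog_coef [RHS]raddf_sum /=.
    have [mN|mN] := eqVneq (mdeg m) N; last first.
      rewrite big1 // => t _; rewrite mcoeffZ mcoeffX; case: eqP => [E1|]; last by rewrite mulr0.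
      by case/eqP: mN; rewrite -E1; apply/eqP; exact: (valP t).
    have mlt : (mdeg m < N.+1)%N by rewrite mN.
    have mN' : mdeg (BMultinom mlt) == N by rewrite /= mN.
    rewrite (bigD1 (exist (fun m : 'X_{1..n.+1 < N.+1} => mdeg m == N) _ mN' : T)) //=.
    rewrite mcoeffZ mcoeffX eqxx mulr1 big1 ?addr0 // => t tm.
    rewrite mcoeffZ mcoeffX; case: eqP => [E1|]; last by rewrite mulr0.
    by case/eqP: tm; apply/val_inj/val_inj.
  rewrite rmorph_sum /= (reindex (@enum_val T predT)) /=; last first.
    by apply: onW_bij; apply: enum_val_bij.
  by apply: eq_bigr => j _; rewrite EE mxE mevalZ.
have {}mv0 : mv = 0 by rewrite -[mv](mulKmx dE) mv0 mulmx0.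
apply/rowP => i; rewrite mxE.
have iN : (mdeg (U_(i) *+ N : 'X_{1..n.+1})%MM < N.+1)%N by rewrite mdegMn mdeg1 mul1n.
have iN' : mdeg (BMultinom iN) == N by rewrite /= mdegMn mdeg1 mul1n.
have /matrixP/(_ (enum_rank (exist (fun m : 'X_{1..n.+1 < N.+1} => mdeg m == N) _ iN' : T)) 0) := mv0.
rewrite !mxE enum_rankK /= -mpolyXn rmorphXn /= mevalXU => /eqP.
by rewrite expf_eq0 => /andP[_ /eqP].
Qed.

End GenericParameters.

(** [f] vanishes on the whole line of [u], and the differential in direction [u] is the derivative
    along that line. *)
Lemma euler_vanish (F : closedFieldType) n (f : {mpoly F[n.+1]}) e (u : 'rV[F]_n.+1) :
  f \is e.-homog -> f.@[u 0] = 0 -> dif f (u 0) (u 0) = 0.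
Proof.
move=> hf fu; have [r Hr] := along_line (u 0) (u 0) f.
have : along (fun i => (u 0 i)%:P + (u 0 i)%:P * 'X^1) f = 0.
  apply: poly_eq0_fun => t; rewrite horner_along.
  rewrite -(@meval_eq _ _ (((1 + t) *: u) 0)) => [|i].
    by rewrite (dhomog_meval _ _ hf) fu mulr0.
  by rewrite mxE hornerD hornerM hornerXn !hornerC expr1 mulrDl mul1r mulrC.
rewrite Hr fu polyC0 add0r => E.
have : (dif f (u 0) (u 0))%:P + r * 'X = 0.
  by apply: (mulIf (monic_neq0 (monicX F))); rewrite mul0r -[RHS]E; ring.
by move/(congr1 (horner^~ 0)); rewrite hornerD hornerM hornerX hornerC mulr0 addr0 horner0.
Qed.

Section GenericSections.
Variables (F : closedFieldType) (r k d : nat).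
Hypothesis Func : uncountable_field F.
Local Notation n := (r + k)%N.
Local Notation B := {mpoly F[n.+1]}.
Local Notation V := 'rV[F]_n.+1.
Variable g : 'I_r -> B.
Hypothesis gh : forall i, g i \is d.-homog.
Hypothesis d0 : (0 < d)%N.

Definition section_system (l : 'M[F]_(n.+1, k)) (i : 'I_n) : B :=
  match fintype.split i with inl a => g a | inr j => lform (col j l)^T end.

Definition section_degree (i : 'I_n) : nat :=
  match fintype.split i with inl _ => d | inr _ => 1%N end.

Lemma section_degree_gt0 i : (0 < section_degree i)%N.
Proof. by rewrite /section_degree; case: fintype.split. Qed.

Lemma section_system_homog l i : section_system l i \is (section_degree i).-homog.
Proof.
rewrite /section_system /section_degree; case: fintype.split => j; first exact: gh.
exact: lform_homog.
Qed.

Local Notation K := (n.+1 * k)%N.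

Section AuxiliaryForm.
Variable a : V.

Let rows (i : 'I_n.+1) (c : 'I_n.+1) : {mpoly {mpoly F[K]}[n.+1]} :=
  if unlift ord_max i is Some i' then
    match fintype.split i' with
    | inl s => constant_family K (g s)^`M(c)
    | inr j => ('X_(mxvec_index c j))%:MP
    end
  else constant_family K (a 0 c)%:MP.

Let jac := \det (\matrix_(i, c) rows i c).

Local Notation jac_at l := (frame (section_system l) a).

Let jac_special l : specialize (mxvec l 0) jac = \det (jac_at l).
Proof.
rewrite /jac /specialize -det_map_mx; congr (\det _); apply/matrixP => i c.
rewrite !mxE /rows /section_system; case: unlift => [i'|]; last exact: specialize_constant.
case: fintype.split => [s|j]; first exact: specialize_constant.
rewrite mderiv_lform !mxE /specialize /= map_mpolyC /= mevalXU.
by rewrite mxvecE.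
Qed.

(** At [l0] the system and its bordered Jacobian determinant vanish together only at the origin, an
    open condition on [l]. It implies transversality: a multiple of [u] brings a tangent vector into
    the hyperplane a = 0, where the regular frame kills it. *)
Lemma generic_transversal (l0 : 'M[F]_(n.+1, k)) :
  transversal (section_system l0) ->
  (forall u : V, u != 0 -> common_zero (section_system l0) u -> (lform a).@[u 0] != 0) ->
  exists2 G : {mpoly F[K]}, G != 0 &
    forall l, G.@[mxvec l 0] != 0 -> transversal (section_system l).
Proof.
move=> tr0 l0a.
pose Fam (j : option 'I_n) : {mpoly {mpoly F[K]}[n.+1]} := if j is Some i then
  match fintype.split i with
  | inl s => constant_family K (g s)
  | inr j => \sum_c ('X_(mxvec_index c j))%:MP * 'X_c
  end else jac.
have FamS l i : specialize (mxvec l 0) (Fam (Some i)) = section_system l i.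
  rewrite /Fam /section_system; case: fintype.split => j; first exact: specialize_constant.
  rewrite specialize_sum /lform; apply: eq_bigr => c _.
  rewrite specializeM /specialize map_mpolyC map_mpolyX /= mevalXU mxvecE !mxE.
  by rewrite mul_mpolyC.
have hom x j : homogeneous (specialize x (Fam j)).
  have -> : specialize x (Fam j) = specialize (mxvec (vec_mx (\row_i x i)) 0) (Fam j).
    apply/mpolyP => m; rewrite /specialize !mcoeff_map_mpoly /=; apply: meval_eq => i.
    by rewrite vec_mxK mxE.
  set l := vec_mx _; case: j => [i|].
    by rewrite FamS; exists (section_degree i); apply: section_system_homog.
  by rewrite jac_special; apply: frame_det_homog (section_system_homog l).
have [|G G0 HG] := generic_no_common_zero Func (x0 := mxvec l0 0) hom.
  move=> u Hu; apply: contrapT => /eqP u0.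
  have hu : common_zero (section_system l0) u by move=> i; have := Hu (Some i); rewrite FamS.
  have [|v v0 [Hv av]] := @frame_singular _ _ (section_system l0) a u.
    by have := Hu None; rewrite jac_special.
  have [c vE] := tr0 u u0 hu v Hv.
  move/eqP: av; rewrite vE lformZ mulf_eq0 (negPf (l0a u u0 hu)) orbF => /eqP c0.
  by move: v0; rewrite vE c0 scale0r eqxx.
exists G; first by apply: contra_neq G0 => ->; rewrite meval0.
move=> l Gl u u0 hu v Hv.
have Ju : (\det (jac_at l)).@[u 0] != 0.
  apply/eqP => J0; move/eqP: u0; apply; apply: (HG _ Gl) => -[i|].
    by rewrite FamS; apply: hu.
  by rewrite jac_special.
have eu i : dif (section_system l i) (u 0) (u 0) = 0.
  exact: euler_vanish (section_system_homog l i) (hu i).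
have au : (lform a).@[u 0] != 0.
  by apply/eqP => au; move/eqP: u0; apply; apply: (frame_regular Ju).
exists ((lform a).@[v 0] / (lform a).@[u 0]).
apply/eqP; rewrite -subr_eq0; apply/eqP; apply: (frame_regular Ju) => [i|].
  have difB : dif (section_system l i) (u 0) ((v - (lform a).@[v 0] / (lform a).@[u 0] *: u) 0) =
    dif (section_system l i) (u 0) (v 0) -
    (lform a).@[v 0] / (lform a).@[u 0] * dif (section_system l i) (u 0) (u 0).
    by rewrite /dif mulr_sumr -sumrB; apply: eq_bigr => c _; rewrite !mxE; ring.
  by rewrite difB Hv eu mulr0 subr0.
by rewrite lformB lformZ divfK // subrr.
Qed.

End AuxiliaryForm.
End GenericSections.

Section SectionCount.
Variables (F : closedFieldType) (r k d : nat).
Hypothesis Func : uncountable_field F.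
Local Notation n := (r + k)%N.
Local Notation B := {mpoly F[n.+1]}.
Local Notation V := 'rV[F]_n.+1.
Variable g : 'I_r -> B.
Hypothesis gh : forall i, g i \is d.-homog.
Hypothesis d0 : (0 < d)%N.

Lemma section_pointsP (l : 'M[F]_(n.+1, k)) (x : proj F n) (u : V) : u != 0 -> u \in val x ->
  ((zero_set (range g) `&` linear_section l) x <-> common_zero (section_system g l) u).
Proof.
move=> u0 ux; have lE j : (lform (col j l)^T).@[u 0] = (u *m l) 0 j.
  by rewrite lform_eval mxE; apply: eq_bigr => c _; rewrite !mxE mulrC.
split=> [[Zx Lx] i|hu].
  rewrite /section_system; case: fintype.split => j; last by rewrite lE Lx // mxE.
  by apply: (Zx (g j)) => //; exists j.
have hE s : section_system g l (unsplit s) =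
    match s with inl a => g a | inr j => lform (col j l)^T end.
  by rewrite /section_system unsplitK.
split.
  move=> _ [j _ <-]; apply/(vanishesP _ u0 ux); first by exists d.
  by have := hu (unsplit (inl j)); rewrite hE.
have ul : u *m l = 0.
  by apply/rowP => j; rewrite -lE mxE; have := hu (unsplit (inr j)); rewrite hE.
move=> v; rewrite (ptP u0 ux) /= => /vlineP [c ->].
by rewrite -scalemxAl ul scaler0.
Qed.

(** [transversal_count_le] is used in both directions: it bounds all lists of points of the section
    by [D], so a longest list is exhaustive, and then shows that this list has at least [D]
    elements. *)
Theorem section_count (l : 'M[F]_(n.+1, k)) (h : 'I_n -> B) D (p : 'I_D -> V) :
  (forall i, h i \is (section_degree d i).-homog) -> transversal h ->
  (forall i, p i != 0) -> (forall i j c, p i = c *: p j -> i = j) ->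
  (forall i, common_zero h (p i)) ->
  (forall u, u != 0 -> common_zero h u -> exists i c, u = c *: p i) ->
  transversal (section_system g l) ->
  (zero_set (range g) `&` linear_section l #= `I_D)%card.
Proof.
move=> hh trh p0 pd ph pall trl; set X := _ `&` _.
have [rep Hrep] := choice (fun x : proj F n => let: ex_intro2 u u0 xu := proj_rep x in
  ex_intro (fun u : V => u != 0 /\ val x = <[u]>%VS) u (conj u0 xu)).
have rep0 x : rep x != 0 by case: (Hrep x).
have repv x : rep x \in val x by case: (Hrep x) => _ ->; apply: memv_line.
have repX x : X x <-> common_zero (section_system g l) (rep x) by apply: section_pointsP.
have rep_inj x y c : rep x = c *: rep y -> x = y.
  move=> E; rewrite (ptP (rep0 x) (repv x)); apply/esym/ptP.
  by rewrite E memvZ.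
have e0 := section_degree_gt0 d0 (r := r) (k := k).
have sh i := section_system_homog gh l i.
pose Q t := `[< exists s : seq (proj F n), [/\ uniq s, size s = t & forall x, x \in s -> X x] >].
have seqd (s : seq (proj F n)) : uniq s -> forall i j c,
    rep (tnth (in_tuple s) i) = c *: rep (tnth (in_tuple s) j) -> i = j.
  move=> us i j c; have [x0 _] : exists x0 : proj F n, True by exists (tnth (in_tuple s) i).
  move=> /rep_inj; rewrite !(tnth_nth x0) => /eqP.
  by rewrite nth_uniq // => /eqP/val_inj.
pose pts (s : seq (proj F n)) (i : 'I_(size s)) : V := rep (tnth (in_tuple s) i).
have pts0 s i : @pts s i != 0 by apply: rep0.
have Qle t : Q t -> (t <= D)%N.
  move=> /asboolP [s [us <- sX]].
  have ptsX i : common_zero (section_system g l) (@pts s i) by apply/repX/sX/mem_tnth.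
  exact: (@transversal_count_le F n Func (section_system g l) h (section_degree d (k := k))
    (size s) D (@pts s) p e0 sh hh trl trh (@pts0 s) p0 (seqd s us) pd ptsX pall).
have Q0 : exists t, Q t by exists 0%N; apply/asboolP; exists [::].
case: (ex_maxnP Q0 Qle) => t Qt tmax; have tD := Qle _ Qt.
move/asboolP: Qt => [s [us st sX]].
have sall x : X x -> x \in s.
  move=> Xx; apply/negPn/negP => xs; have := tmax t.+1; rewrite ltnn => H.
  suff: false by []; apply: H; apply/asboolP; exists (x :: s); rewrite /= xs us st.
  by split=> // y; rewrite inE => /orP[/eqP ->|/sX].
have Dt : (D <= t)%N.
  rewrite -st.
  suff ptsall u : u != 0 -> common_zero (section_system g l) u -> exists i c, u = c *: @pts s i.
    exact: (@transversal_count_le F n Func h (section_system g l) (section_degree d (k := k))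
      D (size s) p (@pts s) e0 hh sh trh trl p0 (@pts0 s) pd (seqd s us) ph ptsall).
  move=> u0 hu.
  have ptX : X (pt u0) by apply/(section_pointsP l u0) => //; apply: memv_line.
  have is_ : (index (pt u0) s < size s)%N by rewrite index_mem sall.
  exists (Ordinal is_); rewrite /pts.
  have -> : tnth (in_tuple s) (Ordinal is_) = pt u0.
    by rewrite (tnth_nth (pt u0)) /= nth_index // sall.
  have := repv (pt u0); rewrite /= => /vlineP [c E].
  exists c^-1; rewrite E scalerA mulVf ?scale1r //.
  by apply: contra_neq (rep0 (pt u0)) => c0; rewrite E c0 scale0r.
have -> : D = size s by rewrite st; apply/eqP; rewrite eqn_leq Dt tD.
apply/card_set_bijP; exists (fun x => index x s); split.
- by move=> x /sall; rewrite /= index_mem.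
- move=> x y; rewrite !inE => /sall xs /sall ys E.
  by rewrite -(nth_index x xs) E nth_index.
- case: s sall us {st} sX => [|x0 s'] sall us sX i il; first by [].
  exists (nth x0 (x0 :: s') i); first by apply: sX; rewrite mem_nth.
  exact: index_uniq.
Qed.

End SectionCount.

(** * Smooth points *)

Section TopComponent.
Variables (F : fieldType) (k : nat).
Implicit Types p q f G H : {mpoly F[k]}.

Lemma pihomog_topM p q : p != 0 -> q != 0 ->
  pihomog mdeg ((msize p).-1 + (msize q).-1)%N (p * q) =
  pihomog mdeg (msize p).-1 p * pihomog mdeg (msize q).-1 q.
Proof.
move=> p0 q0; have [sp sq] : (0 < msize p /\ 0 < msize q)%N by rewrite !lt0n !msize_poly_eq0.
rewrite {2}(mpoly_sum_homog q) mulr_sumr (raddf_sum (pihomog mdeg _)).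
have lq : ((msize q).-1 < msize q)%N by lia.
rewrite (bigD1 (Ordinal lq)) //= [X in _ + X]big1 ?addr0 => [|j jm].
  by rewrite (pihomogM _ _ (pihomogP _ _ _)) leq_addl addnK.
have jq : j != (msize q).-1 :> nat by apply: contra jm => /eqP E; apply/eqP/val_inj.
rewrite (pihomogM _ _ (pihomogP _ _ _)); case: ifP => // _.
rewrite pihomog_big ?mul0r //; case: j {jm} jq => c /= cq /eqP jq; move: cq jq sp sq.
by move: (mmeasure mdeg p) (mmeasure mdeg q) => x y; lia.
Qed.

Lemma pihomog_top_neq0 p : p != 0 -> pihomog mdeg (msize p).-1 p != 0.
Proof.
move=> p0; apply/eqP => /mpolyP /(_ (mlead p)) /eqP.
by rewrite pihomog_coef -mlead_deg //= eqxx mcoeff0 mleadc_eq0 (negPf p0).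
Qed.

(** The top component of a product is the product of the top components, and a homogeneous [f] is
    its own top component. *)
Lemma square_factor_homog f G H d : f != 0 -> f \is d.-homog -> f = G ^+ 2 * H ->
  exists G' H', G' \is ((msize G).-1).-homog /\ f = G' ^+ 2 * H'.
Proof.
move=> f0 fh fE.
have [G0 H0] : G != 0 /\ H != 0 by move: f0; rewrite fE mulf_eq0 expf_eq0 negb_or => /andP.
set G' := pihomog mdeg (msize G).-1 G; set H' := pihomog mdeg (msize H).-1 H.
exists G', H'; split; first exact: pihomogP.
have E : pihomog mdeg ((msize G).-1 + ((msize G).-1 + (msize H).-1)) f = G' ^+ 2 * H'.
  have GH : (msize (G * H)).-1 = ((msize G).-1 + (msize H).-1)%N.
    rewrite msizeM //; move: (mpolySpred mdeg G0) (mpolySpred mdeg H0).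
    by move: (mmeasure mdeg G) (mmeasure mdeg H) => x y; lia.
  by rewrite fE expr2 -mulrA -{1}GH pihomog_topM ?mulf_neq0 // GH pihomog_topM // expr2 mulrA.
rewrite -E; have [dE|dE] := eqVneq d ((msize G).-1 + ((msize G).-1 + (msize H).-1))%N.
  by rewrite -dE pihomog_dE.
move: E; rewrite (pihomog_ne0 dE fh) => /esym /eqP.
by rewrite mulf_eq0 expf_eq0 !(negPf (pihomog_top_neq0 _)).
Qed.

End TopComponent.

Section SmoothPoints.
Variables (F : closedFieldType) (n r d : nat).
Hypothesis Func : uncountable_field F.
Local Notation B := {mpoly F[n.+1]}.
Local Notation V := 'rV[F]_n.+1.
Variable g : 'I_r -> B.
Hypothesis g_homog : forall i, g i \is d.-homog.
Local Notation Z := (zero_set (range g)).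
Implicit Types (x : proj F n) (u : V).

Lemma zero_setE x u : u != 0 -> u \in val x -> Z x <-> forall i, (g i).@[u 0] = 0.
Proof.
move=> u0 ux; split=> [Zx i|gu _ [i _ <-]]; first by apply: Zx => //; exists i.
by apply/(vanishesP _ u0 ux) => //; exists d.
Qed.

Lemma zero_set_closed : zariski_closed Z.
Proof. by exists (range g) => // _ [i _ <-]; exists d. Qed.

Lemma cone_zero_set u : Z !=set0 -> cone Z u <-> forall i, (g i).@[u 0] = 0.
Proof.
move=> Z0; have [->|u0] := eqVneq u 0.
  split=> [_ i|_]; last exact: cone0.
  case: Z0 => x Zx; have [v v0 vx] := proj_rep x.
  have vx' : v \in val x by rewrite vx memv_line.
  have : (g i).@[v 0] = 0 by apply: Zx => //; exists i.
  have [d0|d0] := posnP d; last by move=> _; exact: (dhomog_meval0 (g_homog i) d0).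
  by have := @dhomog_meval _ _ _ _ 0 v (g_homog i); rewrite d0 expr0 mul1r scale0r => ->.
rewrite (cone_pt _ u0) (@zero_setE _ u) //=; exact: memv_line.
Qed.

Lemma tangentP f e x u v : f \is e.-homog -> u != 0 -> u \in val x ->
  tangent f x v <-> dif f (u 0) (v 0) = 0.
Proof.
move=> fh u0 ux; split=> [/(_ u ux) //|fv w wx].
have := wx; rewrite (ptP u0 ux) => /vlineP [c ->].
rewrite /differential; transitivity (c ^+ e.-1 * dif f (u 0) (v 0)); last by rewrite fv mulr0.
rewrite /dif mulr_sumr; apply: eq_bigr => i _.
by rewrite (dhomog_meval _ _ (dhomog_mderiv i fh)) mulrA.
Qed.

Lemma tangent_space_dim x u : u != 0 -> u \in val x -> submersive g u ->
  forall m, (m + r = n.+1)%N ->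
  has_linear_dim [set v | forall i, tangent (g i) x v] m.
Proof.
move=> u0 ux su m mr; pose f := linfun (mulmxr (jacobian g u) : 'rV[F]_n.+1 -> 'rV_r).
exists (lker f).
  apply/seteqP; split=> v /= Hv.
    rewrite memv_ker lfunE /=; apply/eqP/rowP => i; rewrite jacobianE mxE.
    exact/(tangentP _ (g_homog i) u0 ux).
  move=> i; apply/(tangentP _ (g_homog i) u0 ux); move: Hv.
  by rewrite memv_ker lfunE /= => /eqP /rowP /(_ i); rewrite jacobianE mxE.
have := limg_ker_dim f fullv; rewrite capfv.
have -> : (f @: fullv)%VS = fullv.
  apply/eqP; rewrite eqEsubv subvf /=; apply/subvP => y _; have [w Hw] := su (y 0).
  apply/memv_imgP; exists w; rewrite ?memvf // lfunE /=.
  by apply/rowP => i; rewrite jacobianE Hw.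
have dimE N : dim 'rV[F]_N = N by rewrite dim_matrix; exact: mul1n.
by rewrite !dimvf !dimE => E; apply: (@addIn r); rewrite mr.
Qed.

(** By the Nullstellensatz a form vanishing on [Z] has a power in (g); [tangent_of_power] passes
    from the power to the form. *)
Lemma zariski_tangentE x u : Z x -> u != 0 -> u \in val x -> submersive g u ->
  zariski_tangent Z x = [set v | forall i, tangent (g i) x v].
Proof.
move=> Zx u0 ux su; apply/seteqP; split=> v /= Hv.
  move=> i; apply: Hv; split; first by exists d.
  by move=> y Zy; apply: Zy; exists i.
move=> f [[e fh] fZ]; apply/(tangentP _ fh u0 ux).
have Z0 : Z !=set0 by exists x.
have [a Ha|N [w Hw]] := nullstellensatz Func (f := f) (in_span_ideal g).
  pose a' : V := \row_i a i.
  have aE q : q.@[a] = q.@[a' 0] by apply: meval_eq => i; rewrite mxE.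
  rewrite aE; apply: (cone_vanishP f Z0).2 => //.
  apply/cone_zero_set => // i; rewrite -aE; apply: Ha; exact: in_span_gen.
apply: tangent_of_power Hw => [b|i|i].
- by have [w0 Hw0] := su b; exists (w0 0).
- by have /zero_setE := Zx; apply.
- exact/(tangentP _ (g_homog i) u0 ux).
Qed.

Lemma smooth_point k x u : (r + k = n)%N -> (forall m c, irreducible_chain Z m c -> (m <= k)%N) ->
  pure_dim Z k -> Z x -> u != 0 -> u \in val x -> submersive g u ->
  smooth_at Z x /\ tangents_in_general_position g x.
Proof.
move=> rk bnd pureZ Zx u0 ux su; split; last first.
  by exists k.+1; [apply: tangent_space_dim u0 ux su _ _|]; lia.
split=> //; exists k; last first.
  by rewrite (zariski_tangentE Zx u0 ux su); apply: tangent_space_dim u0 ux su _ _; lia.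
split; last by move=> W m /pureZ Wk _ Wm; rewrite (has_dim_uniq Wm Wk).
have [W cW Wx] := component_exists zero_set_closed bnd Zx.
by exists W; split=> //; apply: pureZ.
Qed.

End SmoothPoints.

(** * Pencils of cages *)

Section PencilOfCages.
Variables (F : closedFieldType) (r k d : nat).
Hypothesis Func : uncountable_field F.
Local Notation n := (r + k)%N.
Local Notation B := {mpoly F[n.+1]}.
Local Notation V := 'rV[F]_n.+1.
Variable l : nat -> nat -> V.
Hypothesis d_gt0 : (0 < d)%N.
Hypothesis grid_dual : forall I j, valid n d I -> (j < n)%N ->
  exists v, ell l j (I j) v = 1 /\ forall i, (i < n)%N -> i != j -> ell l i (I i) v = 0.
Hypothesis grid_node : forall I, valid n d I -> exists2 v, v != 0 & on_node l I v.
Hypothesis grid_distinct : forall I v j i, valid n d I -> v != 0 -> on_node l I v ->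
  (j < n)%N -> (i < d)%N -> i != I j -> ell l j i v != 0.

Variables (M : 'M[F]_(r, n)) (sigma : 'I_n -> 'I_n).
Hypothesis sigma_inj : injective sigma.
Hypothesis M_unit : (\matrix_(i, j) M i (sigma (lshift k j)) : 'M_r) \in unitmx.

Local Notation col_form j := (color_form d l j).

(** [sigma] lists the pivot colours first; unit rows at the other colours complete [M] to an
    invertible matrix. *)
Definition system_matrix : 'M[F]_n := col_mx M (\matrix_(s, j) (j == sigma (rshift r s))%:R).

Lemma system_matrix_inj (x : 'cV[F]_n) : system_matrix *m x = 0 -> x = 0.
Proof.
rewrite /system_matrix mul_col_mx => /eqP; rewrite col_mx_eq0 => /andP[/eqP Mx /eqP Sx].
have xk s : x (sigma (rshift r s)) 0 = 0.
  have /matrixP/(_ s 0) := Sx; rewrite !mxE (bigD1 (sigma (rshift r s))) //= !mxE eqxx mul1r.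
  by rewrite big1 ?addr0 // => j /negPf jn; rewrite mxE jn mul0r.
pose y : 'cV[F]_r := \col_a x (sigma (lshift k a)) 0.
have : (\matrix_(i, j) M i (sigma (lshift k j)) : 'M_r) *m y = 0.
  apply/matrixP => i j0; have /matrixP/(_ i 0) := Mx; rewrite !mxE => E; rewrite -[RHS]E.
  rewrite (reindex_inj sigma_inj) big_split_ord /= [X in _ = _ + X]big1 ?addr0.
    by apply: eq_bigr => j _; rewrite !mxE.
  by move=> s _; rewrite xk mulr0.
move/(congr1 (mulmx (invmx (\matrix_(i, j) M i (sigma (lshift k j)))))).
rewrite mulKmx // mulmx0 => y0.
have [tau tauK sigK] : bijective sigma by apply: injF_bij.
apply/matrixP => j j0; rewrite ord1 mxE -(sigK j).
rewrite -(splitK (tau j)); case: (fintype.split (tau j)) => a /=; last exact: xk.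
by have /matrixP/(_ a 0) := y0; rewrite !mxE.
Qed.

Lemma system_matrix_unit : system_matrix \in unitmx.
Proof.
rewrite unitmxE unitfE -det_tr; apply/det0P => -[v v0 Hv].
have : v^T = 0 by apply: system_matrix_inj; rewrite -[system_matrix]trmxK -trmx_mul Hv trmx0.
by move=> /(congr1 trmx); rewrite trmxK trmx0 => E; rewrite E eqxx in v0.
Qed.

Definition pencil_form (i : 'I_n) : B := \sum_j system_matrix i j *: col_form j.
Local Notation g := pencil_form.
Definition pencil_eqn (i : 'I_r) : B := g (lshift k i).
Local Notation gR := pencil_eqn.
Definition pencil_param (s : 'I_k) : B := g (rshift r s).
Local Notation gK := pencil_param.

Lemma pencil_form_homog i : g i \is d.-homog.
Proof. by apply: rpred_sum => j _; apply: rpredZ; apply: color_form_homog. Qed.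

Lemma pencil_eqnE i : gR i = \sum_j M i j *: col_form j.
Proof. by apply: eq_bigr => j _; rewrite /system_matrix col_mxEu. Qed.

Lemma pencil_paramE s : gK s = col_form (sigma (rshift r s)).
Proof.
rewrite /pencil_param /pencil_form (bigD1 (sigma (rshift r s))) //= /system_matrix col_mxEd mxE eqxx scale1r.
by rewrite big1 ?addr0 // => j /negPf jn; rewrite col_mxEd mxE jn scale0r.
Qed.

Lemma color_formE (j : 'I_n) : col_form j = \sum_(i < n) (invmx system_matrix) j i *: g i.
Proof.
have -> : \sum_(i < n) (invmx system_matrix) j i *: g i =
    \sum_(c < n) (invmx system_matrix *m system_matrix) j c *: col_form c.
  under eq_bigr do rewrite scaler_sumr.
  rewrite exchange_big /=; apply: eq_bigr => c _; rewrite mxE scaler_suml.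
  by apply: eq_bigr => i _; rewrite scalerA.
rewrite mulVmx ?system_matrix_unit // (bigD1 j) //= mxE eqxx scale1r.
by rewrite big1 ?addr0 // => c /negPf jc; rewrite mxE eq_sym jc scale0r.
Qed.

Definition node_vectors : set V := [set p | p != 0 /\ exists2 I, valid n d I & on_node l I p].

Lemma pencil_form_node (p : V) i : node_vectors p -> (g i).@[p 0] = 0.
Proof.
move=> [p0 [I vI nI]]; rewrite rmorph_sum /= big1 // => j _.
by rewrite mevalZ (color_form_node vI nI) ?mulr0.
Qed.

Lemma node_of_zero (u : V) : u != 0 -> (forall i, (g i).@[u 0] = 0) -> node_vectors u.
Proof.
move=> u0 gu; split=> //.
have cu (j : 'I_n) : (col_form j).@[u 0] = 0.
  by rewrite color_formE rmorph_sum /= big1 // => i _; rewrite mevalZ gu mulr0.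
have /choice [I HI] (j : nat) : exists i, (j < n)%N -> (i < d)%N /\ ell l j i u = 0.
  have [jn|_] := ltnP j n; last by exists 0%N.
  have /eqP := cu (Ordinal jn); rewrite color_form_eval /= prodf_seq_eq0 => /hasP [i _ /eqP Ei].
  by exists i => _; split.
exists I; first by move=> j /HI [].
by move=> j /HI [].
Qed.

Lemma dif_lin (f : B) (p w w' : 'I_n.+1 -> F) c :
  dif f p (fun i => w i + c * w' i) = dif f p w + c * dif f p w'.
Proof. by rewrite /dif mulr_sumr -big_split /=; apply: eq_bigr => i _; ring. Qed.

Lemma dif_sumZ (T : Type) (s : seq T) (c : T -> F) (h : T -> B) p w :
  dif (\sum_(i <- s) c i *: h i) p w = \sum_(i <- s) c i * dif (h i) p w.
Proof.
elim: s => [|i s IH]; first by rewrite !big_nil -mpolyC0 difC.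
by rewrite !big_cons difD IH -mul_mpolyC difM difC mevalC mulr0 addr0.
Qed.

Lemma dif_sum_vec (f : B) p (T : Type) (s : seq T) (c : T -> F) (w : T -> V) :
  dif f p ((\sum_(i <- s) c i *: w i) 0) = \sum_(i <- s) c i * dif f p (w i 0).
Proof.
elim: s => [|i s IH].
  by rewrite !big_nil /dif big1 // => i _; rewrite mxE mulr0.
rewrite !big_cons -IH [RHS]addrC -dif_lin; apply: eq_bigr => j _; congr (_ * _).
by rewrite !mxE addrC.
Qed.

Lemma dif_color_form j I (p w : V) : valid n d I -> on_node l I p -> (j < n)%N ->
  dif (col_form j) (p 0) (w 0) =
    (\prod_(i < d | i != I j :> nat) ell l j i p) * ell l j (I j) w.
Proof.
move=> vI nI jn; rewrite /color_form (bigD1 (Ordinal (vI j jn))) //= difM.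
rewrite dif_lform; have -> : (lform (l j (I j))).@[p 0] = 0 by apply: nI.
rewrite mul0r add0r -/(ell l j (I j) w); congr (_ * _).
by rewrite rmorph_prod; apply: eq_bigl.
Qed.

(** At a node the differential of a colour form is a nonzero constant times the equation of its
    hyperplane through the node. On the dual vectors these differentials are diagonal, and
    [system_matrix] is invertible. *)
Lemma node_submersive (p : V) : node_vectors p -> submersive g p.
Proof.
move=> [p0 [I vI nI]] b.
pose e (j : nat) := \prod_(i < d | i != I j :> nat) ell l j i p.
have e0 (j : 'I_n) : e j != 0.
  by apply/prodf_neq0 => i ij; apply: (grid_distinct vI).
have /choice [v Hv] (j : 'I_n) : exists v, ell l j (I j) v = 1 /\
    forall i, (i < n)%N -> i != j -> ell l i (I i) v = 0 by apply: grid_dual.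
pose y : 'cV[F]_n := invmx system_matrix *m \col_i b i.
exists (\sum_j (y j 0 / e j) *: v j) => i.
rewrite /pencil_form dif_sumZ.
have -> : b i = (system_matrix *m y) i 0 by rewrite mulKVmx ?system_matrix_unit // mxE.
rewrite mxE; apply: eq_bigr => j _; congr (_ * _).
rewrite dif_sum_vec (bigD1 j) //= big1 ?addr0 => [|c cj].
  rewrite (dif_color_form _ vI nI) // -/(e j); have [-> _] := Hv j.
  by rewrite mulr1 divfK.
rewrite (dif_color_form _ vI nI) //; have [_ ->] := Hv c; rewrite ?mulr0 //.
by apply: contra_neq cj => E; apply: val_inj.
Qed.

Lemma dif_pencil_form_self (p : V) i : node_vectors p -> dif (g i) (p 0) (p 0) = 0.
Proof. by move=> Np; apply: euler_vanish (pencil_form_homog i) (pencil_form_node i Np). Qed.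

Lemma forms_generate (f : B) : (forall p, node_vectors p -> f.@[p 0] = 0) ->
  exists w w', f = \sum_i gR i * w i + \sum_s gK s * w' s.
Proof.
move=> fN; have [|w ->] := color_forms_generate d_gt0 grid_dual grid_node grid_distinct (f := f).
  by move=> I vI _ v v0 nv; apply: fN; split=> //; exists I.
pose w' i := \sum_(j < n) invmx system_matrix j i *: w j.
exists (fun i => w' (lshift k i)), (fun s => w' (rshift r s)).
transitivity (\sum_i g i * w' i); last by rewrite big_split_ord.
under eq_bigr do rewrite color_formE mulr_suml.
rewrite exchange_big /=; apply: eq_bigr => i _; rewrite mulr_sumr.
by apply: eq_bigr => j _; rewrite -scalerAl scalerAr.
Qed.

Lemma node_transversal : transversal g.
Proof.
move=> u u0 /(node_of_zero u0) Nu v gv.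
apply: (kernel_line ((submersiveP _ _).1 (node_submersive Nu)) u0).
  by apply/rowP => i; rewrite jacobianE dif_pencil_form_self // mxE.
by apply/rowP => i; rewrite jacobianE gv mxE.
Qed.

Lemma node_line I (p q : V) : valid n d I -> p != 0 -> on_node l I p -> on_node l I q ->
  exists c, q = c *: p.
Proof.
move=> vI p0 np nq; apply: (node_transversal p0) => i.
  by apply: pencil_form_node; split=> //; exists I.
rewrite /pencil_form dif_sumZ big1 // => j _.
by rewrite (dif_color_form _ vI np) // nq ?mulr0.
Qed.

Lemma node_form_exists : exists a : V, forall p, node_vectors p -> (lform a).@[p 0] != 0.
Proof.
pose T := {ffun 'I_n -> 'I_d}.
pose In (I : T) (j : nat) : nat := if insub j is Some j' then I j' else 0%N.
have vIn I : valid n d (In I) by move=> j jn; rewrite /In insubT.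
have /choice [p Hp] (i : 'I_#|T|) : exists p : V, p != 0 /\ on_node l (In (enum_val i)) p.
  by have [p p0 np] := grid_node (vIn (enum_val i)); exists p.
have [a Ha] := avoiding_form (p := p) (fun i => (Hp i).1).
exists a => q [q0 [I vI nI]].
pose I' : T := [ffun j : 'I_n => Ordinal (vI j (ltn_ord j))].
have nq : on_node l (In I') q.
  by move=> j jn; rewrite /In insubT ffunE /=; apply: nI.
have [_ np] := Hp (enum_rank I'); rewrite enum_rankK in np.
have [c qE] := node_line (vIn I') (Hp _).1 np nq.
rewrite qE lformZ mulf_neq0 //.
by apply: contra_neq q0 => c0; rewrite qE c0 scale0r.
Qed.

Variable a : V.
Hypothesis node_form : forall p, node_vectors p -> (lform a).@[p 0] != 0.
Local Notation X := (zero_set (range gR)).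
Local Notation par := (params d gK (lform a)).

(** By Euler's identity the differentials of the pencil forms kill [p], so a multiple of [p] adjusts
    the value of [lform a] alone. *)
Lemma node_submersive_form (p : V) b b' c : node_vectors p -> exists w,
  [/\ forall i, dif (gR i) (p 0) w = b i, forall s, dif (gK s) (p 0) w = b' s &
      dif (lform a) (p 0) w = c].
Proof.
move=> Np; have [w Hw] := node_submersive Np
  (fun i => match fintype.split i with inl i => b i | inr s => b' s end).
pose t := (c - dif (lform a) (p 0) (w 0)) / (lform a).@[p 0].
exists (fun i => w 0 i + t * p 0 i); split=> [i|s|].
- rewrite dif_lin Hw -[lshift k i]/(unsplit (inl i)) unsplitK /pencil_eqn dif_pencil_form_self //.
  by rewrite mulr0 addr0.
- rewrite dif_lin Hw -[rshift r s]/(unsplit (inr s)) unsplitK /pencil_param dif_pencil_form_self //.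
  by rewrite mulr0 addr0.
- rewrite dif_lin [X in _ + _ * X]dif_lform divfK ?node_form //.
  by rewrite addrC subrK.
Qed.

Lemma pencil_eqn_homog i : gR i \is d.-homog. Proof. exact: pencil_form_homog. Qed.
Lemma pencil_param_homog s : gK s \is d.-homog. Proof. exact: pencil_form_homog. Qed.

Lemma component_indep W : component X W -> alg_indep W par.
Proof.
apply: (component_dominates Func (N := node_vectors)) => //.
- exact: pencil_eqn_homog.
- exact: pencil_param_homog.
- exact: lform_homog.
- exact: forms_generate.
- by move=> p i; apply: pencil_form_node.
- by move=> p i; apply: pencil_form_node.
- by move=> p b b' c; apply: node_submersive_form.
Qed.

Lemma node_of_zero_split (u : V) : u != 0 -> (forall i, (gR i).@[u 0] = 0) ->
  (forall s, (gK s).@[u 0] = 0) -> node_vectors u.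
Proof.
move=> u0 gR0 gK0; apply: node_of_zero => // i.
by rewrite -(splitK i); case: (fintype.split i).
Qed.

Lemma pencil_params_homog i : par i \is d.-homog.
Proof. by apply: params_homog; [apply: pencil_param_homog | apply: lform_homog]. Qed.

Lemma pencil_params_no_common_zero : no_common_zero X par.
Proof.
move=> u Xu pu; apply: contrapT => /eqP u0.
have gR0 : forall i, (gR i).@[u 0] = 0.
  apply/(zero_setE pencil_eqn_homog (x := pt u0) u0); first exact: memv_line.
  exact/cone_pt.
have Nu : node_vectors u.
  by apply: node_of_zero_split => // s; have := pu (lift ord0 s); rewrite /params /cons_fun liftK.
have := pu ord0; rewrite /params /cons_fun unlift_none rmorphXn => /eqP.
by rewrite expf_eq0 (negPf (node_form Nu)) andbF.
Qed.

Lemma chain_le m c : irreducible_chain X m c -> (m <= k)%N.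
Proof.
by apply: (chain_length_lt Func (zero_set_closed pencil_eqn_homog) pencil_params_homog (fun=> d_gt0)
  pencil_params_no_common_zero).
Qed.

Lemma component_chain W : component X W -> exists2 c, irreducible_chain W k c &
  forall x, c 0%N x -> W x /\ forall u, u != 0 -> u \in val x -> node_vectors u.
Proof.
move=> cW; have [irrW WX _] := cW.
have zW : no_common_zero W par by move=> u /(coneS WX); apply: pencil_params_no_common_zero.
have [c Hc c0] := chain_exists Func irrW d_gt0 pencil_params_homog (component_indep cW) zW.
exists c => // x /c0 [Wx vx]; split=> // u u0 ux.
apply: node_of_zero_split => // [|s].
  by apply/(zero_setE pencil_eqn_homog u0 ux); apply: WX.
have := vx (lift ord0 s) isT; rewrite /params /cons_fun liftK; exact.
Qed.

Lemma pure_dim_zero_set : pure_dim X k.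
Proof.
move=> W cW; have [c Hc _] := component_chain cW; split; first by exists c.
move=> m c' [c1 c2 c3]; apply: (@chain_le m c'); split=> //.
by case: cW => _ WX _; apply: subset_trans c3 WX.
Qed.

Lemma component_node W : component X W ->
  exists x u, [/\ W x, u != 0, u \in val x & node_vectors u].
Proof.
move=> cW; have [c [irr _ _] c0] := component_chain cW.
have [_ [x /c0 [Wx Hx]] _] := irr 0%N isT.
have [u u0 xu] := proj_rep x; have ux : u \in val x by rewrite xu memv_line.
by exists x, u; split=> //; apply: Hx.
Qed.

Lemma zero_set_has_dim : has_dim X k.
Proof.
split; last exact: chain_le.
have [//|u u0 nu] := @grid_node (fun=> 0%N).
have Nu : node_vectors u by split=> //; exists (fun=> 0%N).
have Xu : X (pt u0).
  by apply/(zero_setE pencil_eqn_homog u0) => [|i]; [apply: memv_line | apply: pencil_form_node].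
have [W cW _] := component_exists (zero_set_closed pencil_eqn_homog) chain_le Xu.
have [c [c1 c2 c3] _] := component_chain cW; exists c; split=> //.
by case: cW => _ WX _; apply: subset_trans c3 WX.
Qed.

Lemma node_smooth (x : proj F n) (u : V) : u != 0 -> u \in val x -> node_vectors u ->
  smooth_at X x /\ tangents_in_general_position gR x.
Proof.
move=> u0 ux Nu; apply: (smooth_point Func pencil_eqn_homog _ chain_le pure_dim_zero_set _ u0 ux) => //.
  by apply/(zero_setE pencil_eqn_homog u0 ux) => i; apply: pencil_form_node.
move=> b; have [w [Hw _ _]] := node_submersive_form b (fun=> 0) 0 Nu.
exists (\row_i w i) => i; rewrite -[RHS]Hw; apply: eq_bigr => j _.
by rewrite mxE.
Qed.

(* Replacing the i0-th form by a square factor [G] leaves a common zero, a node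
   at which the differential of the i0-th form vanishes. *)
Lemma square_common_zero e G (i0 : 'I_n) : (0 < e)%N -> G \is e.-homog ->
  exists u : V, [/\ u != 0, G.@[u 0] = 0 & forall i, i != i0 -> (g i).@[u 0] = 0].
Proof.
move=> e0 Gh; pose z i := if i == i0 then G else g i.
pose dz i := if i == i0 then e else d.
have zh i : z i \is (dz i).-homog by rewrite /z /dz; case: eqP => _; last exact: pencil_form_homog.
have dz0 i : (0 < dz i)%N by rewrite /dz; case: eqP.
have Xind : alg_indep [set: proj F n] (fun i : 'I_n.+1 => 'X_i : B).
  move=> P HP; apply: mpoly_eq0_fun => x; pose u : V := \row_i x i.
  have cu : cone [set: proj F n] u.
    by have [->|u0] := eqVneq u 0; [apply: cone0 | apply/(cone_pt _ u0)].
  rewrite -[RHS](HP u cu); apply: meval_eq => i.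
  by rewrite mevalXU mxE.
have : ~ no_common_zero [set: proj F n] z.
  by move=> zz; have := indep_le_generators Func (@closedT F n) zh dz0 zz Xind; rewrite ltnn.
move/existsNP => [u /not_implyP [_ /not_implyP [uz /eqP u0]]].
exists u; split=> //; first by have := uz i0; rewrite /z eqxx.
by move=> i /negPf ii0; have := uz i; rewrite /z ii0.
Qed.

Lemma pencil_form_neq0 i : g i != 0.
Proof.
have [//|u u0 nu] := @grid_node (fun=> 0%N).
have [|w /(_ i) Hw] := @node_submersive u _ (fun=> 1).
  by split=> //; exists (fun=> 0%N).
by apply: contra_eqN Hw => /eqP ->; rewrite -mpolyC0 difC eq_sym oner_eq0.
Qed.

Lemma pencil_form_hypersurface i : hypersurface_equation d (g i).
Proof.
split=> //; [exact: pencil_form_neq0 | exact: pencil_form_homog |] => G H gE.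
have [G' [H' [G'h gE']]] := square_factor_homog (pencil_form_neq0 i) (pencil_form_homog i) gE.
rewrite leqNgt; apply/negP => G1.
have e0 : (0 < (msize G).-1)%N by rewrite -ltnS (ltn_predK G1).
have [u [u0 Gu gu]] := square_common_zero i e0 G'h.
have Nu : node_vectors u.
  apply: node_of_zero => // j; have [->|/gu //] := eqVneq j i.
  by rewrite gE' mevalM rmorphXn /= Gu expr0n mul0r.
have [w /(_ i) /eqP] := @node_submersive u Nu (fun=> 1).
by rewrite gE' difM expr2 difM mevalM Gu !(mul0r, mulr0, addr0) eq_sym oner_eq0.
Qed.

Local Notation detF := (\det (frame g a)).

Lemma node_frame (u : V) : node_vectors u -> detF.@[u 0] != 0.
Proof.
move=> Nu; apply/eqP => /frame_singular [v v0 [gv]].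
have [c vE] := node_transversal Nu.1 (fun i => pencil_form_node i Nu) gv.
rewrite vE lformZ => /eqP; rewrite mulf_eq0 (negPf (node_form Nu)) orbF => /eqP c0.
by rewrite vE c0 scale0r eqxx in v0.
Qed.

Lemma frame_submersive_eqn (u : V) : detF.@[u 0] != 0 -> submersive gR u.
Proof.
move=> /frame_submersive su b; have [w Hw] := su
  (fun i => if fintype.split i is inl c then b c else 0).
by exists w => i; rewrite Hw -[lshift k i]/(unsplit (inl i)) unsplitK.
Qed.

Lemma zero_set_complete_intersection : complete_intersection X (nseq_tuple r d).
Proof.
have detF_homog : homogeneous detF := frame_det_homog a pencil_form_homog.
split; [exact: zero_set_closed pencil_eqn_homog | by exists k; [exact: pure_dim_zero_set | lia] |].
exists gR; split.
- by move=> i; rewrite tnth_nseq; apply: pencil_form_hypersurface.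
- apply/seteqP; split=> x Xx.
    by move=> i _ _ ->; apply: Xx; exists i.
  by move=> _ [i _ <-]; apply: (Xx i).
(* The exceptional set is where the bordered Jacobian of all [n] forms degenerates; every component
   contains a node, and nodes lie off it. *)
move=> W cW; exists (zero_set [set detF]); split.
- exact: closed_zero detF_homog.
- have [x [u [Wx u0 ux Nu]]] := component_node cW.
  move=> /(_ x Wx) /zero_set1P /(vanishesP detF_homog u0 ux) E.
  by have := node_frame Nu; rewrite E eqxx.
move=> x Wx nZx; have Xx : X x by case: cW => _ WX _; apply: WX.
have [u u0 xu] := proj_rep x; have ux : u \in val x by rewrite xu memv_line.
apply: (smooth_point Func pencil_eqn_homog _ chain_le pure_dim_zero_set Xx u0 ux) => //.
apply: frame_submersive_eqn; apply: contra_notN nZx => /eqP E.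
exact/zero_set1P/(vanishesP detF_homog u0 ux).
Qed.

(* The reference section is cut out by the hyperplanes numbered 0 of the colours
   [sigma (rshift r s)]. *)
Definition grid_section : 'M[F]_(n.+1, k) := \matrix_(c, s) l (sigma (rshift r s)) 0%N 0 c.

Local Notation sec := (section_system gR grid_section).

Lemma grid_sectionE s : (col s grid_section)^T = l (sigma (rshift r s)) 0%N.
Proof. by apply/rowP => c; rewrite !mxE. Qed.

Lemma section_lshift (i : 'I_r) : sec (lshift k i) = gR i.
Proof. by rewrite /section_system -[lshift k i]/(unsplit (inl i)) unsplitK. Qed.

Lemma section_rshift (s : 'I_k) : sec (rshift r s) = lform (l (sigma (rshift r s)) 0%N).
Proof.
by rewrite /section_system -[rshift r s]/(unsplit (inr s)) unsplitK grid_sectionE.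
Qed.

Lemma section_node (u : V) : u != 0 -> common_zero sec u -> exists I,
  [/\ valid n d I, on_node l I u & forall s : 'I_k, I (sigma (rshift r s)) = 0%N].
Proof.
move=> u0 zu; have l0 (s : 'I_k) : ell l (sigma (rshift r s)) 0%N u = 0.
  by have := zu (rshift r s); rewrite section_rshift.
have [_ [I vI nI]] : node_vectors u.
  apply: node_of_zero_split => // [i|s]; first by have := zu (lshift k i); rewrite section_lshift.
  by rewrite pencil_paramE color_form_eval (bigD1 (Ordinal d_gt0)) //= l0 mul0r.
exists I; split=> // s; apply/eqP; apply: contraT => I0; rewrite eq_sym in I0.
by have := grid_distinct vI u0 nI (ltn_ord _) d_gt0 I0; rewrite l0 eqxx.
Qed.

Lemma grid_section_transversal : transversal sec.
Proof.
move=> u u0 zu v sv; have [I [vI nI I0]] := section_node u0 zu.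
apply: (node_transversal u0).
  by move=> i; apply: pencil_form_node; split=> //; exists I.
move=> i; rewrite -(splitK i); case: (fintype.split i) => [c|s] /=.
  by have := sv (lshift k c); rewrite section_lshift.
rewrite -/(gK s) pencil_paramE (dif_color_form _ vI nI) // I0.
have := sv (rshift r s); rewrite section_rshift dif_lform => E.
by rewrite /ell E mulr0.
Qed.

Definition section_index (J : {ffun 'I_r -> 'I_d}) (j : nat) : nat :=
  if insub j is Some j' then
    (if fintype.split (invF sigma_inj j') is inl b then J b : nat else 0%N) else 0%N.

Lemma section_index_lshift J b : section_index J (sigma (lshift k b)) = J b.
Proof.
by rewrite /section_index valK invF_f -[lshift k b]/(unsplit (inl b)) unsplitK.
Qed.

Lemma section_index_rshift J s : section_index J (sigma (rshift r s)) = 0%N.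
Proof.
by rewrite /section_index valK invF_f -[rshift r s]/(unsplit (inr s)) unsplitK.
Qed.

Lemma valid_section_index J : valid n d (section_index J).
Proof.
move=> j jn; rewrite /section_index insubT; by case: fintype.split.
Qed.

(** The reference section is transversal, and its points are the d^r nodes of [section_index].
    Generic sections are transversal as well, so [section_count] gives them the same number of
    points. *)
Lemma zero_set_degree : has_degree X (d ^ r).
Proof.
exists k; first exact: zero_set_has_dim.
have Na u : u != 0 -> common_zero sec u -> (lform a).@[u 0] != 0.
  by move=> u0 /(section_node u0) [I [vI nI _]]; apply: node_form; split=> //; exists I.
have [G G0 HG] := generic_transversal Func pencil_eqn_homog grid_section_transversal Na.
exists G => // l1 /HG tl1.
pose T := {ffun 'I_r -> 'I_d}.
have -> : (d ^ r)%N = #|T| by rewrite card_ffun !card_ord.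
have /choice [p Hp] (i : 'I_#|T|) : exists p : V, p != 0 /\
    on_node l (section_index (enum_val i)) p.
  by have [p p0 np] := grid_node (valid_section_index (enum_val i)); exists p.
apply: (section_count Func pencil_eqn_homog d_gt0 (h := sec) (p := p)) => //.
- by move=> i; apply: section_system_homog; apply: pencil_eqn_homog.
- exact: grid_section_transversal.
- by move=> i; apply: (Hp i).1.
- move=> i j c pij; apply: enum_val_inj; apply/ffunP => b; apply/val_inj/eqP.
  rewrite /= -!section_index_lshift; apply: contraT => ne.
  have [[pi0 pi] [pj0 pj]] := (Hp i, Hp j).
  have := grid_distinct (valid_section_index _) pi0 pi (ltn_ord (sigma (lshift k b))).
  rewrite eq_sym in ne.
  move=> /(_ _ (valid_section_index (enum_val j) (ltn_ord _)) ne).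
  by rewrite pij /ell lformZ [X in _ * X]pj // mulr0 eqxx.
- move=> i j; rewrite -(splitK j); case: (fintype.split j) => [c|s] /=.
    rewrite section_lshift; apply: pencil_form_node; split; first exact: (Hp i).1.
    by exists (section_index (enum_val i)); [exact: valid_section_index | exact: (Hp i).2].
  rewrite section_rshift; have := (Hp i).2 _ (ltn_ord (sigma (rshift r s))).
  by rewrite section_index_rshift.
move=> u u0 /(section_node u0) [I [vI nI I0]].
pose J : T := [ffun b => Ordinal (vI _ (ltn_ord (sigma (lshift k b))))].
have nJ : on_node l (section_index J) u.
  move=> j jn; pose j' := Ordinal jn; rewrite -[j]/(val j') -(f_invF sigma_inj j').
  rewrite -(splitK (invF sigma_inj j')); case: (fintype.split _) => [b|s] /=.
    by rewrite section_index_lshift ffunE; apply: nI.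
  by rewrite section_index_rshift -(I0 s); apply: nI.
exists (enum_rank J); have [p0 np] := Hp (enum_rank J); rewrite enum_rankK in np.
exact: node_line (valid_section_index J) p0 np nJ.
Qed.

End PencilOfCages.

(** * From cages to grids *)

Lemma hyperplane_form (F : closedFieldType) n (H : {vspace 'rV[F]_n.+1}) : \dim H = n ->
  exists a : 'rV[F]_n.+1, forall v, (v \in H) = ((lform a).@[v 0] == 0).
Proof.
move=> dH; pose A := \matrix_(i < n) (vbasis H)`_i.
have /rowV0Pn [a /sub_kermxP aA a0] : kermx A^T != 0.
  by rewrite -mxrank_eq0 mxrank_ker subn_eq0 -ltnNge ltnS rank_leq_col.
have lE (v : 'rV[F]_n.+1) : (lform a).@[v 0] = (v *m a^T) 0 0.
  by rewrite lform_eval mxE; apply: eq_bigr => i _; rewrite mxE mulrC.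
pose f := linfun (mulmxr a^T : 'rV[F]_n.+1 -> 'rV_1).
have fE (v : 'rV[F]_n.+1) : (v \in lker f) = ((lform a).@[v 0] == 0).
  rewrite memv_ker lfunE /= lE; apply/eqP/eqP => [->|E]; first by rewrite mxE.
  by apply/rowP => i; rewrite ord1 E mxE.
have HL : (H <= lker f)%VS.
  apply/subvP => v /coord_vbasis ->; apply: memv_suml => i _; apply: memvZ.
  have Aa : A *m a^T = 0 by rewrite -[A]trmxK -trmx_mul aA trmx0.
  rewrite memv_ker lfunE /= -[_`_i]/((vbasis H)`_(cast_ord dH i)).
  by rewrite -(rowK (fun i => (vbasis H)`_i)) -row_mul Aa row0.
exists a => v; rewrite -fE; suff -> : H = lker f by [].
apply/eqP; rewrite eqEdim HL dH /=.
rewrite leqNgt; apply/negP => dL; case/rV0Pn: a0 => i ai.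
have : (delta_mx 0 i : 'rV[F]_n.+1) \in lker f.
  have -> : lker f = fullv; last exact: memvf.
  apply/eqP; rewrite eqEdim subvf dimvf dim_matrix; apply: leq_trans dL.
  by rewrite mul1r.
rewrite fE lform_eval (bigD1 i) //= big1 ?addr0 => [|j ji].
  by rewrite mxE !eqxx mulr1 (negPf ai).
by rewrite mxE (negPf ji) andbF mulr0.
Qed.

Section Cages.
Variables (F : closedFieldType) (n d : nat) (K : cage F n d) (o : 'I_n -> {perm 'I_d}).
Local Notation V := 'rV[F]_n.+1.

Definition cage_index I (vI : valid n d I) : {ffun 'I_n -> 'I_d} :=
  [ffun j : 'I_n => Ordinal (vI j (ltn_ord j))].

Definition cage_node I (vI : valid n d I) : proj F n :=
  node K [ffun j => o j (cage_index vI j)].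

(** The permutations [o] are absorbed into the numbering, which turns a supra-simplicial set into
    the standard simplex of indices. *)
Definition cage_grid (l : nat -> nat -> V) := forall I (vI : valid n d I) v,
  on_node l I v <-> v \in val (cage_node vI).

Lemma cage_grid_exists : exists l, cage_grid l.
Proof.
have /choice [a Ha] (ji : 'I_n * 'I_d) : exists a : V, forall v,
    (v \in hyperplane K ji.1 (o ji.1 ji.2)) = ((lform a).@[v 0] == 0).
  by apply: hyperplane_form; apply: hyperplane_dim.
exists (fun j i => if insub j is Some j' then
  (if insub i is Some i' then a (j', i') else 0) else 0) => I vI v.
rewrite memvE /=; split=> [nv|/subv_bigcapP nv j jn].
  apply/subv_bigcapP => j _; rewrite -memvE !ffunE (Ha (j, _)).
  have := nv j (ltn_ord j); rewrite /ell valK.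
  by rewrite (insubT (fun i => (i < d)%N) (vI j (ltn_ord j))) => /eqP.
have := nv (Ordinal jn) isT; rewrite -memvE !ffunE (Ha (_, _)) => /eqP.
rewrite /ell (insubT (fun i => (i < n)%N) jn) (insubT (fun i => (i < d)%N) (vI j jn)) /= => E.
by rewrite -[RHS]E; congr (lform (a (_, _))).@[_]; apply: val_inj.
Qed.

Variable l : nat -> nat -> V.
Hypothesis gridl : cage_grid l.

Lemma cage_grid_node I : valid n d I -> exists2 v : V, v != 0 & on_node l I v.
Proof.
move=> vI; have [v v0 vE] := proj_rep (cage_node vI).
by exists v => //; apply/(gridl vI); rewrite vE memv_line.
Qed.

Lemma cage_grid_line I (p q : V) : valid n d I -> p != 0 -> on_node l I p -> on_node l I q ->
  exists c, q = c *: p.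
Proof.
move=> vI p0 /(gridl vI) np /(gridl vI); rewrite (ptP p0 np) => /vlineP [c ->].
by exists c.
Qed.

Lemma cage_grid_distinct I (v : V) j i : valid n d I -> v != 0 -> on_node l I v ->
  (j < n)%N -> (i < d)%N -> i != I j -> ell l j i v != 0.
Proof.
move=> vI v0 nv jn id; apply: contraNneq => E.
have vI' := upd_valid j vI id.
have nv' : on_node l (upd I j i) v.
  by move=> c cn; rewrite /upd; case: eqP => [->|_]; [apply: E | apply: nv].
move/(gridl vI): nv => /(ptP v0) nv; move/(gridl vI'): nv' => /(ptP v0) nv'.
have /(congr1 val) /cage_distinct /ffunP /(_ (Ordinal jn)) : cage_node vI = cage_node vI'.
  by rewrite nv nv'.
by rewrite !ffunE => /perm_inj /(congr1 val) /= ->; rewrite upd_same.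
Qed.

(** The [n] equations at a node cut out a line, so their matrix has full rank; the rows of a left
    inverse are the dual vectors. *)
Lemma cage_grid_dual I j : valid n d I -> (j < n)%N ->
  exists v, ell l j (I j) v = 1 /\ forall i, (i < n)%N -> i != j -> ell l i (I i) v = 0.
Proof.
move=> vI jn; have [p p0 np] := cage_grid_node vI.
pose A := \matrix_(c < n.+1, j < n) l j (I j) 0 c.
have AE (w : V) (i : 'I_n) : (w *m A) 0 i = ell l i (I i) w.
  by rewrite mxE /ell lform_eval; apply: eq_bigr => c _; rewrite mxE mulrC.
have /row_fullP [D DA] : row_full A.
  apply: (line_kernel_full (p := p)) => q qA; apply: (cage_grid_line vI p0 np) => c cn.
  by rewrite -(AE q (Ordinal cn)) qA mxE.
exists (row (Ordinal jn) D); split=> [|i iN ij].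
  by rewrite -(AE _ (Ordinal jn)) -row_mul DA !mxE eqxx.
rewrite -(AE _ (Ordinal iN)) -row_mul DA !mxE.
by case: eqP => // /(congr1 val) /= E; rewrite E eqxx in ij.
Qed.

End Cages.

Lemma free_base (F : fieldType) m n (L : 'M[F]_(m, n)) r : \rank L = r ->
  exists2 M : 'M_(r, n), row_free M & (M == L)%MS.
Proof. by move=> <-; exists (row_base L); [exact: row_base_free | apply/eqmxP/eq_row_base]. Qed.

Lemma pivot_columns (F : fieldType) r k (M : 'M[F]_(r, r + k)) : row_free M ->
  exists2 sigma : 'I_(r + k) -> 'I_(r + k), injective sigma &
    (\matrix_(i, j) M i (sigma (lshift k j)) : 'M_r) \in unitmx.
Proof.
rewrite /row_free -mxrank_tr => rM; have fM : row_full M^T := rM; pose f := fullrankfun fM.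
have f_inj : injective f by apply: fullrankfun_inj.
pose C := ~: [set f b | b in 'I_r].
have cC : #|C| = k by rewrite cardsCs finset.setCK card_imset // !card_ord addKn.
have fC b : f b \notin C by rewrite inE negbK imset_f.
pose h s := enum_val (cast_ord (esym cC) s).
have hC s : h s \in C by apply: enum_valP.
exists (fun i => match fintype.split i with inl b => f b | inr s => h s end).
  move=> i j; rewrite -{2}(splitK i) -{2}(splitK j).
  case: (fintype.split i) => b; case: (fintype.split j) => c.
  - by move/f_inj ->.
  - by move=> E; have := fC b; rewrite E hC.
  - by move=> E; have := fC c; rewrite -E hC.
  - by move/enum_val_inj/cast_ord_inj ->.
rewrite -unitmx_tr; have := fullrowsub_unit fM; congr (_ \in unitmx).
by apply/matrixP => i j; rewrite !mxE -[lshift k i]/(unsplit (inl i)) unsplitK.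
Qed.

Lemma zero_set_comb (F : closedFieldType) n p q (f : 'I_p -> {mpoly F[n.+1]})
  (g : 'I_q -> {mpoly F[n.+1]}) (Q : 'M[F]_(q, p)) :
  (forall i, g i = \sum_j Q i j *: f j) -> zero_set (range f) `<=` zero_set (range g).
Proof.
move=> gE x fx _ [i _ <-] u ux; rewrite gE rmorph_sum /= big1 // => j _.
by rewrite mevalZ fx ?mulr0 //; exists j.
Qed.

(** The [m] equations may be dependent; a basis of the row space of [L] has the same zero set and
    consists of [r] equations with pivots. *)
Lemma cage_intersection (F : closedFieldType) r k d m (K : cage F (r + k) d)
    (o : 'I_(r + k) -> {perm 'I_d}) l (L : 'M[F]_(m, r + k)) :
  uncountable_field F -> (0 < d)%N -> cage_grid K o l -> \rank L = r ->
  let V := zero_set (range (fun j => \sum_c L j c *: color_form d l c)) in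
  [/\ has_dim V k, complete_intersection V (nseq_tuple r d),
      forall I, smooth_at V (node K I) & has_degree V (d ^ r)].
Proof.
move=> Func d0 gridl rL V; have [M fM /eqmxP ML] := free_base rL.
have [sigma sigma_inj Mu] := pivot_columns fM.
have dual := cage_grid_dual gridl; have nodes := cage_grid_node gridl.
have distinct := cage_grid_distinct gridl.
have [a na] := node_form_exists dual nodes distinct sigma_inj Mu.
have VE : V = zero_set (range (pencil_eqn d l M sigma)).
  have [/submxP [P PE] /submxP [Q QE]] : (M <= L)%MS /\ (L <= M)%MS by rewrite !ML.
  apply/seteqP; split; [apply: (zero_set_comb (Q := P)) | apply: (zero_set_comb (Q := Q))] => i.
    rewrite pencil_eqnE; under [RHS]eq_bigr do rewrite scaler_sumr.
    rewrite exchange_big /= PE; apply: eq_bigr => c _; rewrite mxE scaler_suml.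
    by apply: eq_bigr => j _; rewrite scalerA.
  under [RHS]eq_bigr do rewrite pencil_eqnE scaler_sumr.
  rewrite exchange_big /= QE; apply: eq_bigr => c _; rewrite mxE scaler_suml.
  by apply: eq_bigr => j _; rewrite scalerA.
rewrite VE; split.
- exact: zero_set_has_dim sigma_inj Mu a na.
- exact: zero_set_complete_intersection sigma_inj Mu a na.
- move=> I; have [u u0 uE] := proj_rep (node K I).
  have uI : u \in val (node K I) by rewrite uE memv_line.
  pose I' (j : nat) : nat := if insub j is Some j' then (o j')^-1%g (I j') else 0%N.
  have vI' : valid (r + k) d I' by move=> j jn; rewrite /I' insubT.
  apply: (node_smooth Func d0 dual nodes distinct sigma_inj Mu na u0 uI _).1.
  split=> //; exists I' => //; apply/(gridl _ vI'); move: uI; congr (u \in val (node K _)).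
  apply/ffunP => j; rewrite !ffunE -[LHS](permKV (o j)); congr (o j _); apply: val_inj.
  by rewrite /= /I' valK.
- exact: zero_set_degree sigma_inj Mu a na.
Qed.

Lemma dhomog0_eq0 (F : closedFieldType) n (f : {mpoly F[n.+1]}) (u : 'rV_n.+1) :
  f \is 0.-homog -> f.@[u 0] = 0 -> f = 0.
Proof.
move=> fh fu; have const (v : 'rV_n.+1) : f.@[v 0] = f.@[(0 : 'rV_n.+1) 0].
  by have := dhomog_meval 0 v fh; rewrite expr0 mul1r scale0r.
apply: mpoly_eq0_fun => b.
rewrite -(@meval_eq _ _ ((\row_i b i : 'rV_n.+1) 0)) => [|i]; last by rewrite mxE.
by rewrite const -(const u).
Qed.

Lemma supra_simplicial_span (F : closedFieldType) n d (K : cage F n d)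
    (o : 'I_n -> {perm 'I_d}) l f e :
  (0 < d)%N -> cage_grid K o l -> f != 0 -> f \is e.-homog -> (e <= d)%N ->
  (forall I : {ffun 'I_n -> 'I_d}, (\sum_(j < n) (I j).+1 <= d + n)%N ->
    vanishes f (node K [ffun j => o j (I j)])) ->
  exists c : 'I_n -> F, f = \sum_(j < n) c j *: color_form d l j.
Proof.
move=> d0 gridl f0 fh ed fA.
apply: (simplex_span d0 (cage_grid_dual gridl) (cage_grid_node gridl)
  (cage_grid_distinct gridl) f0 fh ed) => I vI sI v v0 /(gridl I vI) nv.
apply: (fA (cage_index vI)) nv.
(* Indices start at 0, and the n successors account for the n in the bound d + n. *)
under eq_bigr do rewrite ffunE /= -addn1.
by rewrite big_split /= sum_nat_const card_ord muln1 leq_add2r.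
Qed.

Theorem theorem2p2 (R : realType) (n d s : nat) (K : cage R[i] n d)
    (A V : set (proj R[i] n)) (m : nat)
    (f : 'I_m -> {mpoly R[i][n.+1]})
    (m_gt0 : (0 < m)%N)
    (f_neq0 : forall j, f j != 0)
    (f_homog : forall j, exists2 e, (e <= d)%N & f j \is e.-homog)
    (V_eq : V = zero_set (range f))
    (V_codim : has_codim V s)
    (A_supra : supra_simplicial K A)
    (A_sub_V : A `<=` V) :
  [/\ complete_intersection V (nseq_tuple s d),
      forall I : {ffun 'I_n -> 'I_d}, smooth_at V (node K I) &
      forall k, has_dim V k -> has_degree V (d ^ (n - k))].
Proof.
have [k dimV ksn] := V_codim.
(* For d = 0 the equations would be nonzero constants without zeros, while a set with a dimension is
   nonempty. *)
have d_gt0 : (0 < d)%N.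
  rewrite lt0n; apply/eqP => d0; have [[c [irrc _ cV]] _] := dimV.
  have [_ [x cx] _] := irrc k (leqnn k).
  have [u u0 xu] := proj_rep x.
  have fu : (f (Ordinal m_gt0)).@[u 0] = 0.
    by have := cV _ cx; rewrite V_eq; apply; [exists (Ordinal m_gt0) | rewrite xu memv_line].
  have [e] := f_homog (Ordinal m_gt0); rewrite d0 leqn0 => /eqP -> fh.
  by have := f_neq0 (Ordinal m_gt0); rewrite (dhomog0_eq0 fh fu) eqxx.
have [o AE] := A_supra; have [l gridl] := cage_grid_exists K o.
have /choice [L LE] (j : 'I_m) : exists c : 'I_n -> R[i],
    f j = \sum_(c0 < n) c c0 *: color_form d l c0.
  have [e ed fh] := f_homog j.
  apply: (supra_simplicial_span d_gt0 gridl (f_neq0 j) fh ed) => I sI.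
  have : V (node K [ffun j => o j (I j)]) by apply: A_sub_V; rewrite AE; exists I.
  by rewrite V_eq; apply; exists j.
pose Lam := \matrix_(j, c) L j c.
(* The rank is the codimension: uniqueness of the dimension gives s = r at the end. *)
have [r rL] : exists r, \rank Lam = r by exists (\rank Lam).
have fE : f = fun j => \sum_(c < n) Lam j c *: color_form d l c.
  by apply/funext => j; rewrite LE; apply: eq_bigr => c _; rewrite mxE.
have [k' nE] : exists k', n = (r + k')%N.
  by exists (n - r)%N; rewrite subnKC // -rL rank_leq_col.
move: ksn => /eqP ksn; move: Lam rL fE => Lam rL fE; clear L LE; subst n.
have [] := cage_intersection (@uncountable_complex R) d_gt0 gridl rL.
rewrite -fE -V_eq => dimV' ci smooth deg.
have kk' := has_dim_uniq dimV dimV'.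
have -> : s = r by rewrite kk' in ksn; lia.
split=> // k2 /(has_dim_uniq dimV') <-.
by rewrite addnK.
Qed.
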